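(* For each integer $n \geq 2$, the N\''obeling space $N^n_{n-2}$ has an $(n-2)$-dimensional compactification that embeds into $\mathbb{R}^n$; that is, there is a compact metrizable space $K$ with $\dim K = n-2$ containing a dense subspace homeomorphic to $N^n_{n-2}$, such that $K$ is homeomorphic to a subset of $\mathbb{R}^n$.
   Context: For integers $0 \le m \le n$, the N\''obeling space $N^n_m$ is the subset of $\mathbb{R}^n$ consisting of all points having at most $m$ rational coordinates. $\dim$ denotes covering dimension. *)

(* Defs.v *)
From Stdlib Require Import Reals QArith Qreals List.
From Stdlib Require Vectors.Fin.
Open Scope R_scope.

Definition Rn (n : nat) : Type := Fin.t n -> R.

Definition subset_of (n : nat) : Type := Rn n -> Prop.

(** Open sup-norm balls; they generate the standard (product = Euclidean)
    topology of R^n. *)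
Definition near {n : nat} (x y : Rn n) (r : R) : Prop :=
  forall i : Fin.t n, Rabs (x i - y i) < r.

Definition relopen {n : nat} (A U : subset_of n) : Prop :=
  forall x, A x -> U x ->
    exists r, 0 < r /\ forall y, A y -> near x y r -> U y.

Definition compact_set {n : nat} (A : subset_of n) : Prop :=
  forall (I : Type) (U : I -> subset_of n),
    (forall i, relopen A (U i)) ->
    (forall x, A x -> exists i, U i x) ->
    exists l : list I, forall x, A x -> exists i, In i l /\ U i x.

Definition dense_in {n : nat} (D K : subset_of n) : Prop :=
  (forall x, D x -> K x) /\
  forall x, K x -> forall r, 0 < r -> exists y, D y /\ near x y r.

Definition cont_on {n m : nat} (A : subset_of n) (B : subset_of m)
  (f : Rn n -> Rn m) : Prop :=
  (forall x, A x -> B (f x)) /\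
  forall x, A x -> forall eps, 0 < eps ->
    exists delta, 0 < delta /\
      forall y, A y -> near x y delta -> near (f x) (f y) eps.

Definition homeomorphic {n m : nat} (A : subset_of n) (B : subset_of m) : Prop :=
  exists (f : Rn n -> Rn m) (g : Rn m -> Rn n),
    cont_on A B f /\ cont_on B A g /\
    (forall x, A x -> g (f x) = x) /\
    (forall y, B y -> f (g y) = y).

Definition is_rational (r : R) : Prop := exists q : Q, r = Q2R q.

Definition Nobeling (n m : nat) : subset_of n :=
  fun x => exists l : list (Fin.t n), (length l <= m)%nat /\
    forall i, is_rational (x i) -> In i l.

Definition empty_set {n : nat} : subset_of n := fun _ => False.

Definition finite_open_cover {n : nat} (A : subset_of n) (Us : list (subset_of n)) : Prop :=
  (forall U, In U Us -> relopen A U) /\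
  (forall x, A x -> exists U, In U Us /\ U x).

Definition covdim_le {n : nat} (A : subset_of n) (k : nat) : Prop :=
  forall Us : list (subset_of n), finite_open_cover A Us ->
    exists Vs : list (subset_of n),
      finite_open_cover A Vs /\
      (forall V, In V Vs -> exists U, In U Us /\ forall x, A x -> V x -> U x) /\
      (forall x, A x -> exists l : list nat, (length l <= S k)%nat /\
         forall j, (j < length Vs)%nat -> nth j Vs empty_set x -> In j l).

(** dim A = k (k >= 0): dim A <= k and not dim A <= k-1
    (for k = 0, "not dim A <= -1" means A is nonempty). *)
Definition covdim_eq {n : nat} (A : subset_of n) (k : nat) : Prop :=
  covdim_le A k /\
  match k with
  | O => exists x, A x
  | S k' => ~ covdim_le A k'
  end.

(* Main.v *)
Require Import Defs.
From Stdlib Require Reals QArith Qreals List.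
From Stdlib Require Vectors.Fin.
From mathcomp Require all_boot all_order all_algebra fingroup perm.
From mathcomp Require boolp classical_sets cardinality reals topology normedtype Rstruct.
From mathcomp Require ring lra zify.

(* An embedding of the Noebeling space into R^n whose closure misses every line parallel to an axis
   through a rational point is enough: this closure has dimension at most n - 2, because its points have
   at most n - 2 coordinates on a rational grid, and at least n - 2, because the space contains a cube of
   that dimension.

   Its inverse is a limit of maps g of R^n onto itself, close to the identity, each injective off the
   preimage of a bad set Z which, inside a box, lies on lines with all coordinates but one in a countable
   set D. To process a rational line l, first precompose g with a small map theta, so that the curve
   g (theta l) runs parallel to the axes off Z and countably many bends: this is possible since g is
   locally conical off the preimage of Z, and pieces of g l can be pushed to staircases in disjoint
   neighbourhoods that shrink towards Z. Then collapse a tube around l onto l; the tube is mapped by the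
   new g into the enlarged bad set. In the limit, points with two coordinates outside the union of the
   sets D have one preimage, depending continuously on them and away from all rational lines. Finally a
   homeomorphism of the real line moves the union of the sets D into the rationals. *)

Module Compactification.
Import all_boot all_order all_algebra.
Import boolp classical_sets cardinality reals topology normedtype.
Import fingroup perm Rstruct.
Import ring lra zify.
Set Implicit Arguments.
Unset Strict Implicit.
Unset Printing Implicit Defensive.
Import Order.TTheory GRing.Theory Num.Theory.
Import numFieldNormedType.Exports.
Local Open Scope classical_set_scope.
Local Open Scope ring_scope.

(** * Continuity and compactness for the sup norm *)

Section Basics.
Variables (R : realType) (n : nat).
Local Notation X := 'rV[R]_n.

Lemma norm_rV_le (x : X) (r : R) : 0 <= r -> (`|x| <= r) <-> forall j, `|x 0 j| <= r.
Proof.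
move=> r0; have -> : `|x| = mx_norm x by []; rewrite mx_normrE; split.
  by move=> /bigmax_leP [_ h] j; apply: (h (0, j)).
move=> h; apply/bigmax_leP; split=> // -[i j] _ /=.
by rewrite (ord1 i).
Qed.

Lemma norm_rV_lt (x : X) (r : R) : 0 < r -> (`|x| < r) <-> forall j, `|x 0 j| < r.
Proof.
move=> r0; have -> : `|x| = mx_norm x by []; rewrite mx_normrE; split.
  by move=> /bigmax_ltP [_ h] j; apply: (h (0, j)).
move=> h; apply/bigmax_ltP; split=> // -[i j] _ /=.
by rewrite (ord1 i).
Qed.

Lemma coord_le_norm (x : X) j : `|x 0 j| <= `|x|.
Proof. by have [h _] := @norm_rV_le x `|x| (normr_ge0 _); apply: h. Qed.

Lemma gauge_compact (d : X -> R) (B : R) :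
  (forall x, 0 < d x) ->
  exists s : seq X, forall x, `|x| <= B -> exists2 z, z \in s & `|x - z| < d z.
Proof.
move=> d0.
have cA : compact [set x : X | `|x| <= B]%classic.
  apply: bounded_closed_compact.
    exists B; split; first exact: num_real.
    by move=> M BM x /= xB; apply: le_trans xB (ltW BM).
  have -> : [set x : X | `|x| <= B]%classic = (fun x : X => `|x|) @^-1` [set r : R | r <= B].
    by [].
  apply: closed_comp; last exact: closed_le.
  by move=> x _; apply: norm_continuous.
have cov : cover_compact [set x : X | `|x| <= B]%classic by rewrite -compact_cover.
have [||D _ Dc] := cov X setT (fun z => ball z (d z)).
- by move=> i _; exact: ball_open.
- by move=> x _; exists x => //; apply: ballxx.
exists (finmap.enum_fset D) => x xB.
have [z /= zD xz] := Dc x xB.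
exists z => //; move: xz; rewrite mx_norm_ball /ball_ /= distrC //.
Qed.
End Basics.

Definition contat (R : realType) (V W : normedZmodType R) (f : V -> W) (x : V) :=
  forall e : R, 0 < e -> exists2 d : R, 0 < d & forall y, `|y - x| < d -> `|f y - f x| < e.

Section ContAt.
Variables (R : realType).
Implicit Types V W U : normedZmodType R.

Lemma contat_comp V W U (f : W -> U) (g : V -> W) x :
  contat g x -> contat f (g x) -> contat (f \o g) x.
Proof.
move=> cg cf e e0; have [d d0 hd] := cf e e0; have [d' d'0 hd'] := cg d d0.
by exists d' => // y /hd' /hd.
Qed.

Lemma contat_id V (x : V) : contat id x.
Proof. by move=> e e0; exists e. Qed.

Lemma contat_cst V W (c : W) (x : V) : contat (fun=> c) x.
Proof. by move=> e e0; exists 1 => // y _; rewrite subrr normr0. Qed.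

Lemma contatD V W (f g : V -> W) x :
  contat f x -> contat g x -> contat (fun y => f y + g y) x.
Proof.
move=> cf cg e e0; have e2 : 0 < e / 2 by lra.
have [d d0 hd] := cf _ e2; have [d' d'0 hd'] := cg _ e2.
exists (Num.min d d'); first by rewrite lt_min d0.
move=> y; rewrite lt_min => /andP [/hd h1 /hd' h2].
rewrite opprD addrACA; apply: le_lt_trans (ler_normD _ _) _; lra.
Qed.

Lemma contatN V W (f : V -> W) x : contat f x -> contat (fun y => - f y) x.
Proof.
move=> cf e e0; have [d d0 hd] := cf e e0; exists d => // y /hd.
by rewrite -opprD normrN.
Qed.

Lemma contatM V (f g : V -> R) x :
  contat f x -> contat g x -> contat (fun y => f y * g y) x.
Proof.
move=> cf cg e e0.
pose M := 1 + `|f x| + `|g x|.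
have M0 : 0 < M by rewrite /M; have := normr_ge0 (f x); have := normr_ge0 (g x); lra.
have e2 : 0 < Num.min 1 (e / (2 * M)).
  by rewrite lt_min ltr01 divr_gt0 ?mulr_gt0.
have [d d0 hd] := cf _ e2; have [d' d'0 hd'] := cg _ e2.
exists (Num.min d d'); first by rewrite lt_min d0.
move=> y; rewrite lt_min => /andP [/hd h1 /hd' h2].
move: h1 h2; rewrite !lt_min => /andP[f1 f2] /andP[g1 g2].
have -> : f y * g y - f x * g x = (f y - f x) * g y + f x * (g y - g x) by ring.
apply: le_lt_trans (ler_normD _ _) _; rewrite !normrM.
have gy : `|g y| <= M.
  have -> : g y = (g y - g x) + g x by ring.
  apply: le_trans (ler_normD _ _) _; rewrite /M; have := normr_ge0 (f x); lra.
have fM : `|f x| <= M by rewrite /M; have := normr_ge0 (g x); lra.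
have h3 : `|f y - f x| * `|g y| <= `|f y - f x| * M by rewrite ler_wpM2l.
have h4 : `|f x| * `|g y - g x| <= M * `|g y - g x| by rewrite ler_wpM2r.
have f3 : `|f y - f x| * M < e / (2 * M) * M by rewrite ltr_pM2r.
have g3 : M * `|g y - g x| < M * (e / (2 * M)) by rewrite ltr_pM2l.
have E : e / (2 * M) * M = e / 2 by field; lra.
have E' : M * (e / (2 * M)) = e / 2 by field; lra.
lra.
Qed.

Lemma contat_lip V W (f : V -> W) (k : R) x : 0 <= k ->
  (forall y, `|f y - f x| <= k * `|y - x|) -> contat f x.
Proof.
move=> k0 h e e0; exists (e / (k + 1)); first by apply: divr_gt0; lra.
move=> y hy; apply: le_lt_trans (h y) _.
apply: le_lt_trans (_ : (k + 1) * `|y - x| < _).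
  by rewrite ler_wpM2r // lerDl.
by rewrite mulrC -ltr_pdivlMr //; lra.
Qed.

Lemma contat_norm V (x : V) : contat (fun y : V => `|y| : R) x.
Proof.
apply: (@contat_lip _ _ _ 1) => // y; rewrite mul1r; exact: ler_dist_dist.
Qed.

Lemma contat_abs V (f : V -> R) x : contat f x -> contat (fun y => `|f y|) x.
Proof. by move=> cf; apply: (contat_comp cf); apply: contat_norm. Qed.

Lemma maxr_abs (a b : R) : Num.max a b = (a + b + `|a - b|) / 2.
Proof.
by case: (lerP a b) => h; lra.
Qed.

Lemma contat_row V n (f : V -> 'rV[R]_n) x :
  (forall j, contat (fun y => f y 0 j) x) -> contat f x.
Proof.
move=> h e e0.
have e2 : 0 < e / 2 by lra.
have {h} /choice [d hd] : forall j, exists d : R, 0 < d /\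
     forall y, `|y - x| < d -> `|f y 0 j - f x 0 j| < e / 2.
  by move=> j; have [d d0 hd] := h j _ e2; exists d.
exists (\big[Num.min/1]_j d j).
  by apply/bigmin_gtP; split=> // j _; case: (hd j).
move=> y /bigmin_gtP [_ hy].
apply: le_lt_trans (_ : e / 2 < e); last by lra.
apply/norm_rV_le; first exact: ltW.
by move=> j; rewrite !mxE; apply: ltW; apply: (hd j).2; apply: hy.
Qed.

Lemma contat_coord n (x : 'rV[R]_n) j : contat (fun y : 'rV[R]_n => y 0 j) x.
Proof.
apply: (@contat_lip _ _ _ 1) => // y; rewrite mul1r.
by have := coord_le_norm (y - x) j; rewrite !mxE.
Qed.

End ContAt.

Section Compactness.
Variables (R : realType) (n : nat).
Local Notation X := 'rV[R]_n.

Lemma closed_image_gap (h : X -> X) (C : X -> Prop) (M : R) (x : X) :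
  (forall y, contat h y) -> (forall y, `|h y - y| <= M) ->
  (forall y, ~ C y -> exists2 r : R, 0 < r & forall z, `|z - y| < r -> ~ C z) ->
  (forall y, C y -> h y <> x) ->
  exists2 r : R, 0 < r & forall y, C y -> r <= `|h y - x|.
Proof.
move=> ch hM clC neq.
have /choice [d hd] : forall y, exists d : R * R, [/\ 0 < d.1, 0 < d.2 &
   forall z, `|z - y| < d.1 -> C z -> d.2 <= `|h z - x|].
  move=> y; have [Cy|nCy] := pselect (C y); last first.
    by have [r r0 hr] := clC y nCy; exists (r, 1); split=> // z /hr.
  have p0 : 0 < `|h y - x| / 2.
    by rewrite divr_gt0 // normr_gt0 subr_eq0; apply/eqP; apply: neq.
  have [d d0 hd] := ch y _ p0.
  exists (d, `|h y - x| / 2); split=> // z /hd /= hz _.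
  have : `|h y - x| <= `|h z - h y| + `|h z - x|.
    have -> : h y - x = - (h z - h y) + (h z - x) by rewrite opprB addrA subrK.
    by apply: le_trans (ler_normD _ _) _; rewrite normrN.
  lra.
have [s hs] := @gauge_compact R n (fun y => (d y).1) (`|x| + M + 1) (fun y => let: And3 a _ _ := hd y in a).
exists (\big[Num.min/1]_(z <- s) (d z).2).
  elim/big_ind: _ => // [a b a0 b0|z _]; first by rewrite lt_min a0.
  by case: (hd z).
move=> y Cy; have [yB|yB] := lerP `|y| (`|x| + M + 1); last first.
  apply: le_trans (_ : 1 <= _); first exact: bigmin_le_id.
  have : `|y| <= `|h y - x| + `|h y - y| + `|x|.
    have {1}-> : y = (h y - x) - (h y - y) + x by apply/rowP => j; rewrite !mxE; ring.
    apply: le_trans (ler_normD _ _) _; rewrite lerD2r.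
    by apply: le_trans (ler_normD _ _) _; rewrite normrN.
  have := hM y; lra.
have [z zs yz] := hs y yB.
case: (hd z) => _ _ /(_ y yz Cy); apply: le_trans.
exact: ge_bigmin_seq.
Qed.

Lemma preimage_control (g : X -> X) (M : R) (y0 : X) (e : R) :
  (forall y, contat g y) -> (forall y, `|g y - y| <= M) ->
  (forall y, g y = g y0 -> y = y0) -> 0 < e ->
  exists2 r : R, 0 < r & forall y, `|g y - g y0| < r -> `|y - y0| < e.
Proof.
move=> cg gM inj e0.
have [|y ey yx|r r0 hr] := @closed_image_gap g (fun y => e <= `|y - y0|) M (g y0) cg gM.
- move=> y /negP; rewrite -ltNge => ye; exists (e - `|y - y0|); first by lra.
  move=> z zy; apply/negP; rewrite -ltNge.
  have -> : z - y0 = (z - y) + (y - y0) by rewrite addrA subrK.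
  by apply: le_lt_trans (ler_normD _ _) _; lra.
- by move: ey; rewrite (inj y yx) subrr normr0; lra.
exists r => // y yr; rewrite ltNge; apply/negP => /hr; lra.
Qed.

Lemma heine_cantor (g : X -> X) (B e : R) : (forall y, contat g y) -> 0 < e ->
  exists2 d : R, 0 < d & forall y z, `|y| <= B -> `|z - y| < d -> `|g z - g y| < e.
Proof.
move=> cg e0; have e2 : 0 < e / 2 by lra.
have /choice [d hd] : forall y, exists d : R, 0 < d /\
   forall z, `|z - y| < d -> `|g z - g y| < e / 2.
  by move=> y; have [d d0 hd] := cg y _ e2; exists d.
have d20 y : 0 < d y / 2 by have := (hd y).1; lra.
have [s hs] := @gauge_compact R n (fun y => d y / 2) B d20.
exists (\big[Num.min/1]_(z <- s) (d z / 2)).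
  by elim/big_ind: _ => // a b a0 b0; rewrite lt_min a0.
move=> y z yB zy; have [w ws yw] := hs y yB.
have zy' : `|z - y| < d w / 2.
  by apply: lt_le_trans zy _; apply: ge_bigmin_seq.
have yw1 : `|y - w| < d w by have := (hd w).1; lra.
have zw1 : `|z - w| < d w.
  have -> : z - w = (z - y) + (y - w) by rewrite addrA subrK.
  by apply: le_lt_trans (ler_normD _ _) _; lra.
have := (hd w).2 _ yw1; have := (hd w).2 _ zw1 => h1 h2.
have -> : g z - g y = (g z - g w) - (g y - g w) by rewrite opprB addrA subrK.
by apply: le_lt_trans (ler_normB _ _) _; lra.
Qed.

End Compactness.

(** * Locally conical maps *)

Section LocallyConical.
Variables (R : realType).

(* Affine on small rays from [x]: a pointwise substitute for piecewise linearity, which survives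
   infinitely many modifications as long as they are finite in number near [x]. *)
Definition conical n (F : 'rV[R]_n -> R) (x : 'rV[R]_n) :=
  exists2 r : R, 0 < r & forall (v : 'rV[R]_n) (s : R), `|v| < r -> 0 <= s -> s <= 1 ->
    F (x + s *: v) = F x + s * (F (x + v) - F x).

Definition pl n (F : 'rV[R]_n -> R) x := contat F x /\ conical F x.
Definition plv n m (G : 'rV[R]_n -> 'rV[R]_m) x := forall j, pl (fun y => G y 0 j) x.

Section Fixed.
Variable n : nat.
Local Notation X := 'rV[R]_n.
Implicit Types (F G : X -> R) (x : X).

Lemma pl_eq F G x (r : R) : 0 < r -> (forall y, `|y - x| < r -> F y = G y) -> pl F x -> pl G x.
Proof.
move=> r0 FG [cF [d d0 lF]].
have xx : `|x - x| < r by rewrite subrr normr0.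
split.
  move=> e /cF [d' d'0 h]; exists (Num.min r d'); first by rewrite lt_min r0.
  by move=> y; rewrite lt_min => /andP [y1 y2]; rewrite -!FG //; apply: h.
exists (Num.min r d); first by rewrite lt_min r0.
move=> v s; rewrite lt_min => /andP [v1 v2] s0 s1.
rewrite -!FG //; first exact: lF.
- by rewrite addrAC subrr add0r.
- rewrite addrAC subrr add0r normrZ ger0_norm //.
  by apply: le_lt_trans v1; rewrite ler_piMl.
Qed.

Lemma pl_cst c x : pl (fun=> c) x.
Proof. by split; [exact: contat_cst | exists 1 => // v s _ _ _; rewrite subrr mulr0 addr0]. Qed.

Lemma pl_coord j x : pl (fun y => y 0 j) x.
Proof. by split; [exact: contat_coord | exists 1 => // v s _ _ _; rewrite !mxE; ring]. Qed.

Lemma pl_add F G x : pl F x -> pl G x -> pl (fun y => F y + G y) x.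
Proof.
move=> [cF [d d0 lF]] [cG [d' d'0 lG]]; split; first exact: contatD.
exists (Num.min d d'); first by rewrite lt_min d0.
by move=> v s; rewrite lt_min => /andP [v1 v2] s0 s1; rewrite lF // lG //; ring.
Qed.

Lemma pl_scale (a : R) F x : pl F x -> pl (fun y => a * F y) x.
Proof.
move=> [cF [d d0 lF]]; split; first by apply: contatM => //; apply: contat_cst.
by exists d => // v s v1 s0 s1; rewrite lF //; ring.
Qed.

Lemma pl_opp F x : pl F x -> pl (fun y => - F y) x.
Proof. by move=> /(pl_scale (-1)); apply: (@pl_eq _ _ _ 1) => // y _; rewrite mulN1r. Qed.

Lemma pl_sub F G x : pl F x -> pl G x -> pl (fun y => F y - G y) x.
Proof. by move=> hF hG; apply: pl_add => //; apply: pl_opp. Qed.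

Lemma pl_abs F x : pl F x -> pl (fun y => `|F y|) x.
Proof.
move=> [cF [d d0 lF]]; split; first exact: contat_abs.
case: (eqVneq (F x) 0) => [F0|F0].
  exists d => // v s v1 s0 s1; rewrite lF // F0 normr0 !subr0 !add0r normrM ger0_norm //.
have [d' d'0 hd'] : exists2 d', 0 < d' & forall y, `|y - x| < d' -> `|F y - F x| < `|F x|.
  by apply: cF; rewrite normr_gt0.
exists (Num.min d d'); first by rewrite lt_min d0.
move=> v s; rewrite lt_min => /andP [v1 v2] s0 s1.
have h1 : `|F (x + v) - F x| < `|F x| by apply: hd'; rewrite addrAC subrr add0r.
have h2 : `|F (x + s *: v) - F x| < `|F x|.
  apply: hd'; rewrite addrAC subrr add0r normrZ ger0_norm //.
  by apply: le_lt_trans v2; rewrite ler_piMl.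
move: h1 h2; rewrite lF //; case: (ltrgt0P (F x)) F0 => // Fp _.
  rewrite !ltr_norml => /andP [a b] /andP [c e].
  by rewrite !gtr0_norm; lra.
rewrite !ltr_norml => /andP [a b] /andP [c e].
by rewrite !ltr0_norm; lra.
Qed.

Lemma pl_max F G x : pl F x -> pl G x -> pl (fun y => Num.max (F y) (G y)) x.
Proof.
move=> hF hG; apply: (@pl_eq (fun y => 2^-1 * ((F y + G y) + `|F y - G y|)) _ _ 1) => //.
  by move=> y _; rewrite maxr_abs mulrC.
by apply: pl_scale; apply: pl_add; [exact: pl_add | apply: pl_abs; exact: pl_sub].
Qed.

Lemma pl_min F G x : pl F x -> pl G x -> pl (fun y => Num.min (F y) (G y)) x.
Proof.
move=> hF hG; apply: (@pl_eq (fun y => - Num.max (- F y) (- G y)) _ _ 1) => //.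
  by move=> y _; rewrite oppr_max !opprK.
by apply: pl_opp; apply: pl_max; apply: pl_opp.
Qed.

Lemma pl_sum (I : Type) (s : seq I) (P : pred I) (F : I -> X -> R) x :
  (forall i, pl (F i) x) -> pl (fun y => \sum_(i <- s | P i) F i y) x.
Proof.
move=> h; elim: s => [|i s IH].
  by apply: (@pl_eq (fun=> 0) _ _ 1) => //; [move=> y _; rewrite big_nil | exact: pl_cst].
apply: (@pl_eq (fun y => (if P i then F i y else 0) + \sum_(i <- s | P i) F i y) _ _ 1) => //.
  by move=> y _; rewrite big_cons; case: (P i) => //; rewrite add0r.
by apply: pl_add => //; case: (P i) => //; exact: pl_cst.
Qed.

Lemma pl_bigmax (I : Type) (s : seq I) (P : pred I) (F : I -> X -> R) (c : R) x :
  (forall i, pl (F i) x) -> pl (fun y => \big[Num.max/c]_(i <- s | P i) F i y) x.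
Proof.
move=> h; elim: s => [|i s IH].
  by apply: (@pl_eq (fun=> c) _ _ 1) => //; [move=> y _; rewrite big_nil | exact: pl_cst].
case Pi: (P i).
  apply: (@pl_eq (fun y => Num.max (F i y) (\big[Num.max/c]_(i <- s | P i) F i y)) _ _ 1) => //.
    by move=> y _; rewrite big_cons Pi.
  exact: pl_max.
by apply: (@pl_eq _ _ _ 1) IH => // y _; rewrite big_cons Pi.
Qed.

End Fixed.

Lemma plv_contat n m (G : 'rV[R]_n -> 'rV[R]_m) x : plv G x -> contat G x.
Proof. by move=> h; apply: contat_row => j; case: (h j). Qed.

Lemma plv_conical n m (G : 'rV[R]_n -> 'rV[R]_m) x : plv G x ->
  exists2 r : R, 0 < r & forall (v : 'rV[R]_n) (s : R), `|v| < r -> 0 <= s -> s <= 1 ->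
    G (x + s *: v) = G x + s *: (G (x + v) - G x).
Proof.
move=> h.
have /choice [d hd] : forall j, exists d : R, 0 < d /\ forall (v : 'rV[R]_n) (s : R),
   `|v| < d -> 0 <= s -> s <= 1 ->
    G (x + s *: v) 0 j = G x 0 j + s * (G (x + v) 0 j - G x 0 j).
  by move=> j; have [_ [d d0 hd]] := h j; exists d.
exists (\big[Num.min/1]_j d j).
  by apply/bigmin_gtP; split=> // j _; case: (hd j).
move=> v s /bigmin_gtP [_ hv] s0 s1; apply/rowP => j; rewrite !mxE.
by apply: (hd j).2 => //; apply: hv.
Qed.

Lemma pl_comp n m (F : 'rV[R]_m -> R) (G : 'rV[R]_n -> 'rV[R]_m) x :
  plv G x -> pl F (G x) -> pl (fun y => F (G y)) x.
Proof.
move=> hG [cF [d d0 lF]]; have cG := plv_contat hG; have [d' d'0 lG] := plv_conical hG.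
split; first exact: (contat_comp cG cF).
have [d2 d20 h2] := cG d d0.
exists (Num.min d' d2); first by rewrite lt_min d'0.
move=> v s; rewrite lt_min => /andP [v1 v2] s0 s1.
rewrite lG // lF //; first by rewrite (addrC (G x) (_ - _)) subrK.
by apply: h2; rewrite addrAC subrr add0r.
Qed.

Lemma plv_comp n m k (F : 'rV[R]_m -> 'rV[R]_k) (G : 'rV[R]_n -> 'rV[R]_m) x :
  plv G x -> plv F (G x) -> plv (F \o G) x.
Proof. by move=> hG hF j; apply: (pl_comp hG (hF j)). Qed.

Lemma plv_id n (x : 'rV[R]_n) : plv id x.
Proof. by move=> j; apply: pl_coord. Qed.

Lemma plv_eq n m (F G : 'rV[R]_n -> 'rV[R]_m) x (r : R) :
  0 < r -> (forall y, `|y - x| < r -> F y = G y) -> plv F x -> plv G x.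
Proof. by move=> r0 FG h j; apply: (@pl_eq _ _ _ _ r) (h j) => // y yr; rewrite FG. Qed.

Lemma pl_normv n m (G : 'rV[R]_n -> 'rV[R]_m) x : plv G x -> pl (fun y => `|G y|) x.
Proof.
move=> h; apply: (@pl_eq _ (fun y => \big[Num.max/0]_ij `|G y ij.1 ij.2|) _ _ 1) => //.
  by move=> y _; rewrite -mx_normrE.
by apply: pl_bigmax => -[i j] /=; apply: pl_abs; rewrite (ord1 i); apply: h.
Qed.

End LocallyConical.

(** * Staircase homeomorphisms *)

Lemma half_lip_fixpoint (R : realType) (h : R -> R) (M : R) : 0 <= M ->
  (forall r, 0 <= h r) -> (forall r, h r <= M) ->
  (forall r s, `|h r - h s| <= 2^-1 * `|r - s|) -> exists r, h r = r.
Proof.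
move=> M0 h0 hM clip.
have supE : has_sup [set r : R | 0 <= r <= M /\ r <= h r].
  split; first by exists 0; split; [rewrite lexx | exact: h0].
  by exists M => r [/andP []].
have r0 : 0 <= sup [set r : R | 0 <= r <= M /\ r <= h r].
  by apply: (ub_le_sup (proj2 supE)); split; [rewrite lexx | exact: h0].
have adh := fun e (e0 : 0 < e) => sup_adherent e0 supE.
have ubs := fun z Ez => ub_le_sup (proj2 supE) (x := z) Ez.
exists (sup [set r : R | 0 <= r <= M /\ r <= h r]).
move: (sup _) r0 adh ubs => r r0 adh ubs {supE}.
have clip2 z : h z - h r <= 2^-1 * `|z - r| /\ h r - h z <= 2^-1 * `|z - r|.
  by have := clip z r; rewrite ler_norml => /andP [a b]; split; lra.
apply/eqP; rewrite eq_le; apply/andP; split; rewrite leNgt; apply/negP => hr.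
  have zr : (2 * r + h r) / 3 - r = (h r - r) / 3 by field.
  have z0 : 0 <= (2 * r + h r) / 3 by have := h0 r; lra.
  have [_] := clip2 ((2 * r + h r) / 3); rewrite zr ger0_norm; last by lra.
  move=> c2; have hrM := hM r.
  have /ubs : [set r : R | 0 <= r <= M /\ r <= h r] ((2 * r + h r) / 3).
    by split; [apply/andP; split|]; lra.
  lra.
have q0 : 0 < (r - h r) / 2 by lra.
have [z Ez z3] := adh _ q0; have zr := ubs z Ez; case: Ez => _ z2.
have [c1 _] := clip2 z; move: c1; rewrite ler0_norm; lra.
Qed.

Section Moves.
Variables (R : realType) (n : nat).
Local Notation X := 'rV[R]_n.
Implicit Types (V U c x y : X) (i j : 'I_n).

Definition tau V x : R := \sum_j Num.sg (V 0 j) * x 0 j.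

Lemma tauD V x y : tau V (x + y) = tau V x + tau V y.
Proof. by rewrite /tau -big_split /=; apply: eq_bigr => j _; rewrite mxE mulrDr. Qed.

Lemma tauZ V (a : R) x : tau V (a *: x) = a * tau V x.
Proof. by rewrite /tau mulr_sumr; apply: eq_bigr => j _; rewrite mxE mulrCA. Qed.

Lemma tauN V x : tau V (- x) = - tau V x.
Proof. by rewrite -scaleN1r tauZ mulN1r. Qed.

Lemma tauB V x y : tau V (x - y) = tau V x - tau V y.
Proof. by rewrite tauD tauN. Qed.

Lemma tau_norm V x : `|tau V x| <= n%:R * `|x|.
Proof.
apply: le_trans (ler_norm_sum _ _ _) _.
apply: le_trans (ler_sum _ (_ : forall j, true -> _ <= `|x|)) _.
  move=> j _; rewrite normrM; apply: le_trans (_ : 1 * `|x 0 j| <= _).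
    by rewrite ler_wpM2r // normr_sg; case: (_ != 0).
  by rewrite mul1r coord_le_norm.
by rewrite sumr_const card_ord mulr_natl.
Qed.

Definition unitv i : X := delta_mx 0 i.

Lemma unitvE i j : unitv i 0 j = (j == i)%:R.
Proof. by rewrite mxE eqxx. Qed.

Lemma tau_unitv V i : tau V (unitv i) = Num.sg (V 0 i).
Proof.
rewrite /tau (bigD1 i) //= unitvE eqxx mulr1 big1 ?addr0 // => j ji.
by rewrite unitvE (negbTE ji) mulr0.
Qed.

Definition subvec U V := forall j, U 0 j = V 0 j \/ U 0 j = 0.

Lemma subvec_tau U V : subvec U V -> tau V U = \sum_j `|U 0 j|.
Proof.
move=> UV; apply: eq_bigr => j _; case: (UV j) => ->; last by rewrite mulr0 normr0.
by rewrite normrEsg.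
Qed.

Lemma subvec_tau_ge0 U V : subvec U V -> 0 <= tau V U.
Proof. by move=> /subvec_tau ->; apply: sumr_ge0. Qed.

Lemma subvec_coord_le U V j : subvec U V -> `|U 0 j| <= tau V U.
Proof. by move=> /subvec_tau ->; rewrite (bigD1 j) //= lerDl sumr_ge0. Qed.

Lemma subvec_norm_le U V : subvec U V -> `|U| <= tau V U.
Proof.
move=> UV; apply/norm_rV_le; first exact: subvec_tau_ge0.
by move=> j; apply: subvec_coord_le.
Qed.

Definition mv_height V c U i x : R :=
  let t := tau V (x - c) in let al := `|U 0 i| in let be := tau V U in
  Num.max 0 (Num.min t (al / (be - al) * (be - t)) - 2^-1 * `|x - c - (t / be) *: U|).

Definition mv_dir V U i : X := Num.sg (V 0 i) *: unitv i - (tau V U)^-1 *: U.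

(* The triangle move pushing the segment [c, c+U] onto the broken line
   c, c + U_i e_i, c + U along the direction [mv_dir], which [tau V] kills. *)
Definition mv V c U i x : X := x + mv_height V c U i x *: mv_dir V U i.

Lemma mv_height_ge0 V c U i x : 0 <= mv_height V c U i x.
Proof. by rewrite /mv_height le_max lexx. Qed.

Section OneMove.
Variables (V c U : X) (i : 'I_n) (al be : R).
Hypotheses (UV : subvec U V) (Ui : U 0 i = V 0 i).
Hypotheses (alE : al = `|U 0 i|) (beE : be = tau V U).

Lemma al_ge0 : 0 <= al. Proof. by rewrite alE normr_ge0. Qed.
Lemma al_le_be : al <= be. Proof. by rewrite alE beE subvec_coord_le. Qed.

Lemma mv_heightE x : mv_height V c U i x =
  Num.max 0 (Num.min (tau V (x - c)) (al / (be - al) * (be - tau V (x - c))) -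
             2^-1 * `|x - c - (tau V (x - c) / be) *: U|).
Proof. by rewrite alE beE. Qed.

Lemma mv_height_supp x : mv_height V c U i x != 0 ->
  [/\ 0 < tau V (x - c), tau V (x - c) < be, 0 < al, al < be &
      `|x - c| <= 3 * be /\ mv_height V c U i x <= be].
Proof.
have al0 := al_ge0; have albe := al_le_be.
rewrite mv_heightE; set t := tau V _ => h.
have h0 : 0 < Num.min t (al / (be - al) * (be - t)) - 2^-1 * `|x - c - (t / be) *: U|.
  rewrite ltNge; apply/negP => h1; move: h; rewrite max_l // eqxx //.
have n0 := normr_ge0 (x - c - (t / be) *: U).
have : 0 < Num.min t (al / (be - al) * (be - t)) by lra.
rewrite lt_min => /andP [t0 q0].
have [E|E] := eqVneq (be - al) 0; first by move: q0; rewrite E invr0 mulr0 mul0r ltxx.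
have ab : 0 < be - al by rewrite lt_def E /=; lra.
have q0' : 0 < al * (be - t).
  have -> : al * (be - t) = (al / (be - al) * (be - t)) * (be - al) by field.
  exact: mulr_gt0.
have al_gt0 : 0 < al.
  by rewrite lt_def al0 andbT; apply/eqP => a0; move: q0'; rewrite a0 mul0r ltxx.
have tb : t < be by move: q0'; rewrite pmulr_rgt0 // subr_gt0.
have mb : Num.min t (al / (be - al) * (be - t)) <= be.
  by rewrite ge_min (ltW tb).
split=> //; first by lra.
split; last by rewrite max_r; lra.
have hb : `|x - c - (t / be) *: U| <= 2 * be by lra.
have b0 : 0 < be by lra.
have hU : `|(t / be) *: U| <= be.
  rewrite normrZ ger0_norm; last by apply: divr_ge0; lra.
  apply: le_trans (_ : 1 * `|U| <= _); last by rewrite mul1r beE subvec_norm_le.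
  by rewrite ler_wpM2r // ler_pdivrMr // mul1r ltW.
have -> : x - c = (x - c - (t / be) *: U) + (t / be) *: U by rewrite subrK.
by apply: le_trans (ler_normD _ _) _; lra.
Qed.

Lemma mv_fix x : tau V (x - c) <= 0 \/ be <= tau V (x - c) \/ al <= 0 \/ be <= al -> mv V c U i x = x.
Proof.
move=> h; rewrite /mv; case: (eqVneq (mv_height V c U i x) 0) => [->|/mv_height_supp [h1 h2 h3 h4 _]].
  by rewrite scale0r addr0.
by exfalso; case: h => [h|[h|[h|h]]]; lra.
Qed.

Lemma tau_mv_dir : 0 < al -> tau V (mv_dir V U i) = 0.
Proof.
move=> a0; rewrite /mv_dir tauB !tauZ tau_unitv -beE.
have b0 : be != 0 by have := al_le_be => ?; apply/eqP; lra.
rewrite mulVf // -expr2 sqr_sg -Ui.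
have -> : (U 0 i != 0) = true by rewrite -normr_gt0 -alE.
by rewrite subrr.
Qed.

Lemma mv_dir_norm : 0 < al -> `|mv_dir V U i| <= 1.
Proof.
move=> a0; have albe := al_le_be; have b0 : 0 < be by lra.
apply/norm_rV_le => // j; rewrite /mv_dir !mxE eqxx /= -beE.
case: (eqVneq j i) => [->|ji] /=; last first.
  rewrite mulr0 sub0r normrN normrM normfV (gtr0_norm b0) mulrC ler_pdivrMr // mul1r.
  by rewrite beE; exact: subvec_coord_le.
rewrite mulr1 -Ui.
have E : U 0 i = Num.sg (U 0 i) * al by rewrite alE -numEsg.
have -> : Num.sg (U 0 i) - be^-1 * U 0 i = Num.sg (U 0 i) * (1 - al / be).
  by rewrite {2}E; ring.
have q : 0 <= 1 - al / be by rewrite subr_ge0 ler_pdivrMr // mul1r.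
have q2 : 0 <= al / be by apply: divr_ge0; lra.
rewrite normrM normr_sg -normr_gt0 -alE a0 mul1r ger0_norm //; lra.
Qed.

Lemma tau_mv x : tau V (mv V c U i x) = tau V x.
Proof.
rewrite /mv; case: (eqVneq (mv_height V c U i x) 0) => [->|/mv_height_supp [_ _ a0 _ _]].
  by rewrite scale0r addr0.
by rewrite tauD tauZ tau_mv_dir // mulr0 addr0.
Qed.

Lemma max0_dist (a b : R) : `|Num.max 0 a - Num.max 0 b| <= `|a - b|.
Proof.
case: (lerP 0 a) => a1; case: (lerP 0 b) => b1.
- exact: lexx.
- by rewrite subr0 ger0_norm // ger0_norm; lra.
- by rewrite sub0r normrN ger0_norm // ltr0_norm; lra.
- by rewrite subrr normr0.
Qed.

Lemma mv_height_lip_dir x y : tau V x = tau V y ->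
  `|mv_height V c U i x - mv_height V c U i y| <= 2^-1 * `|x - y|.
Proof.
move=> txy; rewrite !mv_heightE !tauB txy; set t := tau V y - _.
set A := Num.min _ _; set w := (t / be) *: U.
have h : `| (`|x - c - w| - `|y - c - w|) | <= `|x - y|.
  apply: le_trans (ler_dist_dist _ _) _.
  by have -> : x - c - w - (y - c - w) = x - y by apply/rowP => j; rewrite !mxE; ring.
apply: le_trans (max0_dist _ _) _.
by move: h; rewrite !ler_norml => /andP [? ?]; apply/andP; split; lra.
Qed.

Lemma mv_inj : injective (mv V c U i).
Proof.
move=> x y E.
have tE : tau V x = tau V y by rewrite -(tau_mv x) -(tau_mv y) E.
case: (ltrP 0 al) => a0; last by move: E; rewrite !mv_fix; auto.
have : x - y = (mv_height V c U i y - mv_height V c U i x) *: mv_dir V U i.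
  move: E; rewrite /mv; move: (mv_height V c U i x) (mv_height V c U i y) => p q E.
  have -> : x = y + q *: mv_dir V U i - p *: mv_dir V U i by rewrite -E addrK.
  by apply/rowP => j; rewrite !mxE; ring.
move=> /(congr1 (fun z : X => `|z|)); rewrite normrZ.
have h1 := mv_height_lip_dir (esym tE); have h2 := mv_dir_norm a0.
have h3 : `|mv_height V c U i y - mv_height V c U i x| * `|mv_dir V U i| <= `|mv_height V c U i y - mv_height V c U i x| * 1.
  by rewrite ler_wpM2l.
move=> h; have : `|x - y| <= 0 by move: h1; rewrite (distrC y x) => h1; lra.
by rewrite normr_le0 subr_eq0 => /eqP.
Qed.

Lemma tau_lip x y : `|tau V x - tau V y| <= n%:R * `|x - y|.
Proof. by rewrite -tauB tau_norm. Qed.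

Lemma mv_height_lip x y : al <= be - al \/ be <= al ->
  `|mv_height V c U i x - mv_height V c U i y| <= (2 * n%:R + 1) * `|x - y|.
Proof.
have al0 := al_ge0; have albe := al_le_be.
have N0 := normr_ge0 (x - y); have nn : 0 <= n%:R :> R by [].
have z (w : X) : al <= 0 \/ be <= al -> mv_height V c U i w = 0.
  move=> h; apply/eqP/negbNE/negP => /mv_height_supp [_ _ h1 h2 _].
  by case: h; lra.
have nn0 : 0 <= (2 * n%:R + 1) * `|x - y| by apply: mulr_ge0 => //; lra.
move=> ab; case: (ltrP 0 al) => a0; last by rewrite !z ?subrr ?normr0 //; auto.
case: ab => ab; last by rewrite !z ?subrr ?normr0 //; auto.
have b0 : 0 < be by lra.
rewrite !mv_heightE; apply: le_trans (max0_dist _ _) _.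
have tl : `|tau V (x - c) - tau V (y - c)| <= n%:R * `|x - y|.
  by have := tau_lip (x - c) (y - c); have -> : x - c - (y - c) = x - y by apply/rowP => j; rewrite !mxE; ring.
move: tl; set s := tau V (x - c); set t := tau V (y - c) => tl.
have q0 : 0 <= al / (be - al) by apply: divr_ge0; lra.
have q1 : al / (be - al) <= 1 by rewrite ler_pdivrMr; lra.
have h1 : `|Num.min s (al / (be - al) * (be - s)) - Num.min t (al / (be - al) * (be - t))| <= `|s - t|.
  move: q0 q1; set k := al / _ => k0 k1.
  have : `|k * (be - s) - k * (be - t)| <= `|s - t|.
    rewrite -mulrBr normrM (ger0_norm k0).
    have -> : be - s - (be - t) = - (s - t) by ring.
    by rewrite normrN; apply: ler_piMl.
  rewrite !ler_norml; have := ler_norm (s - t); have := ler_norm (- (s - t)); rewrite normrN.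
  move: `|s - t| (k * _) (k * _) => M a b; rewrite !minEle.
  by case: (lerP s b) => ?; case: (lerP t a) => ?; move=> ? ? /andP [? ?]; apply/andP; split; lra.
have h2 : `| (`|x - c - (s / be) *: U| - `|y - c - (t / be) *: U|) | <= `|x - y| + `|s - t|.
  apply: le_trans (ler_dist_dist _ _) _.
  have -> : x - c - (s / be) *: U - (y - c - (t / be) *: U) = (x - y) - ((s - t) / be) *: U.
    by apply/rowP => j; rewrite !mxE; field; lra.
  apply: le_trans (ler_normB _ _) _; rewrite lerD2l normrZ normrM normfV (gtr0_norm b0).
  rewrite -mulrA; apply: ler_piMr => //; rewrite mulrC ler_pdivrMr // mul1r beE.
  exact: subvec_norm_le.
move: h1 h2 tl; move: (Num.min _ _) (Num.min _ _) `|x - c - _| `|y - c - _| => A B C D.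
move: `|s - t| `|x - y| N0 => M N N0; rewrite !ler_norml => /andP [? ?] /andP [? ?] ?.
by apply/andP; split; lra.
Qed.

Lemma mv_lip x y : al <= be - al \/ be <= al ->
  `|mv V c U i x - mv V c U i y| <= (2 * n%:R + 2) * `|x - y|.
Proof.
have al0 := al_ge0; have albe := al_le_be; have N0 := normr_ge0 (x - y).
have nn : 0 <= n%:R :> R by [].
move=> ab; case: (ltrP 0 al) => a0; last first.
  by rewrite !mv_fix; auto; rewrite -[leLHS]mul1r; apply: ler_wpM2r => //; lra.
have h1 := mv_height_lip x y ab; have h2 := mv_dir_norm a0.
have -> : mv V c U i x - mv V c U i y = (x - y) + (mv_height V c U i x - mv_height V c U i y) *: mv_dir V U i.
  by rewrite /mv; apply/rowP => j; rewrite !mxE; ring.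
apply: le_trans (ler_normD _ _) _; rewrite normrZ.
have h3 : `|mv_height V c U i x - mv_height V c U i y| * `|mv_dir V U i| <= `|mv_height V c U i x - mv_height V c U i y| * 1.
  by rewrite ler_wpM2l.
lra.
Qed.

Lemma mv_segment (s : R) : 0 <= s -> s <= 1 ->
  (s * be <= al /\ mv V c U i (c + s *: U) = c + (s * be * Num.sg (V 0 i)) *: unitv i) \/
  (exists s' : R, [/\ 0 <= s', s' <= 1 &
     mv V c U i (c + s *: U) = (c + U 0 i *: unitv i) + s' *: (U - U 0 i *: unitv i)]).
Proof.
have al0 := al_ge0; have albe := al_le_be; move=> s0 s1.
have tE : tau V (c + s *: U - c) = s * be by rewrite addrAC subrr add0r tauZ beE.
have E : U 0 i = Num.sg (V 0 i) * al by rewrite -Ui alE -numEsg.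
have [ab|ab] := lerP be al.
  have {}ab : be = al by lra.
  left; split; first by rewrite ab ler_piMl.
  rewrite mv_fix; last by right; right; right; rewrite ab.
  congr (c + _); apply/rowP => j; rewrite !mxE eqxx /=.
  case: (eqVneq j i) => [->|ji] /=; first by rewrite E ab; ring.
  have := subvec_tau UV; rewrite -beE ab alE (bigD1 i) //= => /eqP.
  rewrite eq_sym -subr_eq0 addrAC subrr add0r psumr_eq0 // => /allP /(_ j (mem_index_enum j)) /=.
  by rewrite ji /= normr_eq0 => /eqP ->; rewrite !mulr0.
have b0 : 0 < be by lra.
have H : mv_height V c U i (c + s *: U) = Num.min (s * be) (al / (be - al) * (be - s * be)).
  rewrite mv_heightE tE mulfK; last by apply/eqP; lra.
  have -> : c + s *: U - c - s *: U = 0 by apply/rowP => j; rewrite !mxE; ring.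
  rewrite normr0 mulr0 subr0 max_r // le_min; apply/andP; split; first by apply: mulr_ge0 => //; lra.
  apply: mulr_ge0; first by apply: divr_ge0; lra.
  by rewrite subr_ge0 ler_piMl //; lra.
rewrite /mv H; have ba : be - al != 0 by apply/eqP; lra.
have bn : be != 0 by apply/eqP; lra.
have [h|h] := lerP (s * be) al; [left; split=> // | right].
  rewrite min_l; last first.
    have -> : al / (be - al) * (be - s * be) = (al * (be - s * be)) / (be - al) by ring.
    rewrite ler_pdivlMr; last by lra.
    have : 0 <= (al - s * be) * be by apply: mulr_ge0; lra.
    lra.
  by rewrite /mv_dir -beE; apply/rowP => j; rewrite !mxE; field.
rewrite min_r; last first.
  have -> : al / (be - al) * (be - s * be) = (al * (be - s * be)) / (be - al) by ring.
  rewrite ler_pdivrMr; last by lra.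
  have : 0 <= (s * be - al) * be by apply: mulr_ge0; lra.
  lra.
have sb : s * be <= be by rewrite ler_piMl //; lra.
exists ((s * be - al) / (be - al)); split.
- by apply: divr_ge0; lra.
- by rewrite ler_pdivrMr; lra.
rewrite /mv_dir -beE E; apply/rowP => j; rewrite !mxE eqxx /=.
case: (eqVneq j i) => [->|ji] /=; last by field; rewrite ba bn.
by rewrite E; field; rewrite ba bn.
Qed.

Lemma pl_affine (a : R) (l : 'I_n -> R) x : pl (fun y : X => a + \sum_j l j * y 0 j) x.
Proof.
apply: pl_add; first exact: pl_cst.
by apply: pl_sum => j; apply: pl_scale; apply: pl_coord.
Qed.

Lemma pl_tau x : pl (fun y => tau V (y - c)) x.
Proof.
apply: (@pl_eq _ _ (fun y => - tau V c + \sum_j Num.sg (V 0 j) * y 0 j) _ _ 1) => //.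
  by move=> y _; rewrite tauB addrC.
exact: pl_affine.
Qed.

Lemma plv_mv x : plv (mv V c U i) x.
Proof.
move=> j; apply: (@pl_eq _ _ (fun y => y 0 j + mv_dir V U i 0 j * mv_height V c U i y) _ _ 1) => //.
  by move=> y _; rewrite /mv !mxE; ring.
apply: pl_add; first exact: pl_coord.
apply: pl_scale; rewrite /mv_height -alE -beE.
apply: pl_max; first exact: pl_cst.
apply: pl_sub.
  apply: pl_min; first exact: pl_tau.
  apply: pl_scale; apply: pl_sub; [exact: pl_cst | exact: pl_tau].
apply: pl_scale; apply: pl_normv => k.
apply: (@pl_eq _ _ (fun y => (y 0 k - c 0 k) - (be^-1 * U 0 k) * tau V (y - c)) _ _ 1) => //.
  by move=> y _; rewrite !mxE; ring.
apply: pl_sub; first by apply: pl_sub; [exact: pl_coord | exact: pl_cst].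
by apply: pl_scale; exact: pl_tau.
Qed.

Lemma mv_surj y : exists x, mv V c U i x = y.
Proof.
have al0 := al_ge0; have albe := al_le_be.
case: (ltrP 0 al) => a0; last by exists y; rewrite mv_fix; auto.
have b0 : 0 < be by lra.
pose h (r : R) := mv_height V c U i (y - r *: mv_dir V U i).
have hM r : h r <= be.
  rewrite /h; set w := y - _; case: (eqVneq (mv_height V c U i w) 0) => [->|/mv_height_supp []]; first exact: ltW.
  by move=> _ _ _ _ [].
have clip r s : `|h r - h s| <= 2^-1 * `|r - s|.
  apply: le_trans (mv_height_lip_dir _) _.
    by rewrite !tauB !tauZ tau_mv_dir // !mulr0.
  have -> : y - r *: mv_dir V U i - (y - s *: mv_dir V U i) = (s - r) *: mv_dir V U i.
    by apply/rowP => j; rewrite !mxE; ring.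
  apply: ler_wpM2l; first by lra.
  rewrite normrZ distrC; apply: ler_piMr => //; exact: mv_dir_norm.
have h0 r : 0 <= h r by exact: mv_height_ge0.
have [r rh] := half_lip_fixpoint (ltW b0) h0 hM clip.
exists (y - r *: mv_dir V U i); rewrite /mv -/(h r) rh.
by rewrite subrK.
Qed.

End OneMove.
End Moves.

Section Stair.
Variables (R : realType) (n : nat).
Local Notation X := 'rV[R]_n.
Implicit Types (V U c x y : X) (i j : 'I_n) (l : seq 'I_n).

Fixpoint stair V l c U : X -> X :=
  if l is i :: l' then
    stair V l' (c + U 0 i *: unitv R i) (U - U 0 i *: unitv R i) \o mv V c U i
  else id.

Definition vec_on V l U := forall j, U 0 j = if j \in l then V 0 j else 0.

Definition abs_le V i j := `|V 0 i| <= `|V 0 j|.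

Lemma vec_on_subvec V l U : vec_on V l U -> subvec U V.
Proof. by move=> h j; rewrite h; case: ifP; auto. Qed.

Lemma vec_on_cons V i l U : uniq (i :: l) -> vec_on V (i :: l) U ->
  U 0 i = V 0 i /\ vec_on V l (U - U 0 i *: unitv R i).
Proof.
move=> /= /andP [il _] h; split; first by rewrite h inE eqxx.
move=> j; rewrite !mxE eqxx /= h h !inE eqxx /=.
case: (eqVneq j i) => [->|ji] /=; first by rewrite (negbTE il) mulr1 subrr.
by rewrite mulr0 subr0.
Qed.

Lemma tau_rest V i l U : uniq (i :: l) -> vec_on V (i :: l) U ->
  tau V (U - U 0 i *: unitv R i) = tau V U - `|U 0 i|.
Proof.
move=> u h; have [Ui _] := vec_on_cons u h.
by rewrite tauB tauZ tau_unitv -Ui mulrC -normrEsg.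
Qed.

Lemma stair_inj V l c U : uniq l -> vec_on V l U -> injective (stair V l c U).
Proof.
elim: l c U => [|i l IH] c U u h; first by move=> x y.
have [Ui h'] := vec_on_cons u h; have /andP [_ ul] := u.
apply: inj_comp; first exact: IH.
exact: (mv_inj (vec_on_subvec h) Ui erefl erefl).
Qed.

Lemma stair_surj V l c U y : uniq l -> vec_on V l U -> exists x, stair V l c U x = y.
Proof.
elim: l c U y => [|i l IH] c U y u h; first by exists y.
have [Ui h'] := vec_on_cons u h; have /andP [_ ul] := u.
have [z zy] := IH (c + U 0 i *: unitv R i) _ y ul h'.
have [x xz] := mv_surj c (vec_on_subvec h) Ui erefl erefl z.
by exists x; rewrite /= xz.
Qed.

Lemma plv_stair V l c U x : plv (stair V l c U) x.
Proof.
elim: l c U x => [|i l IH] c U x; first exact: plv_id.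
by apply: plv_comp; [exact: (@plv_mv R n V c U i _ _ erefl erefl) | exact: IH].
Qed.

Lemma stair_supp V l c U x : uniq l -> vec_on V l U -> stair V l c U x <> x ->
  [/\ 0 < tau V (x - c), tau V (x - c) < tau V U & `|x - c| <= 3 * tau V U].
Proof.
elim: l c U x => [|i l IH] c U x // u h.
have [Ui h'] := vec_on_cons u h; have ul : uniq l by case/andP: u.
have UV := vec_on_subvec h; rewrite /=.
case: (eqVneq (mv_height V c U i x) 0) => [E|/(mv_height_supp UV erefl erefl) [? ? _ _ [? _]] //].
have -> : mv V c U i x = x by rewrite /mv E scale0r addr0.
move=> /IH [] // ; rewrite (tau_rest u h).
have -> : x - (c + U 0 i *: unitv R i) = x - c - U 0 i *: unitv R i by rewrite opprD addrA.
rewrite (tauB V (x - c)) tauZ tau_unitv -Ui mulrC -normrEsg => h1 h2 h3.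
have n0 := normr_ge0 (U 0 i); split; [lra|lra|].
have -> : x - c = (x - c - U 0 i *: unitv R i) + U 0 i *: unitv R i by rewrite subrK.
apply: le_trans (ler_normD _ _) _.
have : `|U 0 i *: unitv R i| <= `|U 0 i|.
  rewrite normrZ ler_piMr //; apply/norm_rV_le => // j.
  by rewrite unitvE; case: (_ == _); rewrite ?normr1 ?normr0.
lra.
Qed.

Lemma stair_lip V l c U x y : uniq l -> vec_on V l U -> sorted (abs_le V) l ->
  `|stair V l c U x - stair V l c U y| <= (2 * n%:R + 2) ^+ size l * `|x - y|.
Proof.
elim: l c U x y => [|i l IH] c U x y u h so; first by rewrite mul1r.
have [Ui h'] := vec_on_cons u h; have ul : uniq l by case/andP: u.
have UV := vec_on_subvec h; rewrite /= exprSr -mulrA.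
have K0 : 0 <= (2 * n%:R + 2 : R) by have : 0 <= n%:R :> R by []; lra.
apply: le_trans (IH _ _ _ _ ul h' (path_sorted so)) _.
apply: ler_wpM2l; first exact: exprn_ge0.
apply: (mv_lip _ UV Ui erefl erefl).
rewrite (subvec_tau UV) (bigD1 i) //=.
case: l so h h' u ul {IH} => [|k l] /= so h h' u _.
  right; rewrite big1 ?addr0 // => j ji.
  by rewrite h inE (negbTE ji) normr0.
left; rewrite addrAC subrr add0r.
have ki : k != i by move: u; rewrite inE negb_or eq_sym => /andP [/andP []].
rewrite (bigD1 k) //=; apply: le_trans (_ : `|U 0 k| <= _); last by rewrite lerDl sumr_ge0.
by rewrite h (h k) !inE !eqxx orbT; case/andP: so.
Qed.

Lemma stair_segment (i0 : 'I_n) V l c U (s : R) : uniq l -> vec_on V l U -> 0 <= s -> s <= 1 ->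
  exists i, forall j, j != i ->
    stair V l c U (c + s *: U) 0 j = c 0 j \/ stair V l c U (c + s *: U) 0 j = c 0 j + U 0 j.
Proof.
elim: l c U s => [|i l IH] c U s u h s0 s1.
  by exists i0 => j _; left; rewrite /= mxE mxE h mulr0 addr0.
have [Ui h'] := vec_on_cons u h; have ul : uniq l by case/andP: u.
have UV := vec_on_subvec h.
have coord j : j != i -> (unitv R i) 0 j = 0 by move=> ji; rewrite unitvE (negbTE ji).
case: (mv_segment c UV Ui erefl erefl s0 s1) => [[sb E]|[s' [s'0 s'1 E]]].
  exists i => j ji; left; rewrite /= E.
  set x := c + (s * _ * _) *: _.
  have [xx|xx] := pselect (stair V l (c + U 0 i *: unitv R i) (U - U 0 i *: unitv R i) x = x).
    by rewrite xx /x !mxE eqxx (negbTE ji) mulr0 addr0.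
  have [] := stair_supp ul h' xx.
  have -> : x - (c + U 0 i *: unitv R i) = (s * tau V U * Num.sg (V 0 i)) *: unitv R i - U 0 i *: unitv R i.
    by rewrite /x opprD addrA addrAC addrC addrA addrAC -addrA; apply/rowP => k; rewrite !mxE; ring.
  rewrite tauB !tauZ tau_unitv -Ui (mulrC (U 0 i)) -normrEsg => t0.
  have : s * tau V U * Num.sg (U 0 i) * Num.sg (U 0 i) <= s * tau V U.
    rewrite -mulrA; apply: ler_piMr; first by apply: mulr_ge0 => //; exact: subvec_tau_ge0.
    by rewrite -expr2 sqr_sg; case: (_ != _).
  lra.
have [k hk] := IH (c + U 0 i *: unitv R i) _ s' ul h' s'0 s'1.
exists k => j jk; rewrite /= E.
have := hk j jk; set w := stair _ _ _ _ _ 0 j; rewrite !mxE eqxx /=.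
case: (eqVneq j i) => [->|ji] /=; first by rewrite !mulr1 subrr addr0; case; auto.
by rewrite !mulr0 subr0 !addr0.
Qed.

(* Visiting the coordinates in increasing order of size keeps the slopes of all
   triangle moves bounded, whence a Lipschitz constant depending on [n] only. *)
Definition coords V : seq 'I_n := sort (fun i j => `|V 0 i| <= `|V 0 j|) (enum 'I_n).

Definition staircase a b : X -> X := stair (b - a) (coords (b - a)) a (b - a).

Lemma coords_uniq V : uniq (coords V).
Proof. by rewrite sort_uniq enum_uniq. Qed.

Lemma coords_sorted V : sorted (abs_le V) (coords V).
Proof. by apply: sort_sorted => i j; apply: le_total. Qed.

Lemma coords_vec V : vec_on V (coords V) V.
Proof. by move=> j; rewrite mem_sort mem_enum. Qed.

Lemma coords_size V : size (coords V) = n.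
Proof. by rewrite size_sort size_enum_ord. Qed.

Lemma staircase_inj a b : injective (staircase a b).
Proof. by apply: stair_inj; [exact: coords_uniq | exact: coords_vec]. Qed.

Lemma staircase_surj a b y : exists x, staircase a b x = y.
Proof. by apply: stair_surj; [exact: coords_uniq | exact: coords_vec]. Qed.

Lemma plv_staircase a b x : plv (staircase a b) x.
Proof. exact: plv_stair. Qed.

Lemma staircase_supp a b x : staircase a b x <> x ->
  [/\ tau (b - a) a < tau (b - a) x, tau (b - a) x < tau (b - a) b &
      `|x - a| <= 3 * n%:R * `|b - a|].
Proof.
move=> /stair_supp [||h1 h2 h3]; [exact: coords_uniq | exact: coords_vec|].
move: h1 h2; rewrite !tauB => h1 h2; split; [lra|lra|].
apply: le_trans h3 _; rewrite -mulrA; apply: ler_wpM2l => //.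
by apply: le_trans (tau_norm _ _); exact: ler_norm.
Qed.

Lemma staircase_lip a b x y :
  `|staircase a b x - staircase a b y| <= (2 * n%:R + 2) ^+ n * `|x - y|.
Proof.
rewrite -[in X in _ ^+ X](coords_size (b - a)).
by apply: stair_lip; [exact: coords_uniq | exact: coords_vec | exact: coords_sorted].
Qed.

Lemma staircase_segment (i0 : 'I_n) a b (s : R) : 0 <= s -> s <= 1 ->
  exists i, forall j, j != i ->
    staircase a b (a + s *: (b - a)) 0 j = a 0 j \/ staircase a b (a + s *: (b - a)) 0 j = b 0 j.
Proof.
move=> s0 s1.
have [i hi] := stair_segment i0 a (coords_uniq _) (coords_vec (b - a)) s0 s1.
exists i => j ji; have [->|->] := hi j ji; first by left.
by right; rewrite !mxE addrCA subrr addr0.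
Qed.

End Stair.

(** * Straightening the image of a line *)

Definition enumerable (R : realType) (A : R -> Prop) :=
  exists f : nat -> R, forall x, A x -> exists k, f k = x.

Section Enumerable.
Variable R : realType.
Implicit Types A B : R -> Prop.

Lemma enumerable_sub A B : (forall x, A x -> B x) -> enumerable B -> enumerable A.
Proof. by move=> AB [f hf]; exists f => x /AB /hf. Qed.

Lemma enumerable_bigU (I : countType) (A : I -> R -> Prop) :
  (forall i, enumerable (A i)) -> enumerable (fun x => exists i, A i x).
Proof.
move=> /choice [F hF].
exists (fun k => if (unpickle k : option (I * nat)) is Some p then F p.1 p.2 else 0).
by move=> x [i /hF [k <-]]; exists (pickle (i, k)); rewrite pickleK.
Qed.

Lemma enumerable_sub1 A : (forall x y, A x -> A y -> x = y) -> enumerable A.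
Proof.
move=> h; have [[x Ax]|n] := pselect (exists x, A x); last first.
  by exists (fun=> 0) => x Ax; case: n; exists x.
by exists (fun=> x) => y Ay; exists 0%N; apply: h.
Qed.

Lemma enumerableU A B : enumerable A -> enumerable B -> enumerable (fun x => A x \/ B x).
Proof.
move=> eA eB.
apply: enumerable_sub (@enumerable_bigU bool (fun b => if b then A else B) _).
  by move=> x [Ax|Bx]; [exists true | exists false].
by case.
Qed.

Lemma enumerable_image A (h : R -> R) : enumerable A -> enumerable (fun y => exists2 x, A x & y = h x).
Proof. by move=> [f hf]; exists (h \o f) => y [x /hf [k <-] ->]; exists k. Qed.

Lemma enumerable_isolated A :
  (forall x, A x -> exists2 r : R, 0 < r & forall y, `|y - x| < r -> A y -> y = x) -> enumerable A.
Proof.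
move=> iso.
pose B (ab : rat * rat) x := [/\ A x, ratr ab.1 < x, x < ratr ab.2 &
   forall y, A y -> ratr ab.1 < y -> y < ratr ab.2 -> y = x].
apply: enumerable_sub (@enumerable_bigU _ B _); last first.
  move=> ab; apply: enumerable_sub1 => x y [Ax a1 a2 h] [Ay b1 b2 h']; exact: h'.
move=> x Ax; have [r r0 h] := iso x Ax.
have h1 : x - r < x by lra.
have h2 : x < x + r by lra.
have [a] := rat_in_itvoo h1; have [b] := rat_in_itvoo h2.
rewrite !in_itv /= => /andP [b1 b2] /andP [a1 a2].
exists (a, b); split=> // y Ay /= ay yb; apply: h => //.
by rewrite ltr_norml; apply/andP; split; lra.
Qed.

End Enumerable.

Section Line.
Variables (R : realType) (n : nat).
Local Notation X := 'rV[R]_n.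

Definition line (i : 'I_n) (mu : X) (s : R) : X := \row_j (if j == i then s else mu 0 j).

Lemma lineB i mu s t : line i mu s - line i mu t = (s - t) *: unitv R i.
Proof.
by apply/rowP => j; rewrite !mxE eqxx /=; case: (j == i); rewrite ?mulr1 ?mulr0 ?subrr.
Qed.

Lemma norm_unitv (i : 'I_n) : `|unitv R i| = 1.
Proof.
apply/eqP; rewrite eq_le; apply/andP; split.
  apply/norm_rV_le => // j; rewrite unitvE; case: (_ == _); by rewrite ?normr1 ?normr0.
by have := coord_le_norm (unitv R i) i; rewrite unitvE eqxx normr1.
Qed.

Lemma line_dist i mu s t : `|line i mu s - line i mu t| = `|s - t|.
Proof. by rewrite lineB normrZ norm_unitv mulr1. Qed.

Lemma line_norm i mu s : `|line i mu s| <= `|s| + `|mu|.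
Proof.
apply/norm_rV_le; first by rewrite addr_ge0.
move=> j; rewrite mxE; case: (j == i); first by rewrite lerDl.
by apply: le_trans (coord_le_norm mu j) _; rewrite lerDr.
Qed.

Lemma lineE i (mu y : X) : (forall j, j != i -> y 0 j = mu 0 j) -> y = line i mu (y 0 i).
Proof.
by move=> h; apply/rowP => j; rewrite mxE; case: (eqVneq j i) => [->//|/h].
Qed.

Lemma line_closed i mu (y : X) : ~ (exists s, y = line i mu s) ->
  exists2 r : R, 0 < r & forall z, `|z - y| < r -> ~ (exists s, z = line i mu s).
Proof.
move=> h.
have [j ji yj] : exists2 j, j != i & y 0 j != mu 0 j.
  apply: contrapT => h'; apply: h; exists (y 0 i); apply: lineE => j ji.
  by apply/eqP/negP => /negP yj; apply: h'; exists j.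
exists `|y 0 j - mu 0 j|; first by rewrite normr_gt0 subr_eq0.
move=> z zy [s zs]; have := coord_le_norm (z - y) j.
rewrite !mxE zs mxE (negbTE ji) distrC; rewrite -zs; lra.
Qed.

End Line.

(* [Z] is the bad set; the box is the open unit ball. *)
Record almost_homeo (R : realType) (n : nat) (M : R) (g : 'rV[R]_n -> 'rV[R]_n)
    (Z : 'rV[R]_n -> Prop) (D : R -> Prop) : Prop := AlmostHomeo {
  ah_cont : forall y, contat g y;
  ah_near : forall y, `|g y - y| <= M;
  ah_surj : forall x, exists y, g y = x;
  ah_closed : forall x, ~ Z x -> exists2 r : R, 0 < r & forall z, `|z - x| < r -> ~ Z z;
  ah_box : forall x, ~ Z x -> forall j, `|x 0 j| < 1;
  ah_lines : forall x, Z x -> (forall j, `|x 0 j| < 1) ->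
                exists i, forall j, j != i -> D (x 0 j);
  ah_inj : forall y y', g y = g y' -> ~ Z (g y) -> y = y';
  ah_pl : forall y, ~ Z (g y) -> plv g y }.

Section Rectify.
Variables (R : realType) (n : nat).
Local Notation X := 'rV[R]_n.
Variables (M : R) (g : X -> X) (Z : X -> Prop) (D : R -> Prop).
Hypothesis I : almost_homeo M g Z D.
Variables (i : 'I_n) (mu : X) (e : R).
Hypothesis (e0 : 0 < e).
Variable N : nat.
Hypothesis MN : M + 1 <= N%:R.

Local Notation ln := (line i mu).
Definition gam (s : R) : X := g (ln s).

Lemma gam_bound s : ~ Z (gam s) -> `|s| < N%:R.
Proof.
move=> /(ah_box I) /(_ i) h1; have := ah_near I (ln s) => /(le_trans (coord_le_norm _ i)).
rewrite !mxE eqxx -/(gam s) => h2.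
have : `|s| <= `|gam s 0 i| + `|gam s 0 i - s|.
  by rewrite -{1}[s](subKr (gam s 0 i)); exact: ler_normB.
move=> h3; apply: lt_le_trans MN; apply: le_lt_trans h3 _.
by rewrite addrC; apply: ler_ltD.
Qed.

Lemma g_control y0 (d : R) : ~ Z (g y0) -> 0 < d ->
  exists2 r : R, 0 < r & forall y, `|g y - g y0| < r -> `|y - y0| < d.
Proof.
move=> nz d0; apply: preimage_control (ah_cont I) (ah_near I) _ d0.
by move=> y E; apply: (ah_inj I E); rewrite E.
Qed.

Definition dy (k j : nat) : R := j%:R / 2 ^+ k - N%:R.
Definition pgam k j := gam (dy k j).
Definition chord k j := pgam k j.+1 - pgam k j.
Definition slope k j := (2 ^+ k : R) *: chord k j.

Lemma dyS k j : dy k j.+1 = dy k j + (2 ^+ k)^-1.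
Proof. by rewrite /dy -addn1 natrD mulrDl mul1r addrAC. Qed.

Lemma pow2_gt0 k : 0 < 2 ^+ k :> R. Proof. by rewrite exprn_gt0. Qed.

Lemma dy_lt k j : dy k j < dy k j.+1.
Proof. by rewrite dyS ltrDl invr_gt0 pow2_gt0. Qed.

Lemma dy_bound k s : `|s| < N%:R -> exists j, dy k j <= s /\ s < dy k j.+1.
Proof.
rewrite ltr_norml => /andP [s1 s2].
have s0 : 0 <= (s + N%:R) * 2 ^+ k by apply: mulr_ge0; [lra | exact: ltW (pow2_gt0 k)].
have /andP [h1 h2] := truncn_itv s0.
exists (Num.truncn ((s + N%:R) * 2 ^+ k)).
move: h1 h2; rewrite -ler_pdivrMr ?pow2_gt0 // -ltr_pdivlMr ?pow2_gt0 // /dy => h1 h2.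
by split; lra.
Qed.

Lemma dy_nest k j k' j' : (k <= k')%N -> dy k' j' < dy k j.+1 -> dy k j < dy k' j'.+1 ->
  dy k j <= dy k' j' /\ dy k' j'.+1 <= dy k j.+1.
Proof.
move=> kk; rewrite /dy !ltrBlDr !lerBlDr !subrK.
rewrite -(subnK kk) exprD (mulrC (2 ^+ (k' - k))); set d := (k' - k)%N.
have E (a b : nat) : (a%:R / (2 ^+ k * 2 ^+ d) < b%:R / 2 ^+ k :> R) = (a < b * 2 ^ d)%N.
  by rewrite ltr_pdivrMr ?mulr_gt0 ?pow2_gt0 // mulrA divfK ?lt0r_neq0 ?pow2_gt0 // -natrX -natrM ltr_nat.
have E' (a b : nat) : (b%:R / 2 ^+ k < a%:R / (2 ^+ k * 2 ^+ d) :> R) = (b * 2 ^ d < a)%N.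
  by rewrite ltr_pdivlMr ?mulr_gt0 ?pow2_gt0 // mulrA divfK ?lt0r_neq0 ?pow2_gt0 // -natrX -natrM ltr_nat.
by rewrite E E' !leNgt E E' -!leqNgt => h1 h2; split.
Qed.

Definition cc : R := 3 * n%:R.

(* The chord is an isolated piece of the curve, far from [Z], and preimages of points near it are close
   together, even compared with their distance to the preimage of [Z]: the last clause makes [theta]
   continuous on the latter. *)
Definition good k j := [/\
  forall s, dy k j <= s -> s <= dy k j.+1 -> gam s = pgam k j + (s - dy k j) *: slope k j,
  forall x, `|x - pgam k j| <= (2 * cc + 1) * `|chord k j| -> ~ Z x,
  forall s, `|gam s - pgam k j| <= (2 * cc + 1) * `|chord k j| ->
     gam s = pgam k j + (s - dy k j) *: slope k j &
  forall y y', `|g y - pgam k j| <= cc * `|chord k j| -> `|g y' - pgam k j| <= cc * `|chord k j| ->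
     `|y - y'| <= e /\ forall z, Z (g z) -> `|y - y'| <= `|y - z| ].

Definition selected k j := good k j /\
  forall k' j', (k' < k)%N -> dy k' j' <= dy k j -> dy k j.+1 <= dy k' j'.+1 -> ~ good k' j'.

Definition psi k j : X -> X := staircase (pgam k j) (pgam k j.+1).

Definition moved (kj : nat * nat) x := selected kj.1 kj.2 /\ psi kj.1 kj.2 x <> x.

Lemma cc_ge0 : 0 <= cc. Proof. by apply: mulr_ge0. Qed.

Lemma chordE k j : chord k j = (dy k j.+1 - dy k j) *: slope k j.
Proof.
by rewrite dyS addrAC subrr add0r /slope scalerA mulVf ?scale1r // lt0r_neq0 ?pow2_gt0.
Qed.

Lemma moved_supp kj x : moved kj x ->
  [/\ tau (chord kj.1 kj.2) (pgam kj.1 kj.2) < tau (chord kj.1 kj.2) x,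
      tau (chord kj.1 kj.2) x < tau (chord kj.1 kj.2) (pgam kj.1 kj.2.+1) &
      `|x - pgam kj.1 kj.2| <= cc * `|chord kj.1 kj.2|].
Proof. by case=> _; apply: staircase_supp. Qed.

Lemma tau_scale (V x : X) (a : R) : 0 < a -> tau (a *: V) x = tau V x.
Proof.
by move=> a0; apply: eq_bigr => l _; rewrite mxE sgrM gtr0_sg // mul1r.
Qed.

Lemma moved_unique_aux k j k' j' x : `|chord k' j'| <= `|chord k j| ->
  moved (k, j) x -> moved (k', j') x -> dy k' j' < dy k j.+1 /\ dy k j < dy k' j'.+1.
Proof.
move=> LL m m'.
have /= [t1 t2 b] := moved_supp m; have /= [t1' t2' b'] := moved_supp m'.
have [[[g1 g2 g3 g4] _] _] := m.
have c0 := cc_ge0; have L0 := normr_ge0 (chord k j).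
have cL : cc * `|chord k' j'| <= cc * `|chord k j| by apply: ler_wpM2l.
have aa : `|pgam k' j' - pgam k j| <= 2 * cc * `|chord k j|.
  have -> : pgam k' j' - pgam k j = (x - pgam k j) - (x - pgam k' j') by apply/rowP => l; rewrite !mxE; ring.
  by apply: le_trans (ler_normB _ _) _; lra.
have E1 : pgam k' j' = pgam k j + (dy k' j' - dy k j) *: slope k j.
  by apply: g3; rewrite -/(pgam k' j'); lra.
have E2 : pgam k' j'.+1 = pgam k j + (dy k' j'.+1 - dy k j) *: slope k j.
  apply: g3; rewrite -/(pgam k' j'.+1).
  have -> : pgam k' j'.+1 - pgam k j = chord k' j' + (pgam k' j' - pgam k j) by rewrite /chord addrA subrK.
  by apply: le_trans (ler_normD _ _) _; lra.
have d0 := dy_lt k j; have d0' := dy_lt k' j'.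
have tE : tau (chord k' j') =1 tau (chord k j).
  move=> z; rewrite {1}/chord E1 E2.
  have -> : pgam k j + (dy k' j'.+1 - dy k j) *: slope k j - (pgam k j + (dy k' j' - dy k j) *: slope k j)
     = (dy k' j'.+1 - dy k' j') *: slope k j by apply/rowP => l; rewrite !mxE; ring.
  have p : 0 < dy k j.+1 - dy k j by rewrite subr_gt0.
  have p' : 0 < dy k' j'.+1 - dy k' j' by rewrite subr_gt0.
  by rewrite chordE (tau_scale _ _ p) (tau_scale _ _ p').
have E3 : pgam k j.+1 = pgam k j + (dy k j.+1 - dy k j) *: slope k j.
  by rewrite -chordE /chord addrC subrK.
move: t1' t2'; rewrite !tE E1 E2; rewrite E3 in t2; move: t1 t2; rewrite !tauD !tauZ.
set T := 2 ^+ k * _; set A := tau _ (pgam _ _); set W := tau _ x => t1 t2 t1' t2'.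
have T0 : 0 < T.
  have : 0 < (dy k j.+1 - dy k j) * T by lra.
  by rewrite pmulr_rgt0 // subr_gt0.
split.
  have : (dy k' j' - dy k j) * T < (dy k j.+1 - dy k j) * T by lra.
  by rewrite ltr_pM2r //; lra.
have : 0 < (dy k' j'.+1 - dy k j) * T by lra.
by rewrite pmulr_lgt0 //; lra.
Qed.

Lemma selected_disjoint k j k' j' : selected k j -> selected k' j' ->
  dy k' j' < dy k j.+1 -> dy k j < dy k' j'.+1 -> (k, j) = (k', j').
Proof.
move=> s s' h1 h2; case: (ltngtP k k') => kk.
- have [n1 n2] := dy_nest (ltnW kk) h1 h2.
  by case: (s'.2 _ _ kk n1 n2); case: s.
- have [n1 n2] := dy_nest (ltnW kk) h2 h1.
  by case: (s.2 _ _ kk n1 n2); case: s'.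
subst k'.
have [n1 _] := dy_nest (leqnn k) h1 h2; have [n2 _] := dy_nest (leqnn k) h2 h1.
have dyle a b : dy k a <= dy k b -> (a <= b)%N.
  by rewrite /dy lerD2r ler_pM2r ?invr_gt0 ?pow2_gt0 // ler_nat.
by congr pair; apply/eqP; rewrite eqn_leq !dyle.
Qed.

Lemma moved_unique kj kj' x : moved kj x -> moved kj' x -> kj = kj'.
Proof.
case: kj => k j; case: kj' => k' j' m m'.
case: (lerP `|chord k' j'| `|chord k j|) => L.
  have [h1 h2] := moved_unique_aux L m m'.
  exact: selected_disjoint m.1 m'.1 h1 h2.
have [h1 h2] := moved_unique_aux (ltW L) m' m.
exact: selected_disjoint m.1 m'.1 h2 h1.
Qed.

Definition Psi (x : X) : X :=
  if pselect (exists kj, moved kj x) is left h then psi (projT1 (cid h)).1 (projT1 (cid h)).2 x else x.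

Lemma Psi_moved kj x : moved kj x -> Psi x = psi kj.1 kj.2 x.
Proof.
move=> m; rewrite /Psi; case: pselect => [h|[]]; last by exists kj.
by rewrite (moved_unique (projT2 (cid h)) m).
Qed.

Lemma Psi_fix x : (forall kj, ~ moved kj x) -> Psi x = x.
Proof. by move=> h; rewrite /Psi; case: pselect => // -[kj m]; case: (h kj m). Qed.

Lemma moved_psi kj x : moved kj x -> moved kj (psi kj.1 kj.2 x).
Proof. by move=> [s m]; split=> // /staircase_inj. Qed.

Lemma Psi_cases x : (exists2 kj, moved kj x & Psi x = psi kj.1 kj.2 x) \/
  ((forall kj, ~ moved kj x) /\ Psi x = x).
Proof.
have [[kj m]|h] := pselect (exists kj, moved kj x).
  by left; exists kj => //; apply: Psi_moved.
right; have h' kj : ~ moved kj x by move=> m; apply: h; exists kj.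
by split=> //; apply: Psi_fix.
Qed.

Lemma psi_eq kj x : selected kj.1 kj.2 -> ~ moved kj x -> psi kj.1 kj.2 x = x.
Proof. by move=> s h; apply: contrapT => E; apply: h; split. Qed.

Lemma Psi_inj : injective Psi.
Proof.
move=> x y; case: (Psi_cases x) => [[kj m ->]|[h ->]]; case: (Psi_cases y) => [[kj' m' ->]|[h' ->]] E.
- have E' : kj = kj' by apply: (moved_unique (moved_psi m)); rewrite E; exact: moved_psi.
  by subst kj'; apply: staircase_inj E.
- by case: (h' kj); rewrite -E; apply: moved_psi.
- by case: (h kj'); rewrite E; apply: moved_psi.
- exact: E.
Qed.

Lemma Psi_surj w : exists x, Psi x = w.
Proof.
case: (Psi_cases w) => [[kj m _]|[h E]]; last by exists w.
have [x xw] := staircase_surj (pgam kj.1 kj.2) (pgam kj.1 kj.2.+1) w.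
have mx : moved kj x.
  split; first by case: m.
  move=> E; have xw' : x = w by rewrite -E.
  by case: m => _; rewrite -xw'.
by exists x; rewrite (Psi_moved mx).
Qed.

Lemma moved_notZ kj x : moved kj x -> ~ Z x.
Proof.
move=> m; have [_ _ b] := moved_supp m; case: m => -[[_ g2 _ _] _] _.
apply: g2; apply: le_trans b _; have := cc_ge0; have := normr_ge0 (chord kj.1 kj.2).
by move=> L0 c0; apply: ler_wpM2r => //; lra.
Qed.

Lemma Psi_Z x : Z x -> Psi x = x.
Proof. by move=> zx; apply: Psi_fix => kj /moved_notZ. Qed.

Lemma Psi_notZ x : ~ Z x -> ~ Z (Psi x).
Proof.
case: (Psi_cases x) => [[kj m ->] _|[_ ->] //].
exact: moved_notZ (moved_psi m).
Qed.

Lemma Psi_lip x y : `|Psi x - Psi y| <= (2 * (2 * n%:R + 2) ^+ n + 1) * `|x - y|.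
Proof.
set K := (2 * n%:R + 2) ^+ n : R.
have nn : 0 <= n%:R :> R by [].
have K1 : 1 <= K by apply: exprn_ege1; lra.
have N0 := normr_ge0 (x - y).
have KN : K * `|x - y| <= (2 * K + 1) * `|x - y| by apply: ler_wpM2r => //; lra.
have N1 : `|x - y| <= (2 * K + 1) * `|x - y|.
  by rewrite -{1}[`|x - y|]mul1r; apply: ler_wpM2r => //; lra.
have lip kj u v : `|psi kj.1 kj.2 u - psi kj.1 kj.2 v| <= K * `|u - v| by exact: staircase_lip.
case: (Psi_cases x) => [[kj m ->]|[h ->]]; case: (Psi_cases y) => [[kj' m' ->]|[h' ->]].
- have [E|E] := pselect (kj = kj'); first by subst kj'; apply: le_trans (lip _ _ _) KN.
  have yE : psi kj.1 kj.2 y = y by apply: psi_eq => [|my]; [case: m | apply: E; exact: moved_unique my m'].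
  have xE : psi kj'.1 kj'.2 x = x by apply: psi_eq => [|mx]; [case: m' | apply: E; exact: moved_unique m mx].
  have h1 := lip kj x y; have h2 := lip kj' x y; rewrite yE in h1; rewrite xE in h2.
  have -> : psi kj.1 kj.2 x - psi kj'.1 kj'.2 y = (psi kj.1 kj.2 x - y) - (x - y) + (x - psi kj'.1 kj'.2 y).
    by apply/rowP => l; rewrite !mxE; ring.
  apply: le_trans (ler_normD _ _) _.
  by have := ler_normB (psi kj.1 kj.2 x - y) (x - y); lra.
- have yE : psi kj.1 kj.2 y = y by apply: psi_eq => //; case: m.
  by have := lip kj x y; rewrite yE => h1; apply: le_trans h1 KN.
- have xE : psi kj'.1 kj'.2 x = x by apply: psi_eq => //; case: m'.
  by have := lip kj' x y; rewrite xE => h1; apply: le_trans h1 KN.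
- exact: N1.
Qed.

Lemma Psi_cont x : contat Psi x.
Proof.
apply: contat_lip (fun y => Psi_lip y x).
have : 0 <= (2 * n%:R + 2) ^+ n :> R by apply: exprn_ge0; have : 0 <= n%:R :> R by []; lra.
lra.
Qed.

Definition flat s := ~ Z (gam s) /\
  exists v : X, exists2 r : R, 0 < r & forall t, `|t - s| < r -> gam t = gam s + (t - s) *: v.

Lemma line_gap_Z s : ~ Z (gam s) ->
  exists2 d : R, 0 < d & forall z, Z (g z) -> d <= `|z - ln s|.
Proof.
move=> nz; have [r r0 hr] := ah_closed I nz.
have [d d0 hd] := ah_cont I (ln s) r0.
exists d => // z Zz; rewrite leNgt; apply/negP => /hd /hr; exact.
Qed.

Lemma pow2_small (a : R) : 0 < a -> exists k, (2 ^+ k)^-1 < a.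
Proof.
move=> a0; have a1 : 0 <= a^-1 by rewrite invr_ge0 ltW.
have /andP [_ h] := truncn_itv a1.
exists (Num.truncn a^-1).+1; rewrite -[ltRHS]invrK ltf_pV2 ?posrE ?invr_gt0 ?pow2_gt0 //.
apply: lt_trans h _; rewrite -natrX ltr_nat; exact: ltn_expl.
Qed.

Lemma flat_good s : flat s -> exists k j, [/\ dy k j <= s, s < dy k j.+1 & good k j].
Proof.
move=> [nz [v [r r0 hv]]].
have [d d0 hd] := line_gap_Z nz.
have [rho rho0 hrho] := ah_closed I nz.
pose eps := Num.min (r / 2) (Num.min (e / 2) (d / 3)).
have e0' := e0.
have eps0 : 0 < eps by rewrite !lt_min; apply/and3P; split; lra.
have [epsr epse epsd] : [/\ eps <= r / 2, eps <= e / 2 & eps <= d / 3].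
  by rewrite /eps; split; rewrite !ge_min lexx ?orbT.
have [m m0 hm] := g_control nz eps0.
move: eps eps0 epsr epse epsd hm => eps eps0 epsr epse epsd hm.
have c0 := cc_ge0; have v0 := normr_ge0 v.
have [k [k1 k2]] : exists k, (2 ^+ k)^-1 < r /\ (2 ^+ k)^-1 * `|v| * (2 * cc + 2) < Num.min m rho.
  have A0 : 0 < Num.min r (Num.min m rho / (`|v| * (2 * cc + 2) + 1)).
    rewrite lt_min r0 /= divr_gt0 ?lt_min ?m0 //.
    have : 0 <= `|v| * (2 * cc + 2) by apply: mulr_ge0; lra.
    lra.
  have [k hk] := pow2_small A0.
  exists k; move: hk; rewrite lt_min => /andP [h1 h2]; split=> //.
  have B0 : 0 < `|v| * (2 * cc + 2) + 1.
    have : 0 <= `|v| * (2 * cc + 2) by apply: mulr_ge0; lra.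
    lra.
  move: h2; rewrite ltr_pdivlMr // => h2; apply: le_lt_trans h2.
  rewrite -mulrA; apply: ler_wpM2l; last by lra.
  by rewrite invr_ge0 ltW ?pow2_gt0.
have sN := gam_bound nz.
have [j [j1 j2]] := dy_bound k sN.
exists k, j; split=> //.
have dS := dyS k j.
have p0 : 0 < (2 ^+ k)^-1 :> R by rewrite invr_gt0 pow2_gt0.
have Ep : pgam k j = gam s + (dy k j - s) *: v.
  by apply: hv; rewrite ltr_norml; apply/andP; split; lra.
have Eq : pgam k j.+1 = gam s + (dy k j.+1 - s) *: v.
  by apply: hv; rewrite ltr_norml; apply/andP; split; lra.
have Ec : chord k j = (2 ^+ k)^-1 *: v.
  by rewrite /chord Ep Eq dS; apply/rowP => l; rewrite !mxE; ring.
have Es : slope k j = v by rewrite /slope Ec scalerA divff ?scale1r // lt0r_neq0 ?pow2_gt0.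
have Lc : `|chord k j| = (2 ^+ k)^-1 * `|v| by rewrite Ec normrZ gtr0_norm.
have pd : `|pgam k j - gam s| <= `|chord k j|.
  rewrite Ep addrAC subrr add0r normrZ Lc; apply: ler_wpM2r => //.
  by rewrite ler_norml; apply/andP; split; lra.
have L0 := normr_ge0 (chord k j).
move: k2; rewrite -Lc lt_min => /andP [k2 k3].
have near (A : R) x : A <= 2 * cc + 1 -> `|x - pgam k j| <= A * `|chord k j| ->
   `|x - gam s| < m /\ `|x - gam s| < rho.
  move=> AA h; have : `|x - gam s| <= `|chord k j| * (2 * cc + 2).
    have -> : x - gam s = (x - pgam k j) + (pgam k j - gam s) by rewrite addrA subrK.
    apply: le_trans (ler_normD _ _) _.
    have : A * `|chord k j| <= (2 * cc + 1) * `|chord k j| by apply: ler_wpM2r.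
    lra.
  by move=> h'; split; apply: le_lt_trans h' _.
have fl t : `|t - s| < r -> gam t = pgam k j + (t - dy k j) *: slope k j.
  by move=> /hv ->; rewrite Es Ep; apply/rowP => l; rewrite !mxE; ring.
split.
- by move=> t t1 t2; apply: fl; rewrite ltr_norml; apply/andP; split; lra.
- by move=> x /(near _ _ (lexx _)) [_ xr]; apply: hrho.
- move=> t /(near _ _ (lexx _)) [/hm]; rewrite line_dist => ts _.
  by apply: fl; lra.
- have c1 : cc <= 2 * cc + 1 by lra.
  move=> y y' /(near _ _ c1) [/hm y1 _] /(near _ _ c1) [/hm y2 _].
  have yy : `|y - y'| <= 2 * eps.
    have -> : y - y' = (y - ln s) - (y' - ln s) by apply/rowP => l; rewrite !mxE; ring.
    by apply: le_trans (ler_normB _ _) _; lra.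
  split; first by lra.
  move=> z /hd dz.
  have : `|z - ln s| <= `|y - ln s| + `|y - z|.
    have -> : z - ln s = (y - ln s) - (y - z) by apply/rowP => l; rewrite !mxE; ring.
    exact: ler_normB.
  lra.
Qed.

Lemma flat_selected s : flat s -> exists k j, [/\ dy k j <= s, s < dy k j.+1 & selected k j].
Proof.
move=> fs; have [k0 [j0 h0]] := flat_good fs.
pose P k := `[< exists j, [/\ dy k j <= s, s < dy k j.+1 & good k j] >].
have exP : exists k, P k by exists k0; apply/asboolP; exists j0.
case: (ex_minnP exP) => k /asboolP [j [j1 j2 gj]] mink.
exists k, j; split=> //; split=> // k' j' kk h1 h2 g'.
have /mink : P k'.
  by apply/asboolP; exists j'; split=> //; [apply: le_trans h1 j1 | apply: lt_le_trans j2 h2].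
by rewrite leqNgt kk.
Qed.

Lemma moved_gam kj s : moved kj (gam s) ->
  [/\ dy kj.1 kj.2 < s, s < dy kj.1 kj.2.+1 & flat s].
Proof.
case: kj => k j m; have /= [t1 t2 b] := moved_supp m.
have nz := moved_notZ m.
case: (m) => -[[/= g1 g2 g3 g4] _] _.
have c0 := cc_ge0; have L0 := normr_ge0 (chord k j).
have d0 := dy_lt k j.
have E : gam s = pgam k j + (s - dy k j) *: slope k j.
  by apply: g3; apply: le_trans b _; apply: ler_wpM2r => //; lra.
have E3 : pgam k j.+1 = pgam k j + (dy k j.+1 - dy k j) *: slope k j.
  by rewrite -chordE /chord addrC subrK.
move: t1 t2; rewrite E3 E !tauD !(tauZ _ (_ - _)).
move: (tau _ (slope k j)) (tau _ (pgam k j)) => T A t1 t2.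
have T0 : 0 < T.
  have : 0 < (dy k j.+1 - dy k j) * T by lra.
  by rewrite pmulr_rgt0 // subr_gt0.
have s1 : dy k j < s.
  have : 0 < (s - dy k j) * T by lra.
  by rewrite pmulr_lgt0 // subr_gt0.
have s2 : s < dy k j.+1.
  have : (s - dy k j) * T < (dy k j.+1 - dy k j) * T by lra.
  by rewrite ltr_pM2r // ltrD2r.
split=> //; split=> //; exists (slope k j), (Num.min (s - dy k j) (dy k j.+1 - s)).
  by rewrite lt_min !subr_gt0 s1.
move=> t; rewrite lt_min => /andP []; rewrite !ltr_norml => /andP [? ?] /andP [? ?].
rewrite g1; [|lra|lra].
by rewrite E; apply/rowP => l; rewrite !mxE; ring.
Qed.

Definition bend s := ~ Z (gam s) /\ ~ flat s.

Lemma Psi_bend s : bend s -> Psi (gam s) = gam s.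
Proof. by move=> [_ nf]; apply: Psi_fix => kj /moved_gam []. Qed.

Lemma Psi_flat s : flat s -> exists k j l, forall h, h != l ->
  Psi (gam s) 0 h = pgam k j 0 h \/ Psi (gam s) 0 h = pgam k j.+1 0 h.
Proof.
move=> fs; have [k [j [j1 j2 sel]]] := flat_selected fs.
have E : Psi (gam s) = psi k j (gam s).
  case: (Psi_cases (gam s)) => [[kj' m' Em]|[nm ->]]; last by rewrite (@psi_eq (k, j)) //; apply: nm.
  have [h1 h2 _] := moved_gam m'.
  suff E : (k, j) = kj' by rewrite Em -E.
  case: kj' m' h1 h2 {Em} => k' j' m' /= h1 h2.
  by apply: selected_disjoint => //; [case: m' | lra | lra].
have d0 := dy_lt k j; have q0 := pow2_gt0 k; have dS := dyS k j.
pose t := (s - dy k j) * 2 ^+ k.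
have t0 : 0 <= t by apply: mulr_ge0; lra.
have t1 : t <= 1.
  by rewrite /t -ler_pdivlMr // div1r; lra.
have Es : gam s = pgam k j + t *: (pgam k j.+1 - pgam k j).
  case: sel => -[g1 _ _ _] _; rewrite g1 //; last exact: ltW.
  by rewrite /slope scalerA.
have [l hl] := staircase_segment i (pgam k j) (pgam k j.+1) t0 t1.
by exists k, j, l => h hi; rewrite E Es; apply: hl.
Qed.

Lemma bend_isolated s : bend s ->
  exists2 r : R, 0 < r & forall t, `|t - s| < r -> bend t -> t = s.
Proof.
move=> [nz _]; have [r r0 hr] := plv_conical (ah_pl I nz).
have half (u : R) : `|u| = r / 2 -> forall t, 0 <= t -> t <= 1 ->
    gam (s + t * u) = gam s + t *: (gam (s + u) - gam s).
  move=> hu t t0 t1.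
  have E w : ln (s + w) = ln s + w *: unitv R i.
    by apply/rowP => j; rewrite !mxE eqxx /=; case: (j == i); rewrite ?mulr1 ?mulr0 ?addr0.
  rewrite /gam !E -scalerA; apply: hr => //.
  by rewrite normrZ norm_unitv mulr1 hu; lra.
exists (r / 2); first by lra.
move=> t ts [nzt nft]; apply: contrapT => tns; apply: nft; split=> //.
have Q (u : R) : u != 0 -> `|u| = r / 2 -> 0 < (t - s) / u -> (t - s) / u < 1 ->
   exists v : X, exists2 r0 : R, 0 < r0 & forall t0, `|t0 - t| < r0 -> gam t0 = gam t + (t0 - t) *: v.
  move=> u0 hu q0 q1; exists (u^-1 *: (gam (s + u) - gam s)).
  exists (Num.min ((t - s) / u) (1 - (t - s) / u) * `|u|).
    by apply: mulr_gt0; [rewrite lt_min; apply/andP; split; lra | rewrite normr_gt0].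
  have H w : 0 <= (w - s) / u -> (w - s) / u <= 1 -> gam w = gam s + ((w - s) / u) *: (gam (s + u) - gam s).
    by move=> w0 w1; rewrite -(half u hu _ w0 w1) divfK // addrC subrK.
  move=> w; rewrite -ltr_pdivrMr ?normr_gt0 // -normfV -normrM mulrBl => hw.
  have Ew : (w - s) / u = (t - s) / u + (w / u - t / u) by field.
  move: hw; rewrite lt_min !ltr_norml => /andP [/andP [? ?] /andP [? ?]].
  have w0 : 0 <= (w - s) / u by rewrite Ew; lra.
  have w1 : (w - s) / u <= 1 by rewrite Ew; lra.
  rewrite (H w w0 w1) (H t (ltW q0) (ltW q1)).
  by apply/rowP => l; rewrite !mxE; field.
have r2 : 0 < r / 2 by lra.
move: ts; rewrite ltr_norml => /andP [ts1 ts2].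
case: (ltrgtP t s) => st; last by [].
- apply: (Q (- (r / 2))).
  + by rewrite oppr_eq0; lra.
  + by rewrite normrN gtr0_norm.
  + by rewrite invrN mulrN -mulNr divr_gt0 // opprB subr_gt0.
  + by rewrite invrN mulrN -mulNr ltr_pdivrMr // mul1r; lra.
- apply: (Q (r / 2)).
  + by lra.
  + by rewrite gtr0_norm.
  + by rewrite divr_gt0 // subr_gt0.
  + by rewrite ltr_pdivrMr // mul1r; lra.
Qed.

Definition D' (x : R) := D x \/
  ((exists kjl : nat * nat * 'I_n, x = pgam kjl.1.1 kjl.1.2 0 kjl.2) \/
   (exists l : 'I_n, exists2 s, bend s & x = gam s 0 l)).

Lemma D'_enumerable : enumerable D -> enumerable D'.
Proof.
move=> eD; apply: enumerableU => //; apply: enumerableU; apply: enumerable_bigU.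
  by move=> kjl; apply: enumerable_sub1 => x y -> ->.
move=> l; apply: (enumerable_image (fun s => gam s 0 l)).
exact: enumerable_isolated bend_isolated.
Qed.

Lemma theta_ex : exists theta : X -> X,
  forall y, g (theta y) = Psi (g y) /\ (Psi (g y) = g y -> theta y = y).
Proof.
have /choice [th h] : forall y, exists y', g y' = Psi (g y) /\ (Psi (g y) = g y -> y' = y).
  move=> y; have [y' E] := ah_surj I (Psi (g y)).
  have [h|h] := pselect (Psi (g y) = g y); first by exists y; rewrite h.
  by exists y'; split=> // /h.
by exists th.
Qed.

Lemma plv_Psi x : ~ Z x -> (forall s, gam s <> x) -> plv Psi x.
Proof.
move=> nz ng.
have [||r r0 hr] := @closed_image_gap R n g (fun y => exists s, y = ln s) M x (ah_cont I) (ah_near I).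
- exact: line_closed.
- by move=> y [s ->]; apply: ng.
have gr s : r <= `|gam s - x| by apply: hr; exists s.
have c0 := cc_ge0.
have k0 : 0 < r / (2 * (cc + 1)) by apply: divr_gt0; lra.
have [d d0 hd] := heine_cantor (N%:R + `|mu|) (ah_cont I) k0.
have [K hK] := pow2_small d0.
pose lst := [seq (a, b) | a <- iota 0 K, b <- iota 0 (2 * N * 2 ^ K)].
(* Near [x] only the finitely many long dyadic pieces can act. *)
have fin kj z : moved kj z -> `|z - x| < r / 2 ->
   kj \in lst.
  case: kj => k j m zx; have /= [_ _ b] := moved_supp m.
  have L1 : r / (2 * (cc + 1)) <= `|chord k j|.
    rewrite ler_pdivrMr; last by lra.
    have := gr (dy k j); rewrite -/(pgam k j).
    have -> : pgam k j - x = (z - x) - (z - pgam k j) by apply/rowP => l; rewrite !mxE; ring.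
    move=> /le_trans /(_ (ler_normB _ _)) h; have := normr_ge0 (chord k j); lra.
  have pN : `|dy k j| < N%:R.
    apply: gam_bound; case: (m) => -[[_ g2 _ _] _] _; apply: g2.
    rewrite subrr normr0; apply: mulr_ge0 => //=; lra.
  have kK : (k < K)%N.
    rewrite ltnNge; apply/negP => Kk.
    have : `|g (ln (dy k j.+1)) - g (ln (dy k j))| < r / (2 * (cc + 1)).
      apply: hd.
        by apply: le_trans (line_norm _ _ _) _; rewrite lerD2r ltW.
      rewrite line_dist dyS addrAC subrr add0r gtr0_norm ?invr_gt0 ?pow2_gt0 //.
      apply: le_lt_trans hK; rewrite lef_pV2 ?posrE ?pow2_gt0 //.
      by apply: ler_weXn2l => //; lra.
    by rewrite -/(gam _) -/(gam _) -/(pgam k j) -/(pgam k j.+1) -/(chord k j); lra.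
  apply/allpairsP; exists (k, j); split=> //=; rewrite mem_iota //= add0n.
  move: pN; rewrite ltr_norml => /andP [_]; rewrite /dy ltrBlDr ltr_pdivrMr ?pow2_gt0 //.
  rewrite -natrD -natrX -natrM ltr_nat => /leq_trans; apply.
  by rewrite addnn -mul2n leq_mul2l leq_pexp2l ?orbT // ltnW.
have ul : uniq lst by apply: allpairs_uniq => //; [exact: iota_uniq | exact: iota_uniq | move=> [? ?] [? ?]].
move=> l; apply: (@pl_eq _ _ (fun z => z 0 l + \sum_(kj <- lst) (if `[< selected kj.1 kj.2 >] then psi kj.1 kj.2 z 0 l - z 0 l else 0)) _ _ (r / 2)); first by lra.
  move=> z zx; case: (Psi_cases z) => [[kj m ->]|[nm ->]].
    rewrite (bigD1_seq kj) /=; [|exact: fin m zx|exact: ul].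
    rewrite ifT; last by apply/asboolP; case: m.
    rewrite big1 ?addr0; first by rewrite addrC subrK.
    move=> kj' ne; case: asboolP => // sel; rewrite psi_eq ?subrr // => m'.
    by case/eqP: ne; apply: moved_unique m' m.
  rewrite big1 ?addr0 // => kj _; case: asboolP => // sel.
  by rewrite psi_eq ?subrr.
apply: pl_add; first exact: pl_coord.
apply: pl_sum => kj; case: asboolP => _; last exact: pl_cst.
apply: pl_sub; last exact: pl_coord.
exact: plv_staircase.
Qed.

Definition Z' (x : X) := Z x \/ exists s, Psi (gam s) = x.

Lemma theta_cont theta : (forall y, g (theta y) = Psi (g y) /\ (Psi (g y) = g y -> theta y = y)) ->
  (forall y, `|theta y - y| <= e) /\ (forall y, contat theta y).
Proof.
move=> ht; have c0 := cc_ge0; have e0' := e0.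
have near y : `|theta y - y| <= e /\ forall z, Z (g z) -> `|theta y - y| <= `|y - z|.
  have [E1 E2] := ht y; case: (Psi_cases (g y)) => [[kj m E]|[_ /E2 ->]]; last first.
    by rewrite subrr normr0; split; [exact: ltW | move=> z _; exact: normr_ge0].
  have [_ _ b] := moved_supp m; have [_ _ b'] := moved_supp (moved_psi m).
  case: (m) => -[[_ _ _ g4] _] _.
  rewrite -E -E1 in b'; have [h1 h2] := g4 _ _ b b'.
  by rewrite distrC; split=> // z /h2.
have nearM y : `|theta y - y| <= e by case: (near y).
split=> // y d d0.
have [zy|nzy] := pselect (Z (g y)).
  have ty : theta y = y by apply: (ht y).2; apply: Psi_Z.
  exists (d / 2); first by lra.
  move=> y' yy; rewrite ty.
  have -> : theta y' - y = (theta y' - y') + (y' - y) by rewrite addrA subrK.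
  apply: le_lt_trans (ler_normD _ _) _.
  by have := (near y').2 y zy; lra.
have nz' : ~ Z (g (theta y)) by rewrite (ht y).1; apply: Psi_notZ.
have [r r0 hr] := g_control nz' d0.
have cPg : contat (Psi \o g) y by apply: contat_comp (ah_cont I y) (Psi_cont _).
have [d' d'0 hd'] := cPg r r0.
by exists d' => // y' /hd' yy; apply: hr; rewrite (ht y').1 (ht y).1.
Qed.

Lemma rectify_almost_homeo theta : (forall y, g (theta y) = Psi (g y) /\ (Psi (g y) = g y -> theta y = y)) ->
  almost_homeo (M + e) (g \o theta) Z' D'.
Proof.
move=> ht; have [tn tc] := theta_cont ht.
have gt y : g (theta y) = Psi (g y) by case: (ht y).
split.
- by move=> y; apply: contat_comp (tc y) (ah_cont I _).
- move=> y /=; have -> : g (theta y) - y = (g (theta y) - theta y) + (theta y - y) by rewrite addrA subrK.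
  by apply: le_trans (ler_normD _ _) _; apply: lerD => //; exact: (ah_near I).
- move=> x; have [w wx] := Psi_surj x; have [y yw] := ah_surj I w.
  by exists y; rewrite /= gt yw.
- move=> x nz.
  have nzx : ~ Z x by move=> h; apply: nz; left.
  have [r r0 hr] := ah_closed I nzx.
  have [||||r' r'0 hr'] := @closed_image_gap R n (g \o theta) (fun y => exists s, y = ln s) (M + e) x.
  + by move=> y; apply: contat_comp (tc y) (ah_cont I _).
  + move=> y /=; have -> : g (theta y) - y = (g (theta y) - theta y) + (theta y - y) by rewrite addrA subrK.
    by apply: le_trans (ler_normD _ _) _; apply: lerD => //; exact: (ah_near I).
  + exact: line_closed.
  + by move=> y [s ->] /= E; apply: nz; right; exists s; rewrite -E gt.
  exists (Num.min r r'); first by rewrite lt_min r0.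
  move=> z; rewrite lt_min => /andP [zr zr'] [zz|[s sz]]; first by case: (hr _ zr).
  have : r' <= `|(g \o theta) (ln s) - x| by apply: hr'; exists s.
  by rewrite /= gt -/(gam s) sz; lra.
- by move=> x nz; apply: (ah_box I) => h; apply: nz; left.
- move=> x [zx|[s sx]] xb.
    by have [l hl] := ah_lines I zx xb; exists l => j /hl; left.
  have [zs|nzs] := pselect (Z (gam s)).
    rewrite Psi_Z // in sx; rewrite sx in zs.
    by have [l hl] := ah_lines I zs xb; exists l => j /hl; left.
  have [fs|nfs] := pselect (flat s).
    have [k [j [l hl]]] := Psi_flat fs.
    exists l => h hi; right; left; rewrite -sx.
    by case: (hl h hi) => ->; [exists (k, j, h) | exists (k, j.+1, h)].
  have bs : bend s by [].
  exists i => l _; right; right; exists l, s => //.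
  by rewrite -sx Psi_bend.
- move=> y y' /=; rewrite !gt => /Psi_inj E nz; apply: (ah_inj I E) => h.
  by apply: nz; left; rewrite Psi_Z.
- move=> y /=; rewrite gt => nz.
  have nzg : ~ Z (g y) by move=> h; apply: nz; left; rewrite Psi_Z.
  have ng s : gam s <> g y by move=> E; apply: nz; right; exists s; rewrite E.
  apply: (@plv_eq _ _ _ (Psi \o g) _ _ 1) => // [z _|]; first by rewrite /= gt.
  by apply: plv_comp; [exact: (ah_pl I) | exact: plv_Psi].
Qed.

End Rectify.

Lemma rectify (R : realType) (n : nat) (M e : R) (g : 'rV[R]_n -> 'rV[R]_n)
    (Z : 'rV[R]_n -> Prop) (D : R -> Prop) (i : 'I_n) (mu : 'rV[R]_n) :
  almost_homeo M g Z D -> 0 < e -> enumerable D ->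
  exists theta Z1 D1, [/\ forall y, contat theta y, forall y, `|theta y - y| <= e,
    enumerable D1, almost_homeo (M + e) (g \o theta) Z1 D1 &
    (forall x, Z x -> Z1 x) /\ forall s, Z1 (g (theta (line i mu s)))].
Proof.
move=> I e0 eD.
have M0 : 0 <= M + 1 by apply: le_trans (_ : `|g 0 - 0| + 1 <= _); [rewrite addr_ge0 | rewrite lerD2r (ah_near I)].
have /andP [_ hN] := truncn_itv M0.
have MN := ltW hN.
have [theta ht] := theta_ex I i mu e (Num.truncn (M + 1)).+1.
have [h1 h2] := theta_cont I e0 ht.
exists theta, (Z' g Z i mu e (Num.truncn (M + 1)).+1), (D' g Z D i mu (Num.truncn (M + 1)).+1).
split.
- exact: h2.
- exact: h1.
- exact: (D'_enumerable I).
- exact: (rectify_almost_homeo I).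
- split; first by move=> x; left.
  by move=> s; right; exists s; case: (ht (line i mu s)).
Qed.

(** * Collapsing a tube onto a line *)

Lemma contat_continuous (R : realType) (f : R -> R) : (forall x, contat f x) -> continuous f.
Proof.
move=> cf x; apply/cvgrPdist_lt => e e0; have [d d0 h] := cf x e e0.
near=> y; rewrite distrC; apply: h; near: y.
by apply: nbhsx_ballx_sub || (apply/nbhs_ballP; exists d => // y; rewrite /ball /= distrC).
Unshelve. all: by end_near.
Qed.

Lemma pl_bigmin (R : realType) n (I : Type) (s : seq I) (P : pred I) (F : I -> 'rV[R]_n -> R) (c : 'rV[R]_n -> R) x :
  pl c x -> (forall i, pl (F i) x) -> pl (fun y => \big[Num.min/c y]_(i <- s | P i) F i y) x.
Proof.
move=> hc h; elim: s => [|i s IH].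
  by apply: (@pl_eq _ _ c _ _ 1) => // y _; rewrite big_nil.
case Pi: (P i).
  apply: (@pl_eq _ _ (fun y => Num.min (F i y) (\big[Num.min/c y]_(i <- s | P i) F i y)) _ _ 1) => //.
    by move=> y _; rewrite big_cons Pi.
  exact: pl_min.
by apply: (@pl_eq _ _ _ _ _ 1) IH => // y _; rewrite big_cons Pi.
Qed.

Section Zeta.
Variables (R : realType) (eta : R).
Hypothesis eta0 : 0 < eta.
Local Notation p2 k := ((2 ^+ k)^-1 : R).

(* [zeta _ rho] is a concave piecewise linear bijection from [0, eta + rho] to [0, rho]: an infimum that is
   a finite minimum locally in [rho > 0], while its slopes tend to 0 with [rho]. *)
Definition zterm (k : nat) (w rho : R) : R :=
  p2 k * w + Num.max 0 ((1 - p2 k) * rho - p2 k * eta).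

Definition zeta (w rho : R) : R := inf [set t | exists k, t = zterm k w rho].

Lemma p2_gt0 k : 0 < p2 k. Proof. by rewrite invr_gt0 exprn_gt0. Qed.

Lemma p2_le1 k : p2 k <= 1.
Proof. by rewrite invf_le1 ?exprn_gt0 // exprn_ege1 //; lra. Qed.

Lemma p2_le k k' : (k <= k')%N -> p2 k' <= p2 k.
Proof. by move=> kk; rewrite lef_pV2 ?posrE ?exprn_gt0 //; apply: ler_weXn2l => //; lra. Qed.

Lemma zterm_ge0 k w rho : 0 <= w -> 0 <= zterm k w rho.
Proof.
move=> w0; apply: addr_ge0; last by rewrite le_max lexx.
by apply: mulr_ge0 => //; apply/ltW/p2_gt0.
Qed.

Lemma zeta_le k w rho : 0 <= w -> zeta w rho <= zterm k w rho.
Proof.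
by move=> w0; apply: ge_inf; [exists 0 => _ [l ->]; apply: zterm_ge0 | exists k].
Qed.

Lemma zeta_ge c w rho : (forall k, c <= zterm k w rho) -> c <= zeta w rho.
Proof.
by move=> h; apply: lb_le_inf; [exists (zterm 0 w rho), 0%N | move=> _ [k ->]].
Qed.

Lemma zeta_ge0 w rho : 0 <= w -> 0 <= zeta w rho.
Proof. by move=> w0; apply: zeta_ge => k; apply: zterm_ge0. Qed.

Lemma zterm0 w rho : zterm 0 w rho = w.
Proof.
rewrite /zterm expr0 invr1 subrr mul0r !mul1r sub0r.
by rewrite (max_idPl _) ?addr0 // oppr_le0 ltW.
Qed.

Lemma zeta_le_id w rho : 0 <= w -> zeta w rho <= w.
Proof. by move=> w0; rewrite -{2}(zterm0 w rho); apply: zeta_le. Qed.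

Lemma zeta0 rho : zeta 0 rho = 0.
Proof. by apply/eqP; rewrite eq_le zeta_le_id ?zeta_ge0. Qed.

Lemma zterm_lin k w rho : p2 k * w + ((1 - p2 k) * rho - p2 k * eta) <= zterm k w rho.
Proof. by rewrite lerD2l le_max lexx orbT. Qed.

Lemma zeta_low w rho : w <= eta + rho -> w - eta <= zeta w rho.
Proof.
move=> h; apply: zeta_ge => k; apply: le_trans (zterm_lin k w rho).
have := p2_le1 k; have := p2_gt0 k; move: (p2 k) => p p0 p1.
have : 0 <= (1 - p) * (eta + rho - w) by apply: mulr_ge0; lra.
lra.
Qed.

Lemma zeta_end rho : 0 <= rho -> zeta (eta + rho) rho = rho.
Proof.
move=> r0; apply/eqP; rewrite eq_le; apply/andP; split; last first.
  by have := zeta_low (lexx (eta + rho)); rewrite addrC addKr.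
apply/ler_addgt0Pr => d d0.
have e0 := eta0.
have [k hk] := pow2_small (divr_gt0 d0 e0).
apply: le_trans (zeta_le k _ _) _; first by lra.
rewrite /zterm; have p0 := p2_gt0 k; have p1 := p2_le1 k.
have pe : p2 k * eta <= d by rewrite -ler_pdivlMr // ltW.
have pr : p2 k * rho <= rho by rewrite ler_piMl.
by rewrite mulrDr; case: (lerP 0 _) => _; lra.
Qed.

Lemma zeta_rho0 w : 0 <= w -> zeta w 0 = 0.
Proof.
move=> w0; apply/eqP; rewrite eq_le zeta_ge0 // andbT.
apply/ler_addgt0Pr => d d0; rewrite add0r.
have w1 : 0 < w + 1 by lra.
have [k hk] := pow2_small (divr_gt0 d0 w1).
apply: le_trans (zeta_le k _ _) _ => //.
have e0 := eta0; have p0 := p2_gt0 k.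
rewrite /zterm mulr0 sub0r (max_idPl _) ?addr0; last by rewrite oppr_le0 ltW // mulr_gt0.
by move: hk; rewrite ltr_pdivlMr // mulrDr; lra.
Qed.

Lemma zeta_lip w w' rho rho' : 0 <= w -> 0 <= w' ->
  `|zeta w rho - zeta w' rho'| <= `|w - w'| + `|rho - rho'|.
Proof.
have H a a' b b' : 0 <= a -> 0 <= a' -> zeta a b - zeta a' b' <= `|a - a'| + `|b - b'|.
  move=> a0 a'0; rewrite lerBlDl -lerBlDr; apply: zeta_ge => k.
  rewrite lerBlDr; apply: le_trans (zeta_le k _ a0) _.
  rewrite /zterm; have p0 := p2_gt0 k; have p1 := p2_le1 k.
  have h1 : p2 k * a <= p2 k * a' + `|a - a'|.
    rewrite -lerBlDl -mulrBr; apply: le_trans (_ : p2 k * `|a - a'| <= _).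
      by apply: ler_wpM2l; [exact: ltW | exact: ler_norm].
    by rewrite ler_piMl.
  have h2 : (1 - p2 k) * b <= (1 - p2 k) * b' + `|b - b'|.
    rewrite -lerBlDl -mulrBr; apply: le_trans (_ : (1 - p2 k) * `|b - b'| <= _).
      by apply: ler_wpM2l; [lra | exact: ler_norm].
    by rewrite ler_piMl //; lra.
  have n0 := normr_ge0 (b - b').
  by case: (lerP 0 ((1 - p2 k) * b - _)) => ?; case: (lerP 0 ((1 - p2 k) * b' - _)) => ?; lra.
move=> w0 w'0; rewrite ler_norml; apply/andP; split; last exact: H.
by rewrite lerNl opprB (distrC w) (distrC rho); apply: H.
Qed.

Lemma zeta_min K w rho : 0 <= w -> w <= eta + rho -> p2 K * eta <= (1 - p2 K) * rho ->
  zeta w rho = \big[Num.min/w]_(k < K.+1) zterm k w rho.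
Proof.
move=> w0 wr hK; apply/eqP; rewrite eq_le; apply/andP; split.
  by apply/bigmin_geP; split=> [|k _]; [exact: zeta_le_id | exact: zeta_le].
apply: zeta_ge => k; case: (leqP k K) => kK.
  by apply: (@bigmin_le_cond _ _ _ _ (Ordinal (kK : (k < K.+1)%N))).
apply: le_trans (_ : zterm K w rho <= _).
  by apply: (@bigmin_le_cond _ _ _ _ ord_max).
apply: le_trans (zterm_lin k w rho).
rewrite /zterm (max_idPr _); last by rewrite subr_ge0.
have pp := p2_le (ltnW kK); have : 0 <= (p2 K - p2 k) * (eta + rho - w) by apply: mulr_ge0; lra.
lra.
Qed.

Lemma zeta_cut rho : 0 < rho -> exists K, forall rho', rho <= rho' -> p2 K * eta <= (1 - p2 K) * rho'.
Proof.
have e0 := eta0; move=> r0; have q0 : 0 < rho / (eta + rho) by apply: divr_gt0; lra.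
have [K hK] := pow2_small q0; exists K => r' rr.
have p0 := p2_gt0 K; have p1 := p2_le1 K.
move: hK; rewrite ltr_pdivlMr; last by lra.
have : (1 - p2 K) * rho <= (1 - p2 K) * r' by apply: ler_wpM2l => //; lra.
lra.
Qed.

Lemma zeta_strict w w' rho : 0 < rho -> 0 <= w -> w < w' -> w' <= eta + rho -> zeta w rho < zeta w' rho.
Proof.
move=> r0 w0 ww wr; have [K hK] := zeta_cut r0; have hK' := hK rho (lexx _).
have w'0 : 0 <= w' by lra.
rewrite (zeta_min w'0 wr hK'); apply/bigmin_gtP; split.
  by apply: le_lt_trans ww; apply: zeta_le_id.
move=> k _; apply: le_lt_trans (zeta_le k _ w0) _.
by rewrite /zterm ltrD2r ltr_pM2l // p2_gt0.
Qed.

Definition szeta (w rho : R) : R := zeta (Num.max 0 w) rho - zeta (Num.max 0 (- w)) rho.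

Lemma szeta_pos w rho : 0 <= w -> szeta w rho = zeta w rho.
Proof.
by move=> w0; rewrite /szeta (max_idPr w0) (max_idPl _) ?oppr_le0 // zeta0 subr0.
Qed.

Lemma szeta_neg w rho : szeta (- w) rho = - szeta w rho.
Proof.
by rewrite /szeta (opprK w) opprB.
Qed.

Lemma szeta_abs w rho : `|szeta w rho| = zeta `|w| rho.
Proof.
case: (lerP 0 w) => w0; first by rewrite szeta_pos // !ger0_norm // zeta_ge0.
have nw : 0 <= - w by lra.
by rewrite -{1}[w]opprK szeta_neg normrN (szeta_pos _ nw) (ltr0_norm w0) ger0_norm // zeta_ge0.
Qed.

Lemma szeta_id w rho : `|w| <= eta + rho -> `|szeta w rho - w| <= eta.
Proof.
have H v : 0 <= v -> v <= eta + rho -> `|szeta v rho - v| <= eta.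
  move=> v0 vr; rewrite szeta_pos // ler_norml; have := zeta_le_id rho v0.
  by have := zeta_low vr; have := eta0; move=> *; apply/andP; split; lra.
case: (lerP 0 w) => w0 wr; first by apply: H => //; move: wr; rewrite ger0_norm.
rewrite (ltr0_norm w0) in wr.
have nw : 0 <= - w by lra.
by have := H _ nw wr; rewrite szeta_neg -normrN opprB opprK addrC.
Qed.

Lemma szeta_rho0 w : szeta w 0 = 0.
Proof. by rewrite /szeta !zeta_rho0 ?subrr // le_max lexx. Qed.

Lemma szeta_end rho : 0 <= rho -> szeta (eta + rho) rho = rho.
Proof. by have e0 := eta0; move=> r0; rewrite szeta_pos ?zeta_end //; lra. Qed.

Lemma szeta_strict w w' rho : 0 < rho -> `|w| <= eta + rho -> `|w'| <= eta + rho ->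
  w < w' -> szeta w rho < szeta w' rho.
Proof.
move=> r0; rewrite !ler_norml => /andP [h1 h2] /andP [h3 h4] ww.
have nn v : 0 <= v -> 0 <= zeta v rho by exact: zeta_ge0.
case: (lerP 0 w) => w0.
  by rewrite !szeta_pos //; [exact: zeta_strict | lra].
have nw : 0 <= - w by lra.
rewrite -[w]opprK szeta_neg (szeta_pos _ nw).
case: (lerP 0 w') => w'0.
  rewrite szeta_pos //; have := nn _ w'0.
  have : zeta 0 rho < zeta (- w) rho by apply: zeta_strict => //; lra.
  by rewrite zeta0; lra.
have nw' : 0 <= - w' by lra.
rewrite -[w']opprK szeta_neg (szeta_pos _ nw') ltrN2; apply: zeta_strict => //; lra.
Qed.

Lemma szeta_lip w w' rho rho' : `|szeta w rho - szeta w' rho'| <= 2 * (`|w - w'| + `|rho - rho'|).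
Proof.
have -> : szeta w rho - szeta w' rho' =
  (zeta (Num.max 0 w) rho - zeta (Num.max 0 w') rho') -
  (zeta (Num.max 0 (- w)) rho - zeta (Num.max 0 (- w')) rho') by rewrite /szeta; ring.
apply: le_trans (ler_normB _ _) _.
have p v : 0 <= Num.max 0 v :> R by rewrite le_max lexx.
have := zeta_lip rho rho' (p w) (p w'); have := zeta_lip rho rho' (p (- w)) (p (- w')).
have := max0_dist w w'; have := max0_dist (- w) (- w').
rewrite -opprD normrN; lra.
Qed.

Lemma szeta_surj z rho : 0 <= rho -> `|z| <= rho ->
  exists2 w, `|w| <= eta + rho & szeta w rho = z.
Proof.
have e0 := eta0; move=> r0; rewrite ler_norml => /andP [z1 z2].
have cf : continuous (szeta ^~ rho).
  apply: contat_continuous => x; apply: (@contat_lip _ _ _ _ 2) => // y.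
  by have := szeta_lip y x rho rho; rewrite subrr normr0 addr0.
have [|||w] := @IVT R (szeta ^~ rho) (- (eta + rho)) (eta + rho) z.
- by lra.
- exact: continuous_subspaceT.
- by rewrite szeta_neg szeta_end // ge_min le_max z1 z2 orbT.
by rewrite in_itv /= => /andP [w1 w2] <-; exists w => //; rewrite ler_norml w1.
Qed.

Lemma pl_szeta n (F G : 'rV[R]_n -> R) y : pl F y -> pl G y -> 0 < G y ->
  (forall z, `|F z| <= eta + G z) -> pl (fun z => szeta (F z) (G z)) y.
Proof.
move=> pF pG G0 FG.
have [d d0 hd] : exists2 d : R, 0 < d & forall z, `|z - y| < d -> G y / 2 <= G z.
  have G2 : 0 < G y / 2 by lra.
  have [d d0 hd] := pG.1 _ G2; exists d => // z /hd; rewrite ltr_norml => /andP [? ?]; lra.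
have G2 : 0 < G y / 2 by lra.
have [K hK] := zeta_cut G2.
pose T (H : 'rV[R]_n -> R) z := \big[Num.min/Num.max 0 (H z)]_(k < K.+1) zterm k (Num.max 0 (H z)) (G z).
have pT H : pl H y -> pl (T H) y.
  move=> pH.
  have pM : pl (fun z => Num.max 0 (H z)) y by apply: pl_max => //; exact: pl_cst.
  have pk k : pl (fun z => zterm k (Num.max 0 (H z)) (G z)) y.
    apply: pl_add; first exact: pl_scale.
    apply: pl_max; first exact: pl_cst.
    by apply: pl_sub; [exact: pl_scale | exact: pl_cst].
  exact: pl_bigmin.
apply: (@pl_eq _ _ (fun z => T F z - T (fun x => - F x) z) _ _ d) => //.
  move=> z /hd /hK hz; rewrite /szeta /T.
  have := FG z; rewrite ler_norml => /andP [F1 F2].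
  have gz : 0 <= eta + G z by lra.
  by rewrite -!zeta_min ?le_max ?lexx // ge_max gz //=; lra.
by apply: pl_sub; apply: pT => //; exact: pl_opp.
Qed.

End Zeta.

Section Collapse.
Variables (R : realType) (n : nat).
Local Notation X := 'rV[R]_n.
Variables (i : 'I_n) (mu : X) (eta : R).
Hypothesis eta0 : 0 < eta.
Implicit Types (x y z : X).

Definition offline (y : X) : R := \big[Num.max/0]_(j | j != i) `|y 0 j - mu 0 j|.
Definition excess (y : X) : R := Num.max 0 (offline y - eta).
Definition collapse (y : X) : X :=
  \row_j if j == i then y 0 i else mu 0 j + szeta eta (y 0 j - mu 0 j) (excess y).

Lemma offline_ge y j : j != i -> `|y 0 j - mu 0 j| <= offline y.
Proof. by move=> ji; apply: (le_bigmax_cond _ (fun j => `|y 0 j - mu 0 j|)). Qed.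

Lemma offline_le y (r : R) : 0 <= r -> (forall j, j != i -> `|y 0 j - mu 0 j| <= r) -> offline y <= r.
Proof. by move=> r0 h; apply/bigmax_leP; split. Qed.

Lemma offline_ge0 y : 0 <= offline y.
Proof. exact: bigmax_ge_id. Qed.

Lemma offline_attained y : 0 < offline y -> exists2 j, j != i & `|y 0 j - mu 0 j| = offline y.
Proof.
move=> h; apply: contrapT => h'.
suff : offline y < offline y by rewrite ltxx.
rewrite {1}/offline; apply/bigmax_ltP; split=> // j ji.
by rewrite lt_neqAle offline_ge // andbT; apply/eqP => E; apply: h'; exists j.
Qed.

Lemma excess_ge0 y : 0 <= excess y. Proof. by rewrite le_max lexx. Qed.

Lemma offline_excess y : offline y <= eta + excess y.
Proof. by rewrite addrC -lerBlDr le_max lexx orbT. Qed.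

Lemma excess_gt0 y : 0 < excess y -> offline y = eta + excess y.
Proof. by rewrite lt_max ltxx /= /excess => h; rewrite (max_idPr (ltW h)) addrC subrK. Qed.

Lemma off_le y j : j != i -> `|y 0 j - mu 0 j| <= eta + excess y.
Proof. by move=> ji; apply: le_trans (offline_ge _ ji) (offline_excess y). Qed.

Lemma offline0 y : offline y = 0 -> y = line i mu (y 0 i).
Proof.
move=> h; apply: lineE => j ji; apply/eqP; rewrite -subr_eq0 -normr_le0 -h.
exact: offline_ge.
Qed.

Lemma offline_collapse y : offline (collapse y) = excess y.
Proof.
have e0 := eta0; have x0 := excess_ge0 y.
apply/eqP; rewrite eq_le; apply/andP; split.
  apply: offline_le => // j ji; rewrite mxE (negbTE ji) addrC addKr szeta_abs //.
  rewrite -{2}(zeta_end eta0 x0).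
  have := off_le y ji; rewrite le_eqVlt => /orP [/eqP -> //|lt].
  case: (eqVneq (excess y) 0) => [->|ne]; first by rewrite !zeta_rho0 //; lra.
  by apply/ltW/zeta_strict => //; rewrite lt_neqAle eq_sym ne.
case: (lerP (excess y) 0) => h; first by apply: le_trans h (offline_ge0 _).
have /offline_attained [j ji jE] : 0 < offline y by rewrite (excess_gt0 h); lra.
have := offline_ge (collapse y) ji; rewrite mxE (negbTE ji) addrC addKr szeta_abs //.
by rewrite jE (excess_gt0 h) zeta_end.
Qed.

Lemma collapse_near y : `|collapse y - y| <= eta.
Proof.
have e0 := eta0; apply/norm_rV_le; first lra.
move=> j; rewrite !mxE; case: (eqVneq j i) => [->|ji]; first by rewrite subrr normr0; lra.
have -> : mu 0 j + szeta eta (y 0 j - mu 0 j) (excess y) - y 0 j =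
  szeta eta (y 0 j - mu 0 j) (excess y) - (y 0 j - mu 0 j) by ring.
by apply: szeta_id => //; apply: off_le.
Qed.

Lemma excess_lip y y' : `|excess y - excess y'| <= `|y - y'|.
Proof.
apply: le_trans (max0_dist _ _) _.
have -> : offline y - eta - (offline y' - eta) = offline y - offline y' by ring.
have H u v : offline u - offline v <= `|u - v|.
  rewrite lerBlDr; apply: offline_le; first by rewrite addr_ge0 ?offline_ge0.
  move=> j ji; have -> : u 0 j - mu 0 j = (u - v) 0 j + (v 0 j - mu 0 j) by rewrite !mxE; ring.
  by apply: le_trans (ler_normD _ _) _; apply: lerD; [exact: coord_le_norm | exact: offline_ge].
by rewrite ler_norml; apply/andP; split; last exact: H; rewrite lerNl opprB distrC; exact: H.
Qed.

Lemma collapse_cont y : contat collapse y.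
Proof.
apply: (@contat_lip _ _ _ _ 4) => // z.
have N0 := normr_ge0 (z - y).
apply/norm_rV_le; first lra.
move=> j; rewrite !mxE; have := coord_le_norm (z - y) j; rewrite !mxE => hj.
case: (eqVneq j i) => [ji|ji]; first by subst j; lra.
have -> : mu 0 j + szeta eta (z 0 j - mu 0 j) (excess z) - (mu 0 j + szeta eta (y 0 j - mu 0 j) (excess y))
  = szeta eta (z 0 j - mu 0 j) (excess z) - szeta eta (y 0 j - mu 0 j) (excess y) by ring.
apply: le_trans (szeta_lip _ _ _ _ _) _.
have -> : z 0 j - mu 0 j - (y 0 j - mu 0 j) = z 0 j - y 0 j by ring.
by have := excess_lip z y; lra.
Qed.

Lemma collapse_line y : offline y <= eta -> collapse y = line i mu (y 0 i).
Proof.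
move=> h; have E : excess y = 0 by rewrite /excess (max_idPl _) // subr_le0.
apply/rowP => j; rewrite !mxE; case: (j == i) => //.
by rewrite E szeta_rho0 // addr0.
Qed.

Lemma collapse_inj y y' : collapse y = collapse y' ->
  ~ (exists s, collapse y = line i mu s) -> y = y'.
Proof.
move=> E nl.
have x0 : 0 < excess y.
  rewrite lt_neqAle excess_ge0 andbT; apply/eqP => h; apply: nl; exists (y 0 i).
  by apply: collapse_line; have := offline_excess y; rewrite -h addr0.
have Ex : excess y = excess y' by rewrite -!offline_collapse E.
apply/rowP => j; move: E => /(congr1 (fun x : X => x 0 j)); rewrite !mxE.
case: (eqVneq j i) => [->//|ji]; rewrite -Ex => /addrI E.
apply: (addIr (- mu 0 j)).
have w1 := off_le y ji; have w2 := off_le y' ji; rewrite -Ex in w2.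
case: (ltrgtP (y 0 j - mu 0 j) (y' 0 j - mu 0 j)) => // L.
- by have := szeta_strict eta0 x0 w1 w2 L; rewrite E ltxx.
- by have := szeta_strict eta0 x0 w2 w1 L; rewrite E ltxx.
Qed.

Lemma collapse_surj x : exists y, collapse y = x.
Proof.
have e0 := eta0.
case: (lerP (offline x) 0) => h.
  have E : offline x = 0 by apply/eqP; rewrite eq_le h offline_ge0.
  by exists x; rewrite collapse_line ?E -?offline0 //; lra.
set rho := offline x in h.
have /choice [w hw] : forall j, exists w, j != i -> `|w| <= eta + rho /\ szeta eta w rho = x 0 j - mu 0 j.
  move=> j; case: (eqVneq j i) => [->|ji]; first by exists 0.
  have [w w1 w2] := szeta_surj eta0 (ltW h) (offline_ge x ji).
  by exists w.
pose y : X := \row_j if j == i then x 0 i else mu 0 j + w j.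
have yw j : j != i -> y 0 j - mu 0 j = w j by move=> ji; rewrite mxE (negbTE ji) addrC addKr.
have oy : offline y = eta + rho.
  apply/eqP; rewrite eq_le; apply/andP; split.
    by apply: offline_le; [lra | move=> j ji; rewrite yw //; case: (hw j ji)].
  have [j ji jE] := offline_attained h.
  apply: le_trans (offline_ge y ji); rewrite yw //.
  have [w1 w2] := hw j ji; rewrite leNgt; apply/negP => L.
  have : zeta eta `|w j| rho < zeta eta (eta + rho) rho by apply: zeta_strict.
  by rewrite zeta_end ?ltW // -szeta_abs // w2 jE ltxx.
have xy : excess y = rho by rewrite /excess oy addrC addKr; apply/max_idPr/ltW.
exists y; apply/rowP => j; rewrite [LHS]mxE; case: (eqVneq j i) => [->|ji].
  by rewrite mxE eqxx.
by rewrite yw // xy (hw j ji).2 addrC subrK.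
Qed.

Lemma plv_collapse y : 0 < excess y -> plv collapse y.
Proof.
move=> x0.
have pw j : pl (fun z : X => z 0 j - mu 0 j) y by apply: pl_sub; [exact: pl_coord | exact: pl_cst].
have px : pl excess y.
  apply: pl_max; first exact: pl_cst.
  apply: pl_sub; last exact: pl_cst.
  by apply: pl_bigmax => j; apply: pl_abs.
move=> j; case: (eqVneq j i) => [->|ji].
  by apply: (@pl_eq _ _ (fun z : X => z 0 i) _ _ 1) => //; [move=> z _; rewrite mxE eqxx | exact: pl_coord].
apply: (@pl_eq _ _ (fun z : X => mu 0 j + szeta eta (z 0 j - mu 0 j) (excess z)) _ _ 1) => //.
  by move=> z _; rewrite mxE (negbTE ji).
apply: pl_add; first exact: pl_cst.
by apply: pl_szeta => // z; apply: off_le.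
Qed.

End Collapse.

Lemma collapse_almost_homeo (R : realType) (n : nat) (M eta : R) (g : 'rV[R]_n -> 'rV[R]_n)
    (Z : 'rV[R]_n -> Prop) (D : R -> Prop) (i : 'I_n) (mu : 'rV[R]_n) :
  almost_homeo M g Z D -> 0 < eta -> (forall s, Z (g (line i mu s))) ->
  almost_homeo (M + eta) (g \o collapse i mu eta) Z D.
Proof.
move=> I eta0 hl.
have nline y : ~ Z (g (collapse i mu eta y)) -> ~ (exists s, collapse i mu eta y = line i mu s).
  by move=> nz [s E]; apply: nz; rewrite E.
split.
- by move=> y; apply: contat_comp (collapse_cont _ _ _ y) (ah_cont I _).
- move=> y /=; have -> : g (collapse i mu eta y) - y = (g (collapse i mu eta y) - collapse i mu eta y) + (collapse i mu eta y - y).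
    by rewrite addrA subrK.
  apply: le_trans (ler_normD _ _) _; apply: lerD; [exact: (ah_near I) | exact: collapse_near].
- move=> x; have [w wx] := ah_surj I x; have [y yw] := collapse_surj i mu eta0 w.
  by exists y; rewrite /= yw.
- exact: (ah_closed I).
- exact: (ah_box I).
- exact: (ah_lines I).
- move=> y y' /= E nz; apply: (collapse_inj eta0 (ah_inj I E nz)); exact: nline.
- move=> y /= nz; apply: plv_comp; last exact: (ah_pl I).
  apply: plv_collapse => //; rewrite lt_neqAle excess_ge0 andbT; apply/eqP => h.
  apply: (nline y nz); exists (y 0 i); apply: collapse_line => //.
  by have := offline_excess i mu eta y; rewrite -h addr0.
Qed.

Lemma rectify_collapse (R : realType) (n : nat) (M e : R) (g : 'rV[R]_n -> 'rV[R]_n)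
    (Z : 'rV[R]_n -> Prop) (D : R -> Prop) (i : 'I_n) (mu : 'rV[R]_n) :
  almost_homeo M g Z D -> 0 < e -> enumerable D ->
  exists t Z1 D1, [/\ forall y, contat t y, forall y, `|t y - y| <= e,
    enumerable D1, almost_homeo (M + e) (g \o t) Z1 D1 &
    (forall x, Z x -> Z1 x) /\
    exists2 eta, 0 < eta & forall y : 'rV[R]_n, (forall j, j != i -> `|y 0 j - mu 0 j| <= eta) -> Z1 (g (t y))].
Proof.
move=> I e0 eD; have e2 : 0 < e / 2 by lra.
have [th [Z1 [D1 [h1 h2 h3 h4 [h5 h6]]]]] := rectify i mu I e2 eD.
have I' := collapse_almost_homeo h4 e2 h6.
exists (th \o collapse i mu (e / 2)), Z1, D1; split=> //.
- by move=> y; apply: contat_comp (collapse_cont _ _ _ y) (h1 _).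
- move=> y /=; have -> : th (collapse i mu (e / 2) y) - y =
    (th (collapse i mu (e / 2) y) - collapse i mu (e / 2) y) + (collapse i mu (e / 2) y - y) by rewrite addrA subrK.
  apply: le_trans (ler_normD _ _) _.
  by have := h2 (collapse i mu (e / 2) y); have := collapse_near i mu e2 y; lra.
- by move: I'; have -> : M + e / 2 + e / 2 = M + e by lra.
split=> //; exists (e / 2) => // y hy /=.
rewrite collapse_line //; apply: offline_le => //; exact: ltW.
Qed.

(** * The limit map *)

Section Limits.
Variable R : realType.

Lemma interval_limit (u b : nat -> R) (K : nat) :
  (forall k m, (K <= k)%N -> `|u (k + m)%N - u k| <= b k) ->
  exists l, forall k, (K <= k)%N -> `|u k - l| <= b k.
Proof.
move=> h.
have cross k k' : (K <= k)%N -> (K <= k')%N -> u k - b k <= u k' + b k'.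
  move=> Kk Kk'; have b0 := le_trans (normr_ge0 _) (h k 0%N Kk); have b0' := le_trans (normr_ge0 _) (h k' 0%N Kk').
  case: (leqP k k') => kk.
    by have := h k (k' - k)%N Kk; rewrite subnKC // ler_norml => /andP [? ?]; lra.
  by have := h k' (k - k')%N Kk'; rewrite subnKC ?(ltnW kk) // ler_norml => /andP [? ?]; lra.
pose A := [set x | exists2 k, (K <= k)%N & x = u k - b k].
exists (sup A) => k Kk.
have A0 : A !=set0 by exists (u k - b k), k.
have ub : ubound A (u k + b k) by move=> _ [k' Kk' ->]; apply: cross.
have h1 : sup A <= u k + b k by apply: ge_sup.
have h2 : u k - b k <= sup A by apply: ub_le_sup; [exists (u k + b k) | exists k].
by rewrite ler_norml; apply/andP; split; lra.
Qed.

Lemma row_limit n (u : nat -> 'rV[R]_n) (b : nat -> R) (K : nat) :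
  (forall k m, (K <= k)%N -> `|u (k + m)%N - u k| <= b k) ->
  exists l, forall k, (K <= k)%N -> `|u k - l| <= b k.
Proof.
move=> h.
have /choice [l hl] : forall j : 'I_n, exists l, forall k, (K <= k)%N -> `|u k 0 j - l| <= b k.
  move=> j; apply: (@interval_limit (fun k => u k 0 j)) => k m Kk.
  by have := coord_le_norm (u (k + m)%N - u k) j; rewrite !mxE => /le_trans -> //; apply: h.
exists (\row_j l j) => k Kk; apply/norm_rV_le; first exact: le_trans (normr_ge0 _) (h k 0%N Kk).
by move=> j; rewrite !mxE; apply: hl.
Qed.

End Limits.

Lemma ah_weaken (R : realType) (n : nat) (M M' : R) (g : 'rV[R]_n -> 'rV[R]_n)
    (Z : 'rV[R]_n -> Prop) (D : R -> Prop) : M <= M' -> almost_homeo M g Z D -> almost_homeo M' g Z D.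
Proof. by move=> MM [? h ? ? ? ? ? ?]; split=> // y; apply: le_trans (h y) MM. Qed.

Section Master.
Variables (R : realType) (n : nat).
Local Notation X := 'rV[R]_n.
Local Notation p2 k := ((2 ^+ k)^-1 : R).
Variable lam : nat -> 'I_n * X.

Record stage := Stage { sg_map : X -> X; sg_bad : X -> Prop; sg_coords : R -> Prop; sg_eps : R }.

Definition tube (l : 'I_n * X) (eta : R) (y : X) := forall j, j != l.1 -> `|y 0 j - l.2 0 j| <= eta.

(* Later maps are [sg_map s \o t] with [t] moving points by at most [2 * sg_eps s], so the last clause gives
   uniform convergence on bounded sets. *)
Definition stage_ok k s := [/\ 0 < sg_eps s, almost_homeo (1 - 2 * sg_eps s) (sg_map s) (sg_bad s) (sg_coords s),
  enumerable (sg_coords s), sg_eps s <= p2 k / 2 &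
  forall y z, `|y| <= k%:R -> `|z - y| <= 2 * sg_eps s -> `|sg_map s z - sg_map s y| <= p2 k].

Definition stage_next k s s' := [/\ sg_eps s' <= sg_eps s / 2,
  exists2 t, forall y, `|t y - y| <= sg_eps s & sg_map s' = sg_map s \o t &
  exists2 eta, 0 < eta /\ sg_eps s' <= eta / 4 & forall y, tube (lam k) eta y -> sg_bad s' (sg_map s' y)].

Lemma stage_step k s : stage_ok k s -> exists s', stage_ok k.+1 s' /\ stage_next k s s'.
Proof.
move=> [e0 I eD _ _].
have [t [Z1 [D1 [tc tn eD1 I1 [_ [eta eta0 ht]]]]]] := rectify_collapse (lam k).1 (lam k).2 I e0 eD.
have p0 : 0 < p2 k.+1 by rewrite invr_gt0 exprn_gt0.
have [d d0 hd] := heine_cantor k.+1%:R (ah_cont I1) p0.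
pose e' := Num.min (Num.min (sg_eps s / 2) (p2 k.+1 / 2)) (Num.min (eta / 4) (d / 4)).
have e'0 : 0 < e' by rewrite !lt_min; apply/andP; split; apply/andP; split; lra.
have : e' <= e' by [].
rewrite {2}/e' !le_min => /andP [/andP [h1 h2] /andP [h3 h4]].
exists (Stage (sg_map s \o t) Z1 D1 e'); split.
  split=> //=.
    by apply: ah_weaken I1; lra.
  move=> y z yk zy; apply/ltW; apply: hd => //; lra.
split=> //=; first by exists t.
by exists eta.
Qed.

Definition stage0 := Stage id (fun x => 1 <= `|x|) (fun=> False) (2^-1).

Lemma stage0_ok : stage_ok 0 stage0.
Proof.
split=> //=; first by lra.
- split=> //.
  + by move=> y; apply: contat_id.
  + by move=> y; rewrite subrr normr0; lra.
  + by move=> x; exists x.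
  + move=> x /negP; rewrite -ltNge => x1; exists (1 - `|x|); first lra.
    move=> z zx; apply/negP; rewrite -ltNge.
    have -> : z = (z - x) + x by rewrite subrK.
    by apply: le_lt_trans (ler_normD _ _) _; lra.
  + by move=> x /negP; rewrite -ltNge => x1 j; apply: le_lt_trans x1; apply: coord_le_norm.
  + move=> x x1 h; have : `|x| < 1 by apply/norm_rV_lt.
    by rewrite ltNge x1.
  + by move=> y _; apply: plv_id.
- by exists (fun=> 0).
- by rewrite expr0 invr1 mul1r.
- by move=> y z _; rewrite expr0 invr1; lra.
Qed.

Lemma stages_ex : exists s : nat -> stage, forall k, stage_ok k (s k) /\ stage_next k (s k) (s k.+1).
Proof.
have /choice [nx hnx] : forall ks : nat * stage, exists s', stage_ok ks.1 ks.2 ->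
    stage_ok ks.1.+1 s' /\ stage_next ks.1 ks.2 s'.
  move=> [k s] /=; have [h|h] := pselect (stage_ok k s).
    by have [s' hs'] := stage_step h; exists s'.
  by exists s.
pose S := fix S k := if k is k'.+1 then nx (k', S k') else stage0.
have ok k : stage_ok k (S k).
  by elim: k => [|k IH]; [exact: stage0_ok | case: (hnx (k, S k) IH)].
by exists S => k; split=> //; case: (hnx (k, S k) (ok k)).
Qed.

Definition two_free (D : R -> Prop) (x : X) :=
  (forall j, `|x 0 j| < 1) /\ exists i j, [/\ i != j, ~ D (x 0 i) & ~ D (x 0 j)].

Lemma master : exists (g f : X -> X) (D : R -> Prop), [/\ enumerable D,
  forall y, contat g y,
  forall x, two_free D x -> g (f x) = x /\ `|f x| <= 2,
  forall x e, two_free D x -> 0 < e ->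
    exists2 d, 0 < d & forall x', two_free D x' -> `|x' - x| < d -> `|f x' - f x| < e &
  forall k, exists2 eta, 0 < eta & forall x, two_free D x -> ~ tube (lam k) eta (f x)].
Proof.
have [s hs] := stages_ex.
pose G k := sg_map (s k); pose Z k := sg_bad (s k); pose E k := sg_eps (s k).
have I k : almost_homeo (1 - 2 * E k) (G k) (Z k) (sg_coords (s k)) by case: (hs k) => -[].
have E0 k : 0 < E k by case: (hs k) => -[].
have Ep k : E k <= p2 k / 2 by case: (hs k) => -[].
have md k y z : `|y| <= k%:R -> `|z - y| <= 2 * E k -> `|G k z - G k y| <= p2 k.
  by case: (hs k) => -[_ _ _ _ h] _; apply: h.
have EE k : E k.+1 <= E k / 2 by case: (hs k) => _ [].
have /choice [T hT] : forall k, exists t : X -> X, (forall y, `|t y - y| <= E k) /\ G k.+1 = G k \o t.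
  by move=> k; case: (hs k) => _ [_ [t h1 h2] _]; exists t.
pose C := fix C m k y := if m is m'.+1 then T k (C m' k.+1 y) else y.
have Cn m : forall k y, `|C m k y - y| <= 2 * E k.
  elim: m => [|m IH] k y /=; first by have := E0 k; rewrite subrr normr0; lra.
  have -> : T k (C m k.+1 y) - y = (T k (C m k.+1 y) - C m k.+1 y) + (C m k.+1 y - y) by rewrite addrA subrK.
  apply: le_trans (ler_normD _ _) _.
  by have := (hT k).1 (C m k.+1 y); have := IH k.+1 y; have := EE k; lra.
have GC m : forall k y, G (k + m)%N y = G k (C m k y).
  elim: m => [|m IH] k y /=; first by rewrite addn0.
  by rewrite addnS -addSn IH (hT k).2.
have small (e : R) : 0 < e -> forall N : nat, exists2 k, (N <= k)%N & p2 k < e.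
  move=> e0 N; have [k hk] := pow2_small e0; exists (N + k)%N; first exact: leq_addr.
  by apply: le_lt_trans hk; apply: p2_le; apply: leq_addl.
have /choice [g hg] : forall y, exists l, forall k, `|y| <= k%:R -> `|G k y - l| <= p2 k.
  move=> y; have /andP [_ yN] := truncn_itv (normr_ge0 y).
  have [|l hl] := @row_limit R n (fun k => G k y) (fun k => p2 k) (Num.truncn `|y|).+1.
    move=> k m Kk; rewrite /= GC; apply: md (Cn _ _ _).
    by apply: le_trans (ltW yN) _; rewrite ler_nat.
  exists l => k yk; case: (leqP (Num.truncn `|y|).+1 k) => [|kk]; first exact: hl.
  apply/ler_addgt0Pr => d d0; have [m mk md'] := small d d0 (Num.truncn `|y|).+1.
  have mE : m = (k + (m - k))%N by rewrite subnKC //; apply: leq_trans (ltnW kk) mk.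
  have -> : G k y - l = (G k y - G m y) + (G m y - l) by rewrite addrA subrK.
  apply: le_trans (ler_normD _ _) _; apply: lerD; last by apply: le_trans (hl m mk) (ltW md').
  by rewrite mE GC distrC; apply: md (Cn _ _ _).
pose D x := exists k, sg_coords (s k) x.
have notZ x : two_free D x -> forall k, ~ Z k x.
  move=> [b [i [j [ij Di Dj]]]] k zx; have [l hl] := ah_lines (I k) zx b.
  case: (eqVneq i l) => [il|il].
    by apply: Dj; exists k; apply: hl; rewrite -il eq_sym.
  by apply: Di; exists k; apply: hl.
have /choice [f hf] : forall x, exists l, two_free D x -> forall k y, G k y = x -> `|y - l| <= 2 * E k.
  move=> x; have [hx|hx] := pselect (two_free D x); last by exists 0.
  have nz := notZ x hx.
  have /choice [y hy] : forall k, exists y, G k y = x by move=> k; apply: (ah_surj (I k)).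
  have yC k m : C m k (y (k + m)%N) = y k.
    by apply: (ah_inj (I k)); rewrite -?GC !hy.
  have [|l hl] := @row_limit R n y (fun k => 2 * E k) 0.
    by move=> k m _; rewrite -(yC k m) distrC; apply: Cn.
  exists l => _ k z zx; suff -> : z = y k by apply: hl.
  by apply: (ah_inj (I k)); rewrite zx -?(hy k) // hy.
exists g, f, D.
have gf x : two_free D x -> g (f x) = x /\ `|f x| <= 2.
  move=> hx; have f2 : `|f x| <= 2.
    have x1 : `|x| < 1 by apply/norm_rV_lt => //; case: hx.
    have /choice [y hy] : forall k, exists y, G k y = x by move=> k; apply: (ah_surj (I k)).
    have := hf x hx 0 (y 0) (hy 0); have := ah_near (I 0) (y 0%N); rewrite hy; have := Ep 0%N; have := E0 0%N.
    rewrite expr0 invr1 => a1 a2 a3 a4.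
    have -> : f x = x - (x - y 0%N) - (y 0%N - f x) by apply/rowP => l; rewrite !mxE; ring.
    apply: le_trans (ler_normB _ _) _; apply: le_trans (lerD (ler_normB _ _) (lexx _)) _; lra.
  split=> //; apply/eqP; rewrite -subr_eq0 -normr_le0; apply/ler_addgt0Pr => d d0; rewrite add0r.
  have d2 : 0 < d / 2 by lra.
  have [k k2 kd] := small _ d2 2; have [y hy] := ah_surj (I k) x.
  have fk : `|f x| <= k%:R by apply: le_trans f2 _; rewrite (ler_nat R 2).
  have h1 := hg (f x) k fk; have h2 := md k (f x) y fk (hf x hx k y hy).
  have -> : g (f x) - x = (G k y - G k (f x)) *- 1 - (G k (f x) - g (f x)).
    by rewrite mulr1n hy; apply/rowP => l; rewrite !mxE; ring.
  by apply: le_trans (ler_normB _ _) _; rewrite mulr1n normrN; lra.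
split=> //.
- by apply: enumerable_bigU => k; case: (hs k) => -[].
- move=> y e e0; have e3 : 0 < e / 3 by lra.
  have /andP [_ yN] := truncn_itv (normr_ge0 y).
  have [k k2 kd] := small _ e3 (Num.truncn `|y|).+2.
  have yk : `|y| + 1 <= k%:R.
    apply: le_trans (_ : (Num.truncn `|y|).+2%:R <= _); last by rewrite ler_nat.
    by rewrite -(natr1 (Num.truncn `|y|).+1) lerD2r ltW.
  have [d d0 hd] := ah_cont (I k) y e3.
  exists (Num.min 1 d); first by rewrite lt_min d0 ltr01.
  move=> z; rewrite lt_min => /andP [z1 zd].
  have zk : `|z| <= k%:R.
    have -> : z = (z - y) + y by rewrite subrK.
    by apply: le_trans (ler_normD _ _) _; lra.
  have yk' : `|y| <= k%:R by lra.
  have h1 := hg z k zk; have h2 := hg y k yk'; have h3 := hd z zd.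
  have -> : g z - g y = (G k z - G k y) - (G k z - g z) + (G k y - g y) by apply/rowP => l; rewrite !mxE; ring.
  apply: le_lt_trans (ler_normD _ _) _; apply: le_lt_trans (lerD (ler_normB _ _) (lexx _)) _; lra.
- move=> x e hx e0; have e3 : 0 < e / 3 by lra.
  have [k _ kd] := small _ e3 0%N; have [y hy] := ah_surj (I k) x.
  have nz : ~ Z k (G k y) by rewrite hy; apply: notZ.
  have [r r0 hr] := g_control (I k) nz e3.
  exists r => // x' hx' xx; have [y' hy'] := ah_surj (I k) x'.
  have := hr y'; rewrite hy hy' => /(_ xx) yy.
  have h1 := hf x hx k y hy; have h2 := hf x' hx' k y' hy'; have h3 := Ep k.
  have -> : f x' - f x = (y' - y) - (y' - f x') + (y - f x) by apply/rowP => l; rewrite !mxE; ring.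
  apply: le_lt_trans (ler_normD _ _) _; apply: le_lt_trans (lerD (ler_normB _ _) (lexx _)) _; lra.
- move=> k; case: (hs k) => _ [_ _ [eta [eta0 ee] ht]].
  exists (eta / 2); first by lra.
  move=> x hx ft; have [y hy] := ah_surj (I k.+1) x.
  apply: (notZ x hx k.+1); rewrite -hy; apply: ht => j jl.
  have h1 := hf x hx k.+1 y hy; have := ft j jl.
  have := coord_le_norm (y - f x) j; rewrite !mxE.
  have -> : y 0 j - (lam k).2 0 j = (y 0 j - f x 0 j) + (f x 0 j - (lam k).2 0 j) by ring.
  move=> a1 a2; apply: le_trans (ler_normD _ _) _.
  by move: h1 ee; rewrite /E; lra.
Qed.

End Master.

(** * Making the exceptional coordinates rational *)

Section Rationalize.
Variable R : realType.
Local Notation p2 k := ((2 ^+ k)^-1 : R).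

Definition rational (r : R) := exists q : rat, r = ratr q.

Section Bumps.
Variable d : nat -> R.

Definition bump (m : nat) (x : R) : R := \big[Num.min/1]_(j < m) `|x - d j|.

Lemma bump_ge0 m x : 0 <= bump m x.
Proof. by apply/bigmin_geP; split. Qed.

Lemma bump_le1 m x : bump m x <= 1.
Proof. exact: bigmin_le_id. Qed.

Lemma bump_lip m x y : `|bump m x - bump m y| <= `|x - y|.
Proof.
have H a b : bump m a - `|a - b| <= bump m b.
  apply/bigmin_geP; split.
    by rewrite lerBlDr; apply: le_trans (bump_le1 m a) _; rewrite lerDl.
  move=> j _; rewrite lerBlDr; apply: le_trans (_ : `|a - d j| <= _).
    exact: (bigmin_le_cond _ (fun j : 'I_m => `|a - d j|)).
  have -> : a - d j = (b - d j) + (a - b) by ring.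
  exact: ler_normD.
have := H x y; have := H y x; rewrite (distrC y) ler_norml => *.
by apply/andP; split; lra.
Qed.

Lemma bump_eq0 m j : (j < m)%N -> bump m (d j) = 0.
Proof.
move=> jm; apply/eqP; rewrite eq_le bump_ge0 andbT.
have -> : 0 = `|d j - d (Ordinal jm)| by rewrite subrr normr0.
exact: (bigmin_le_cond _ (fun i : 'I_m => `|d j - d i|)).
Qed.

Lemma bump_neq0 m x : bump m x = 0 -> exists2 j, (j < m)%N & x = d j.
Proof.
move=> h; apply: contrapT => h'; have : 0 < bump m x; last by rewrite h ltxx.
apply/bigmin_gtP; split=> // j _; rewrite normr_gt0 subr_eq0; apply/eqP => E.
by apply: h'; exists j.
Qed.

(* Later bumps vanish at [d m], so that [c m] alone can make the value there rational. *)
Lemma bump_coeffs : exists c : nat -> R, forall m, 0 <= c m /\ c m <= p2 m.+2 /\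
  rational (d m + \sum_(i < m.+1) c i * bump i (d m)).
Proof.
have /choice [nx hnx] : forall cm : (nat -> R) * nat, exists t : R, [/\ 0 <= t, t <= p2 cm.2.+2 &
    bump cm.2 (d cm.2) != 0 -> rational (d cm.2 + \sum_(i < cm.2) cm.1 i * bump i (d cm.2) + t * bump cm.2 (d cm.2))].
  move=> [c m] /=; have p0 : 0 < p2 m.+2 by rewrite invr_gt0 exprn_gt0.
  case: (eqVneq (bump m (d m)) 0) => [E|ne]; first by exists 0; split=> //; exact: ltW.
  have b0 : 0 < bump m (d m) by rewrite lt_neqAle eq_sym ne bump_ge0.
  set s := d m + _.
  have h : s < s + p2 m.+2 * bump m (d m) by rewrite ltrDl mulr_gt0.
  have [q] := rat_in_itvoo h; rewrite in_itv /= => /andP [q1 q2].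
  exists ((ratr q - s) / bump m (d m)); split.
  - by apply: divr_ge0; lra.
  - by rewrite ler_pdivrMr //; lra.
  - by move=> _; exists q; rewrite divfK // addrC subrK.
pose C := fix C m : nat -> R := if m is m'.+1 then fun i => if i == m' then nx (C m', m') else C m' i else fun=> 0.
have CE m i : (i < m)%N -> C m i = nx (C i, i).
  elim: m => // m IH; rewrite ltnS /= => im; case: (eqVneq i m) => [->//|ne].
  by apply: IH; rewrite ltn_neqAle ne.
exists (fun m => nx (C m, m)) => m.
have [/= h1 h2 h3] := hnx (C m, m); split=> //; split=> //.
have E : \sum_(i < m) nx (C i, i : nat) * bump i (d m) = \sum_(i < m) C m i * bump i (d m).
  by apply: eq_bigr => i _; rewrite CE.
elim: m {-2}m (leqnn m) h1 h2 h3 E => [|N IH] m mN h1 h2 h3 E.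
  move: mN h3; rewrite leqn0 => /eqP -> /=; rewrite big_ord1 big_ord0 addr0; apply.
  by rewrite /bump big_ord0 oner_eq0.
case: (eqVneq (bump m (d m)) 0) => [b0|ne]; last by rewrite big_ord_recr /= E addrA; apply: h3.
have [j jm dj] := bump_neq0 b0.
have [/= k1 k2 k3] := hnx (C j, j).
have := IH j _ k1 k2 k3 _; rewrite -dj.
have -> : \sum_(i < m.+1) nx (C i, i : nat) * bump i (d m) = \sum_(i < j.+1) nx (C i, i : nat) * bump i (d m).
  rewrite -!(big_mkord xpredT (fun i => nx (C i, i) * bump i (d m))).
  rewrite (@big_cat_nat _ _ _ j.+1 0 m.+1) //=; last by rewrite ltnS ltnW.
  rewrite [X in _ + X]big1_seq ?addr0 // => i; rewrite mem_index_iota => /andP [_ /andP [ji _]].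
  by rewrite dj bump_eq0 ?mulr0.
apply; first by rewrite -ltnS (leq_trans jm).
by apply: eq_bigr => i _; rewrite CE.
Qed.

Lemma rationalize : exists phi : R -> R,
  [/\ forall x y, `|(phi x - x) - (phi y - y)| <= `|x - y| / 2,
      forall x, `|phi x - x| <= 1 & forall m, rational (phi (d m))].
Proof.
have [c hc] := bump_coeffs.
pose S k x : R := \sum_(i < k) c i * bump i x.
have Sd k m (F : nat -> R) (A : R) : 0 <= A -> (forall i, 0 <= F i /\ F i <= A) ->
    0 <= \sum_(k <= i < k + m) c i * F i /\ \sum_(k <= i < k + m) c i * F i <= A * (p2 k.+1 - p2 (k + m).+1).
  move=> A0 hF; elim: m => [|m [IH1 IH2]]; first by rewrite addn0 big_geq // subrr mulr0.
  rewrite addnS big_nat_recr ?leq_addr //=.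
  have [c0 [c1 _]] := hc (k + m)%N; have [F0 F1] := hF (k + m)%N.
  have cF : 0 <= c (k + m)%N * F (k + m)%N by apply: mulr_ge0.
  split; first by lra.
  have cF' : c (k + m)%N * F (k + m)%N <= p2 (k + m).+2 * A by apply: ler_pM.
  have E : p2 (k + m).+1 = 2 * p2 (k + m).+2 by rewrite (exprS 2 (k + m).+1) invfM; lra.
  rewrite -/(p2 _) in cF' *.
  move: IH2 cF'; rewrite E; move: (p2 (k + m).+2) (p2 k.+1) => u v; lra.
have Scat k m x : S (k + m)%N x - S k x = \sum_(k <= i < k + m) c i * bump i x.
  rewrite /S -!(big_mkord xpredT (fun i => c i * bump i x)).
  by rewrite (@big_cat_nat _ _ _ k 0 (k + m)) ?leq_addr //=; ring.
have /choice [h hh] : forall x, exists l, forall k, `|S k x - l| <= p2 k.+1.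
  move=> x; have [|l hl] := @interval_limit R (fun k => S k x) (fun k => p2 k.+1) 0.
    move=> k m _; rewrite Scat.
    have b01 i : 0 <= bump i x /\ bump i x <= 1 by split; [exact: bump_ge0 | exact: bump_le1].
    have [h1 h2] := Sd k m (fun i => bump i x) 1 ler01 b01.
    rewrite ger0_norm //; apply: le_trans h2 _.
    by rewrite mul1r gerBl ltW // invr_gt0 exprn_gt0.
  by exists l => k; apply: hl.
have p21 : p2 1 = 2^-1 by rewrite expr1.
have hb x : `|h x| <= 2^-1.
  by have := hh x 0%N; rewrite /S big_ord0 sub0r normrN p21.
have Slip k x y : `|S k x - S k y| <= `|x - y| / 2.
  rewrite /S -sumrB; apply: le_trans (ler_norm_sum _ _ _) _.
  apply: le_trans (_ : \sum_(0 <= i < 0 + k) c i * `|bump i x - bump i y| <= _).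
    rewrite add0n big_mkord; apply: ler_sum => i _; rewrite -mulrBr normrM ger0_norm //.
    by case: (hc i).
  have b01 i : 0 <= `|bump i x - bump i y| /\ `|bump i x - bump i y| <= `|x - y|.
    by split; [| exact: bump_lip].
  have [_ h2] := Sd 0%N k (fun i => `|bump i x - bump i y|) _ (normr_ge0 (x - y)) b01.
  apply: le_trans h2 _; apply: ler_wpM2l => //.
  by rewrite p21 gerBl ltW // invr_gt0 exprn_gt0.
exists (fun x => x + h x); split.
- move=> x y; have -> : x + h x - x - (y + h y - y) = h x - h y by ring.
  apply/ler_addgt0Pr => e e0; have e2 : 0 < e / 2 by lra.
  have [k hk] := pow2_small e2.
  have kk : p2 k.+1 <= p2 k by apply: p2_le.
  have -> : h x - h y = (S k x - S k y) - (S k x - h x) + (S k y - h y) by ring.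
  apply: le_trans (ler_normD _ _) _; apply: le_trans (lerD (ler_normB _ _) (lexx _)) _.
  have := Slip k x y; have := hh x k; have := hh y k; lra.
- by move=> x; rewrite addrAC subrr add0r; apply: le_trans (hb x) _; lra.
- move=> m; have [_ [_]] := hc m; rewrite -/(S m.+1 (d m)).
  suff -> : S m.+1 (d m) = h (d m) by [].
  apply/eqP; rewrite -subr_eq0 -normr_le0; apply/ler_addgt0Pr => e e0; rewrite add0r.
  have [k hk] := pow2_small e0.
  have E : S (m.+1 + k)%N (d m) = S m.+1 (d m).
    apply/eqP; rewrite -subr_eq0 Scat big1_seq // => i; rewrite mem_index_iota => /andP [_ /andP [mi _]].
    by rewrite bump_eq0 ?mulr0.
  rewrite -E; apply: le_trans (hh _ _) _; apply: le_trans (ltW hk); apply: p2_le.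
  by rewrite addSn ltnW // ltnS leqW // leq_addl.
Qed.

End Bumps.

Definition squash (r : R) : R := r / (1 + `|r|).
Definition unsquash (t : R) : R := t / (1 - `|t|).

Lemma squash_lt1 r : `|squash r| < 1.
Proof.
have n0 := normr_ge0 r; rewrite /squash normrM normfV (ger0_norm (_ : 0 <= 1 + `|r|)); last lra.
by rewrite ltr_pdivrMr; lra.
Qed.

Lemma squashK r : unsquash (squash r) = r.
Proof.
have n0 := normr_ge0 r; rewrite /unsquash /squash normrM normfV (ger0_norm (_ : 0 <= 1 + `|r|)); last lra.
have ne : 1 + `|r| != 0 by apply: lt0r_neq0; lra.
have -> : 1 - `|r| / (1 + `|r|) = (1 + `|r|)^-1 by field.
by rewrite invrK divfK.
Qed.

Lemma contat_inv (V : normedZmodType R) (f : V -> R) x :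
  contat f x -> f x != 0 -> contat (fun y => (f y)^-1) x.
Proof.
move=> cf fx e e0; have a0 : 0 < `|f x| by rewrite normr_gt0.
have m0 : 0 < Num.min (`|f x| / 2) (e * (`|f x| * `|f x|) / 2).
  by rewrite lt_min; apply/andP; split; [lra | apply: divr_gt0 => //; rewrite !mulr_gt0].
have [d d0 hd] := cf _ m0; exists d => // y /hd; rewrite lt_min => /andP [h1 h2].
have h3 : `|f x| / 2 < `|f y|.
  have : `|f x| <= `|f y| + `|f y - f x|.
    have -> : f x = f y - (f y - f x) by ring.
    by apply: le_trans (ler_normB _ _) _; rewrite subKr.
  lra.
have fy : f y != 0 by rewrite -normr_gt0; lra.
have -> : (f y)^-1 - (f x)^-1 = (f x - f y) / (f x * f y) by field; rewrite fx fy.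
rewrite normrM normfV normrM distrC ltr_pdivrMr; last by apply: mulr_gt0; lra.
apply: lt_trans h2 _.
have -> : e * (`|f x| * `|f x|) / 2 = e * (`|f x| * (`|f x| / 2)) by ring.
by rewrite ltr_pM2l // ltr_pM2l.
Qed.

Lemma squash_cont r : contat squash r.
Proof.
apply: contatM; first exact: contat_id.
apply: contat_inv; last by apply: lt0r_neq0; have := normr_ge0 r; lra.
by apply: contatD; [exact: contat_cst | exact: contat_norm].
Qed.

Lemma unsquash_cont t : `|t| < 1 -> contat unsquash t.
Proof.
move=> t1; apply: contatM; first exact: contat_id.
apply: contat_inv; last by apply: lt0r_neq0; lra.
by apply: contatD; [exact: contat_cst | apply: contatN; exact: contat_norm].
Qed.

Lemma rational_reparametrization (D : R -> Prop) : enumerable D ->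
  exists h k : R -> R, [/\ forall r, contat h r, forall r, `|h r| < 1, forall r, k (h r) = r,
    forall r, contat k (h r) & forall r, D (h r) -> rational r].
Proof.
move=> [d hd]; have [phi [p1 p2 p3]] := rationalize (fun m => unsquash (d m)).
have pl x y : `|x - y| / 2 <= `|phi x - phi y|.
  have := p1 x y; have -> : phi x - x - (phi y - y) = (phi x - phi y) - (x - y) by ring.
  have := ler_normB (phi x - phi y) (phi x - phi y - (x - y)); rewrite subKr; lra.
have pinj : injective phi.
  move=> x y E; have := pl x y; rewrite E subrr normr0 => h.
  by apply/eqP; rewrite -subr_eq0 -normr_le0; lra.
have /choice [psi hpsi] : forall w, exists x, phi x = w.
  move=> w; pose x r := r + (w - 1).
  have [||||r hr] := @half_lip_fixpoint R (fun r => 1 - (phi (x r) - x r)) 2.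
  - by lra.
  - by move=> r; have := p2 (x r); rewrite ler_norml => /andP [? ?]; lra.
  - by move=> r; have := p2 (x r); rewrite ler_norml => /andP [? ?]; lra.
  - move=> r s; have := p1 (x s) (x r).
    have -> : x s - x r = s - r by rewrite /x; ring.
    have -> : 1 - (phi (x r) - x r) - (1 - (phi (x s) - x s)) = phi (x s) - x s - (phi (x r) - x r) by ring.
    by rewrite (distrC s) mulrC.
  exists (x r); move: hr; rewrite {2}/x; lra.
have psiL x y : `|psi x - psi y| <= 2 * `|x - y|.
  by have := pl (psi x) (psi y); rewrite !hpsi; lra.
exists (squash \o psi), (phi \o unsquash); split.
- move=> r; apply: contat_comp; last exact: squash_cont.
  exact: (@contat_lip _ _ _ _ 2).
- by move=> r; exact: squash_lt1.
- by move=> r /=; rewrite squashK.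
- move=> r; apply: contat_comp; first by apply: unsquash_cont; exact: squash_lt1.
  apply: (@contat_lip _ _ _ _ 2) => // y.
  move: (unsquash _) => x; have := p1 y x.
  have -> : phi y - y - (phi x - x) = (phi y - phi x) - (y - x) by ring.
  have := ler_normB (phi y - phi x - (y - x)) (- (y - x)); rewrite normrN opprK subrK.
  have := normr_ge0 (y - x); lra.
- move=> r /hd [m hm]; have := p3 m; rewrite hm /= squashK hpsi; exact.
Qed.

End Rationalize.

Section Embedding.
Variables (R : realType) (n : nat).
Local Notation X := 'rV[R]_n.

Definition two_irrational (x : X) := exists i j, [/\ i != j, ~ rational (x 0 i) & ~ rational (x 0 j)].

Lemma nobeling_embedding (i0 : 'I_n) : exists (F g : X -> X) (h k : R -> R), [/\
  (forall r, contat h r) /\ (forall r, k (h r) = r) /\ (forall r, contat k (h r)),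
  forall y, contat g y,
  forall x, two_irrational x -> g (F x) = (\row_j h (x 0 j)) /\ `|F x| <= 2,
  forall x e, two_irrational x -> 0 < e ->
    exists2 d, 0 < d & forall x', two_irrational x' -> `|x' - x| < d -> `|F x' - F x| < e &
  forall (i : 'I_n) (q : 'I_n -> rat), exists2 eta, 0 < eta &
    forall x, two_irrational x -> ~ tube (i, \row_j ratr (q j)) eta (F x)].
Proof.
pose lam m : 'I_n * X := if (unpickle m : option ('I_n * {ffun 'I_n -> rat})) is Some p
  then (p.1, \row_j ratr (p.2 j)) else (i0, 0).
have [g [f [D [eD cg gf cf tf]]]] := master lam.
have [h [k [ch h1 hk ck hD]]] := rational_reparametrization eD.
pose H (x : X) : X := \row_j h (x 0 j).
have HD x : two_irrational x -> two_free D (H x).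
  move=> [i [j [ij xi xj]]]; split; first by move=> l; rewrite mxE.
  by exists i, j; split=> //; rewrite mxE => /hD.
exists (f \o H), g, h, k; split=> //.
- by move=> x /HD /gf.
- move=> x e hx e0; have [d d0 hd] := cf (H x) e (HD x hx) e0.
  have cH : contat H x.
    apply: contat_row => j; have -> : (fun y => H y 0 j) = h \o (fun y : X => y 0 j).
      by apply/funext => y /=; rewrite mxE.
    apply: contat_comp; first exact: contat_coord.
    exact: ch.
  have [d' d'0 hd'] := cH d d0; exists d' => // x' hx' xx.
  by apply: hd; [exact: HD | exact: hd'].
- move=> i q; have [eta eta0 he] := tf (pickle (i, [ffun j => q j])).
  exists eta => // x hx; have := he (H x) (HD x hx); rewrite /lam pickleK /=.
  by have -> : \row_j ratr ([ffun j => q j] j) = \row_j ratr (q j) :> X by apply/rowP => j; rewrite !mxE ffunE.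
Qed.

End Embedding.

(** * The upper bound for the dimension *)

Section Covers.
Variables (R : realType) (n : nat).
Local Notation X := 'rV[R]_n.

Definition relopenX (K U : X -> Prop) := forall x, K x -> U x ->
  exists2 r, 0 < r & forall y, K y -> `|y - x| < r -> U y.

Definition compactX (K : X -> Prop) := forall (I : Type) (U : I -> X -> Prop),
  (forall i, relopenX K (U i)) -> (forall x, K x -> exists i, U i x) ->
  exists l : list I, forall x, K x -> exists i, List.In i l /\ U i x.

Definition coverX (K : X -> Prop) (Us : list (X -> Prop)) :=
  (forall U, List.In U Us -> relopenX K U) /\ forall x, K x -> exists U, List.In U Us /\ U x.

Definition covdimX_le (K : X -> Prop) (k : nat) := forall Us, coverX K Us ->
  exists Vs, [/\ coverX K Vs,
    forall V, List.In V Vs -> exists U, List.In U Us /\ forall x, K x -> V x -> U x &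
    forall x, K x -> exists l : seq nat, (size l <= k.+1)%N /\
      forall j, (j < size Vs)%N -> nth (fun=> False) Vs j x -> j \in l].

Lemma In_mem (T : eqType) (x : T) l : List.In x l <-> x \in l.
Proof.
elim: l => //= y l IH; rewrite inE; split.
  by case=> [->|/IH ->]; rewrite ?eqxx ?orbT.
by move=> /orP [/eqP ->|/IH]; [left | right].
Qed.

Lemma closed_bounded_compactX (K : X -> Prop) (B : R) : (forall x, K x -> `|x| <= B) ->
  (forall x, ~ K x -> exists2 r, 0 < r & forall y, `|y - x| < r -> ~ K y) -> compactX K.
Proof.
move=> bK cK I U oU cov.
have /choice [d hd] : forall x, exists p : R * option I, 0 < p.1 /\
    (forall y, K y -> `|y - x| < p.1 -> exists2 i, p.2 = Some i & U i y).
  move=> x; have [Kx|nK] := pselect (K x).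
    have [i Ui] := cov x Kx; have [r r0 hr] := oU i x Kx Ui.
    by exists (r, Some i); split=> // y Ky yx; exists i => //; apply: hr.
  have [r r0 hr] := cK x nK; exists (r, None); split=> // y Ky yx.
  by case: (hr y yx).
have [s hs] := @gauge_compact R n (fun x => (d x).1) B (fun x => (hd x).1).
exists (pmap (fun z => (d z).2) s) => x Kx.
have [z zs xz] := hs x (bK x Kx); have [i iz Ui] := (hd z).2 x Kx xz.
exists i; split=> //; elim: s {hs} zs => //= w s IH; rewrite inE => /orP [/eqP <-|/IH h].
  by rewrite iz; left.
by case: (d w).2 => [a|] //=; right.
Qed.

Lemma lebesgue_number (K : X -> Prop) Us : compactX K -> coverX K Us ->
  exists2 r, 0 < r & forall x, K x -> exists U, List.In U Us /\ forall y, K y -> `|y - x| < r -> U y.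
Proof.
move=> cK [oU cov].
pose W (p : X * R) x := [/\ 0 < p.2, `|x - p.1| < p.2 &
  exists U, List.In U Us /\ forall y, K y -> `|y - p.1| < 2 * p.2 -> U y].
have [||l hl] := cK _ W.
- move=> p x Kx [p0 xp h]; exists (p.2 - `|x - p.1|); first by lra.
  move=> y Ky yx; split=> //.
  have -> : y - p.1 = (y - x) + (x - p.1) by rewrite addrA subrK.
  by apply: le_lt_trans (ler_normD _ _) _; lra.
- move=> x Kx; have [U [UU Ux]] := cov x Kx; have [r r0 hr] := oU U UU x Kx Ux.
  exists (x, r / 2); split=> /=; [lra | by rewrite subrr normr0; lra |].
  by exists U; split=> // y Ky yx; apply: hr => //; lra.
pose r : R := \big[Num.min/1]_(p <- l | 0 < p.2) p.2.
exists r; first by rewrite /r; elim/big_rec: _ => [|p a p0 a0]; [exact: ltr01 | rewrite lt_min p0].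
move=> x Kx; have [p [pl [p0 xp [U [UU hU]]]]] := hl x Kx.
exists U; split=> // y Ky yx; apply: hU => //.
have rp : r <= p.2.
  rewrite /r; elim: (l) pl => //= q s IH [E|/IH h]; rewrite big_cons; last by case: ifP => _ //; rewrite ge_min h orbT.
  by rewrite E p0 ge_min lexx.
have -> : y - p.1 = (y - x) + (x - p.1) by rewrite addrA subrK.
by apply: le_lt_trans (ler_normD _ _) _; lra.
Qed.

End Covers.

Section IntDist.
Variable R : realType.
Implicit Types u v : R.

Definition rnd u : int := Num.floor (u + 2^-1).
Definition dz u : R := `|u - (rnd u)%:~R|.

Lemma floorP u : (Num.floor u)%:~R <= u < (Num.floor u + 1)%:~R.
Proof. exact: floor_itv. Qed.

Lemma rnd_bounds u : (rnd u)%:~R - 2^-1 <= u /\ u < (rnd u)%:~R + 2^-1.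
Proof. by have := floorP (u + 2^-1); rewrite -/(rnd u) intrD => /andP [? ?]; split; lra. Qed.

Lemma dz_le u (k : int) : dz u <= `|u - k%:~R|.
Proof.
have [h1 h2] := rnd_bounds u; rewrite /dz.
have c : dz u <= 2^-1 by rewrite /dz ler_norml; apply/andP; split; lra.
case: (ltrgtP k (rnd u)) => [lt|gt|-> //].
- have : (k + 1)%:~R <= (rnd u)%:~R :> R by rewrite ler_int lezD1.
  rewrite intrD => h3; rewrite [leRHS]ger0_norm; last lra.
  by rewrite ler_norml; apply/andP; split; lra.
- have : (rnd u + 1)%:~R <= k%:~R :> R by rewrite ler_int lezD1.
  rewrite intrD => h3; rewrite [leRHS]ler0_norm; last lra.
  by rewrite ler_norml; apply/andP; split; lra.
Qed.

Lemma dz_half u : dz u <= 2^-1.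
Proof. by have [h1 h2] := rnd_bounds u; rewrite /dz ler_norml; apply/andP; split; lra. Qed.

Lemma dz_ge0 u : 0 <= dz u. Proof. exact: normr_ge0. Qed.

Lemma dz_lip u v : dz u <= dz v + `|u - v|.
Proof.
apply: le_trans (dz_le u (rnd v)) _.
have -> : u - (rnd v)%:~R = (v - (rnd v)%:~R) + (u - v) by ring.
exact: ler_normD.
Qed.

Lemma rnd_near u v : `|v - u| < 2^-1 - dz u -> rnd v = rnd u.
Proof.
rewrite ltr_norml => /andP [h1 h2].
have : dz u <= dz u by []; rewrite {1}/dz ler_norml => /andP [h3 h4].
by apply/floor_def/andP; rewrite intrD; split; lra.
Qed.

Lemma floor_near u v : `|v - u| < dz u -> Num.floor v = Num.floor u.
Proof.
move=> h; have /andP [f1 f2] := floorP u.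
have h1 := dz_le u (Num.floor u); have h2 := dz_le u (Num.floor u + 1).
rewrite ger0_norm in h1; last by lra.
rewrite ler0_norm in h2; last by lra.
rewrite intrD in f2 h2.
move: h; rewrite ltr_norml => /andP [? ?].
by apply/floor_def/andP; rewrite intrD; split; lra.
Qed.

End IntDist.

Section UpperBound.
Variables (R : realType) (n : nat).
Local Notation X := 'rV[R]_n.
Variable (N : nat).
Hypothesis N0 : (0 < N)%N.
Local Notation u x j := (x 0 j * N%:R).
Implicit Types (x y : X) (J : {set 'I_n} * {ffun 'I_n -> int}).

(* At most one piece for each cardinal of [J.1] contains a given point, hence at most [n - 1] pieces. *)
Definition piece (J : {set 'I_n} * {ffun 'I_n -> int}) (x : X) := [/\ (#|J.1| < n.-1)%N,
  forall i j, i \in J.1 -> j \notin J.1 -> dz (u x i) < dz (u x j),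
  forall j, j \notin J.1 -> 0 < dz (u x j) &
  forall j, J.2 j = if j \in J.1 then rnd (u x j) else Num.floor (u x j)].

Lemma piece_inj J J' x : piece J x -> piece J' x -> #|J.1| = #|J'.1| -> J = J'.
Proof.
case: J J' => S c [S' c'] [/= _ h1 _ h2] [/= _ h1' _ h2'] E.
have SS : S = S'.
  apply/eqP; rewrite eqEcard E leqnn andbT; apply/fintype.subsetP => i iS; apply/negPn/negP => iS'.
  have /subsetPn [j jS' jS] : ~~ (S' \subset S).
    apply/negP => sub; have : S' == S by rewrite eqEcard sub E leqnn.
    by move=> /eqP E'; rewrite E' iS in iS'.
  by have := lt_trans (h1 i j iS jS) (h1' j i jS' iS'); rewrite ltxx.
by subst S'; congr pair; apply/ffunP => j; rewrite h2 h2'.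
Qed.

Lemma piece_diam J x y : piece J x -> piece J y -> `|x - y| <= N%:R^-1.
Proof.
move=> [_ _ _ h] [_ _ _ h']; have Np : 0 < N%:R :> R by rewrite ltr0n.
apply/norm_rV_le; first by rewrite invr_ge0 ltW.
move=> j; rewrite !mxE -(ler_pM2r Np) mulVf ?lt0r_neq0 //.
rewrite -{1}(gtr0_norm Np) -normrM mulrBl.
have := h' j; rewrite (h j); case: (j \in J.1) => E.
  have [a1 a2] := rnd_bounds (u x j); have [b1 b2] := rnd_bounds (u y j); rewrite -E in b1 b2.
  by rewrite ler_norml; apply/andP; split; lra.
have /andP [a1 a2] := floorP (u x j); have /andP [b1 b2] := floorP (u y j); rewrite -E intrD in b1 b2 a2.
by rewrite ler_norml; apply/andP; split; lra.
Qed.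

Lemma piece_open J x : piece J x -> exists2 r, 0 < r & forall y, `|y - x| < r -> piece J y.
Proof.
case: J => S c [/= h0 h1 h2 h3]; have Np : 0 < N%:R :> R by rewrite ltr0n.
have [j0 j0S] : exists j0, j0 \notin S.
  apply: contrapT => h; have : S = finset.setT.
    by apply/finset.setP => j; rewrite inE; apply/negPn/negP => jS; apply: h; exists j.
  by move=> E; move: h0; rewrite E finset.cardsT card_ord ltnNge leq_pred.
pose a : R := \big[Num.min/1]_(j | j \notin S) dz (u x j).
have a0 : 0 < a by apply/bigmin_gtP.
pose b : R := \big[Num.max/0]_(j | j \in S) dz (u x j).
have ba : b < a.
  apply/bigmax_ltP; split=> // i iS; apply/bigmin_gtP; split; last by move=> j jS; apply: h1.
  by apply: le_lt_trans (dz_half _) _; lra.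
have ah : a <= 2^-1.
  by apply: le_trans (dz_half (u x j0)); apply: (bigmin_le_cond _ (fun j => dz (u x j))).
have aj j : j \notin S -> a <= dz (u x j).
  by move=> jS; apply: (bigmin_le_cond _ (fun j => dz (u x j))).
have bi i : i \in S -> dz (u x i) <= b.
  by move=> iS; apply: (le_bigmax_cond _ (fun j => dz (u x j))).
have b0 : 0 <= b by exact: bigmax_ge_id.
exists ((a - b) / 2 / N%:R); first by rewrite !divr_gt0 // subr_gt0.
move=> y yx.
have near j : `|u y j - u x j| < (a - b) / 2.
  rewrite -mulrBl normrM (gtr0_norm Np) -ltr_pdivlMr //.
  by apply: le_lt_trans yx; have := coord_le_norm (y - x) j; rewrite !mxE.
have nb i : i \in S -> dz (u y i) < (a + b) / 2.
  by move=> iS; have := dz_lip (u y i) (u x i); have := bi i iS; have := near i; lra.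
have na j : j \notin S -> (a + b) / 2 < dz (u y j).
  move=> jS; have := dz_lip (u x j) (u y j); have := aj j jS; have := near j; rewrite distrC; lra.
split=> //=.
- by move=> i j iS jS; apply: lt_trans (nb i iS) (na j jS).
- by move=> j jS; have := na j jS; lra.
- move=> j; rewrite h3; have nj := near j; case: ifPn => jS.
    by rewrite (@rnd_near _ (u x j) (u y j)) //; have := bi j jS; lra.
  by rewrite (@floor_near _ (u x j) (u y j)) //; have := aj j jS; lra.
Qed.

Lemma piece_cover x : (2 <= n)%N -> (forall (i : 'I_n) (q : 'I_n -> rat), ~ (forall j, j != i -> x 0 j = ratr (q j))) ->
  exists J, piece J x.
Proof.
move=> n2 hx; have Np : 0 < N%:R :> R by rewrite ltr0n.
pose S := [set j : 'I_n | dz (u x j) == 0]%SET.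
exists (S, [ffun j => if j \in S then rnd (u x j) else Num.floor (u x j)]); split=> /=.
- rewrite ltnNge; apply/negP => cS.
  have [i hi] : exists i, forall j, j != i -> j \in S.
    have i0 : 'I_n by apply: (@Ordinal _ 0); apply: leq_trans n2.
    have cC : (#|~: S| <= 1)%N.
      by have := cardsC S; rewrite card_ord; move: cS n2; move: #|S| #|~: S| => a b; lia.
    case: (finset.set_0Vmem (~: S)) => [E|[i iS]].
      by exists i0 => j _; apply/negPn/negP => jS; have := finset.in_set0 j; rewrite -E inE jS.
    exists i => j ji; apply/negPn/negP => jS.
    have sub : [set i; j]%SET \subset ~: S.
      by apply/fintype.subsetP => k; rewrite !inE => /orP [/eqP ->|/eqP ->]; [move: iS; rewrite !inE | move: jS; rewrite inE].
    have := leq_trans (subset_leq_card sub) cC; by rewrite cards2 eq_sym ji.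
  apply: (hx i (fun j => (rnd (u x j))%:Q / N%:Q)) => j /hi.
  rewrite inE normr_eq0 subr_eq0 => /eqP E.
  rewrite fmorph_div /= ratr_int ratr_int -E mulfK //; exact: lt0r_neq0.
- move=> i j; rewrite !inE => /eqP -> jS; rewrite lt_neqAle eq_sym jS; exact: dz_ge0.
- by move=> j; rewrite inE => jS; rewrite lt_neqAle eq_sym jS; exact: dz_ge0.
- by move=> j; rewrite ffunE.
Qed.

End UpperBound.

Lemma covdimX_upper (R : realType) (n : nat) (K : 'rV[R]_n -> Prop) : (2 <= n)%N -> compactX K ->
  (forall x, K x -> forall (i : 'I_n) (q : 'I_n -> rat), ~ (forall j, j != i -> x 0 j = ratr (q j))) ->
  covdimX_le K n.-2.
Proof.
move=> n2 cK hK Us cU; have [r r0 hr] := lebesgue_number cK cU.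
have r1 : 0 <= r^-1 by rewrite invr_ge0 ltW.
pose N := (Num.truncn r^-1).+1; have /andP [_ Nr] := truncn_itv r1; rewrite -/N in Nr.
have N0 : (0 < N)%N by [].
have hN : N%:R^-1 < r by rewrite invf_plt ?posrE // ltr0n.
have [||l hl] := cK _ (piece N).
- by move=> J x _ /(piece_open N0) [d d0 hd]; exists d => // y _; apply: hd.
- by move=> x Kx; apply: piece_cover => //; exact: hK.
pose L := [seq J <- undup l | `[< exists x, K x /\ piece N J x >]].
have uL : uniq L by rewrite filter_uniq // undup_uniq.
exists [seq piece N J | J <- L]; split.
- split.
    move=> V /List.in_map_iff [J [<- _]] x _ /(piece_open N0) [d d0 hd]; exists d => // y _; exact: hd.
  move=> x Kx; have [J [Jl Jx]] := hl x Kx; exists (piece N J); split=> //.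
  apply/List.in_map_iff; exists J; split=> //; apply/In_mem.
  by rewrite mem_filter mem_undup; apply/andP; split; [apply/asboolP; exists x | apply/In_mem].
- move=> V /List.in_map_iff [J [<- /In_mem]]; rewrite mem_filter => /andP [/asboolP [x [Kx Jx]] _].
  have [U [UU hU]] := hr x Kx; exists U; split=> // y Ky Jy; apply: hU => //.
  by apply: le_lt_trans hN; apply: piece_diam Jy Jx.
- move=> x Kx.
  pose pos s := find (fun J => `[< piece N J x >] && (#|J.1| == s)) L.
  exists [seq pos s | s <- iota 0 n.-1]; split.
    by rewrite size_map size_iota; case: (n) n2 => // -[].
  move=> j; rewrite size_map => jL.
  pose J0 : {set 'I_n} * {ffun 'I_n -> int} := (finset.set0, [ffun=> 0]).
  rewrite (nth_map J0) // => Jx.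
  apply/mapP; exists #|(nth J0 L j).1|; first by rewrite mem_iota add0n; case: Jx.
  have hs : has (fun J => `[< piece N J x >] && (#|J.1| == #|(nth J0 L j).1|)) L.
    by apply/hasP; exists (nth J0 L j); [exact: mem_nth | apply/andP; split; [apply/asboolP | ]].
  have := nth_find J0 hs => /andP [/asboolP h1 /eqP h2].
  apply/eqP; rewrite -(nth_uniq J0 jL _ uL); last by rewrite -has_find.
  by apply/eqP/esym/(piece_inj h1 Jx).
Qed.

(** * Kuhn simplices and the lower bound for the dimension *)

Lemma sum_involution0 (T : finType) (P : pred T) (f : T -> 'F_2) (phi : T -> T) (c : pred T) :
  involutive phi -> (forall x, P (phi x) = P x) -> (forall x, P x -> f (phi x) = f x) ->
  (forall x, c (phi x) = ~~ c x) -> \sum_(x | P x) f x = 0.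
Proof.
move=> ph Pp fp cp; rewrite (bigID c) /=.
rewrite (reindex_inj (can_inj ph)) /= (eq_bigl (fun x => P x && ~~ c x)); last by move=> x; rewrite Pp cp.
rewrite (eq_bigr f) => [|x /andP [/fp //]].
by move: (\sum_(_ | _) _) => -[[|[|]]] // i; apply/val_inj.
Qed.

Lemma det_col0 (F : comNzRingType) d (A : 'M[F]_d) j : (forall i, A i j = 0) -> \det A = 0.
Proof. by move=> h; rewrite (expand_det_col _ j) big1 // => i _; rewrite h mul0r. Qed.

Section Kuhn.
Variables (m N0 : nat) (lab : (nat -> nat) -> nat).
Local Notation N := N0.+1.
Hypothesis labA : forall v i, v i = 0%N -> (lab v <= i)%N.
Hypothesis labB : forall v i, (i < m)%N -> v i = N -> lab v <> i.

Local Notation T := ({ffun 'I_m -> 'I_N} * {perm 'I_m})%type.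
Implicit Type x : T.

(* The Kuhn simplex [(p, s)] has vertices [p + sum of e_i over s i < k]: [s i] is the time at which coordinate [i] is raised. *)
Definition vtx x (k : nat) : nat -> nat :=
  fun i => if (insub i : option 'I_m) is Some i' then (x.1 i' + (x.2 i' < k))%N else 0%N.

Definition onface d x := [forall i : 'I_m, (d <= i)%N ==> (x.1 i == 0 :> nat) && (x.2 i == i)].

Definition labmx d x : 'M['F_2]_d.+1 := \matrix_(a, c) (lab (vtx x a) == c)%:R.
Definition facetmx d (k : 'I_d.+1) x : 'M['F_2]_d := \matrix_(a, c) (lab (vtx x (lift k a)) == c)%:R.

Lemma vtxE x k (i : 'I_m) : vtx x k i = (x.1 i + (x.2 i < k))%N.
Proof. by rewrite /vtx valK. Qed.

Lemma onfaceP d x : reflect (forall i : 'I_m, (d <= i)%N -> x.1 i = 0 :> nat /\ x.2 i = i) (onface d x).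
Proof.
apply: (iffP forallP) => h i.
  by move=> di; move: (h i); rewrite di /= => /andP [/eqP ? /eqP ?].
by apply/implyP => /h [-> ->]; rewrite !eqxx.
Qed.

Lemma lab_onface d x k : onface d x -> (k <= d)%N -> (lab (vtx x k) <= d)%N.
Proof.
move=> /onfaceP h kd; apply: labA; case: (ltnP d m) => dm; last by rewrite /vtx insubN // -leqNgt.
rewrite (vtxE x k (Ordinal dm)); have [-> ->] := h (Ordinal dm) (leqnn d).
by rewrite /= add0n ltnNge kd.
Qed.

Lemma signF2 k : (-1) ^+ k = 1 :> 'F_2.
Proof. by rewrite (_ : -1 = 1) ?expr1n //; apply/val_inj. Qed.

(* The rows of [labmx] sum to one, so its last column may be replaced by ones. *)
Lemma det_labmx d x : onface d x -> \det (labmx d x) = \sum_(k < d.+1) \det (facetmx k x).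
Proof.
move=> fx; pose U : 'M['F_2]_d.+1 := \matrix_(c, c') ((c' == ord_max) || (c == c'))%:R.
have dU : \det U = 1.
  rewrite -det_tr det_trig.
    by rewrite big1 // => c _; rewrite !mxE eqxx orbT.
  apply/is_trig_mxP => i j ij; rewrite !mxE.
  have -> : (j == i) = false by apply/negbTE; rewrite eq_sym -val_eqE; rewrite ltn_eqF.
  by have -> : (i == ord_max) = false by apply/negbTE; rewrite -val_eqE /= ltn_eqF // (leq_trans ij) // -ltnS.
have -> : \det (labmx d x) = \det (labmx d x *m U) by rewrite det_mulmx dU mulr1.
have E a c : (labmx d x *m U) a c = if c == ord_max then 1 else (lab (vtx x a) == c)%:R.
  rewrite mxE; case: eqVneq => [->|ne].
    have lb : (lab (vtx x a) < d.+1)%N by rewrite ltnS; apply: lab_onface => //; rewrite -ltnS.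
    rewrite (bigD1 (Ordinal lb)) //= !mxE !eqxx /= mulr1 big1 ?addr0 // => c' ne; rewrite !mxE eqxx /= mulr1.
    by have -> : (lab (vtx x a) == c') = false by apply/negbTE; rewrite eq_sym.
  rewrite (bigD1 c) //= !mxE (negbTE ne) eqxx /= mulr1 big1 ?addr0 // => c' ne'.
  by rewrite !mxE (negbTE ne) (negbTE ne') mulr0.
rewrite (expand_det_col _ ord_max); apply: eq_bigr => k _.
rewrite E eqxx mul1r /cofactor signF2 mul1r; congr (\det _).
apply/matrixP => a c; rewrite [LHS]mxE [LHS]mxE E [RHS]mxE.
have -> : (lift ord_max c == ord_max) = false by rewrite eq_sym (negbTE (neq_lift _ _)).
by rewrite lift_max.
Qed.

Definition total d : 'F_2 := \sum_(x | onface d x) \det (labmx d x).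

Lemma total0 : total 0 = 1.
Proof.
pose x0 : T := ([ffun=> ord0], 1%g).
have f0 : onface 0 x0 by apply/onfaceP => i _; rewrite ffunE perm1.
rewrite /total (big_pred1 x0).
  rewrite det_mx11 mxE; have -> : lab (vtx x0 (@ord0 0)) = 0%N; last by [].
  by apply/eqP; rewrite -leqn0; apply: lab_onface f0 _.
move=> x /=; apply/idP/eqP => [/onfaceP h|-> //].
case: x h => p s h; congr pair; [apply/ffunP => i | apply/permP => i]; have [/= h1 h2] := h i (leq0n i).
  by apply/val_inj; rewrite ffunE.
by rewrite h2 perm1.
Qed.

Section Step.
Variable d : nat.
Hypothesis dm : (d < m)%N.

Lemma onface_lt x (i : 'I_m) : onface d.+1 x -> (x.2 i < d.+1)%N -> (i < d.+1)%N.
Proof.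
move=> /onfaceP h; case: (ltnP i d.+1) => // di.
by rewrite (h i di).2 ltnNge di.
Qed.

Lemma interior_facets (k : 'I_d.+2) : k != ord0 -> k != ord_max ->
  \sum_(x | onface d.+1 x) \det (facetmx k x) = 0.
Proof.
rewrite -!val_eqE /= -lt0n => k0 kd.
have kd1 : (k < d.+1)%N by rewrite ltn_neqAle kd -ltnS ltn_ord.
have km : (k < m)%N by apply: leq_ltn_trans dm; rewrite -ltnS.
have km1 : (k.-1 < m)%N by apply: leq_ltn_trans km; exact: leq_pred.
pose t := tperm (Ordinal km1) (Ordinal km).
have tt : (t != 1)%g by apply/eqP => /permP /(_ (Ordinal km)); rewrite tpermR perm1 => /(congr1 val) /=; lia.
pose phi x : T := (x.1, (x.2 * t)%g).
have phiK : involutive phi by case=> p s; rewrite /phi /= -mulgA tperm2 mulg1.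
have tfix (i : 'I_m) : (d.+1 <= i)%N -> t i = i.
  by move=> di; rewrite tpermD // -val_eqE /=; apply/eqP; lia.
have fphi x : onface d.+1 x -> onface d.+1 (phi x).
  by move=> /onfaceP h; apply/onfaceP => i di; have [h1 h2] := h i di; rewrite /= permM h2 tfix.
apply: (@sum_involution0 _ _ _ phi (fun x => odd_perm x.2)) => //.
- by move=> x; apply/idP/idP => [/fphi|/fphi //]; rewrite phiK.
- move=> x _; congr (\det _); apply/matrixP => a c; rewrite !mxE; congr (lab _ == _)%:R.
  apply/funext => i; rewrite /vtx; case: insubP => // i' _ _; rewrite /= permM; congr (_ + _)%N.
  have := neq_lift k a; rewrite -val_eqE; move: (nat_of_ord (lift k a)) => b kb; congr nat_of_bool.
  case: tpermP => [->|->|//] /=; apply/idP/idP; move: kb => /=; lia.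
- by move=> x; rewrite /= odd_permM odd_tperm -val_eqE /= (_ : (k.-1 != k)) ?addbT //; apply/eqP; lia.
Qed.

Let r0 : 'I_m := Ordinal (leq_ltn_trans (leq0n d) dm).
Let r1 : 'I_m := Ordinal dm.

Definition cycf (i : 'I_m) : 'I_m := if i == r0 then r1 else if (insub i.-1 : option 'I_m) is Some j then if (i <= d)%N then j else i else i.
Definition cycg (i : 'I_m) : 'I_m := if i == r1 then r0 else if (insub i.+1 : option 'I_m) is Some j then if (i <= d)%N then j else i else i.

Lemma cycf_val i : cycf i = (if i == 0 :> nat then d else if (i <= d)%N then i.-1 else i) :> nat.
Proof.
rewrite /cycf -val_eqE /=; case: eqP => // _.
have pm : (i.-1 < m)%N by apply: leq_ltn_trans (ltn_ord i); exact: leq_pred.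
by rewrite (insubT (fun k => k < m)%N pm) /=; case: ifP.
Qed.

Lemma cycg_val i : cycg i = (if i == d :> nat then 0%N else if (i <= d)%N then i.+1 else i) :> nat.
Proof.
rewrite /cycg -val_eqE /=; case: eqP => // ne; case: (leqP i d) => id.
  have pm : (i.+1 < m)%N by apply: leq_trans dm; rewrite ltnS ltn_neqAle id andbT; apply/eqP.
  by rewrite (insubT (fun k => k < m)%N pm) /=.
by case: insub.
Qed.

Lemma cycfK : cancel cycf cycg.
Proof. by move=> i; apply/val_inj; rewrite /= cycg_val cycf_val; case: (eqVneq (i : nat) 0%N) => [->|ne] /=; rewrite ?eqxx //; case: (leqP i d) => /= id; do ![case: ifP => ?]; lia. Qed.

Definition cyc : {perm 'I_m} := perm (can_inj cycfK).

Lemma cycE i : cyc i = cycf i. Proof. by rewrite permE. Qed.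
Lemma cycVE i : (cyc^-1)%g i = cycg i.
Proof. by apply: (@perm_inj _ cyc); rewrite permKV cycE; apply/val_inj; rewrite /= cycf_val cycg_val; case: (eqVneq (i : nat) d) => [->|ne] /=; rewrite ?eqxx //; case: (leqP i d) => /= id; do ![case: ifP => ?]; lia. Qed.

(* The facet of [x] opposite its first vertex is the facet of [lift_first x] opposite its last one. *)
Definition lift_first x : T := ([ffun i => if x.2 i == r0 then inord (x.1 i).+1 else x.1 i], (x.2 * cyc)%g).
Definition drop_last x : T := ([ffun i => if x.2 i == r1 then inord (x.1 i).-1 else x.1 i], (x.2 * cyc^-1)%g).
Definition inner0 x := [forall i, (x.2 i == r0) ==> (x.1 i < N0)%N].
Definition inner1 x := [forall i, (x.2 i == r1) ==> (0 < x.1 i)%N].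

Lemma cycf_big (i : 'I_m) : (d < i)%N -> cycf i = i.
Proof. by move=> di; apply/val_inj; rewrite /= cycf_val; case: eqP => [|_]; first lia; rewrite leqNgt di. Qed.

Lemma onface_lift_first x : onface d.+1 (lift_first x) = onface d.+1 x.
Proof.
apply/onfaceP/onfaceP => h i di; have := h i di; rewrite /= permM cycE ffunE.
  move=> [h1 h2]; have E : x.2 i = i by apply: (can_inj cycfK); rewrite h2 cycf_big.
  by move: h1; rewrite E -val_eqE /= (_ : i == 0 :> nat = false) //; apply/negbTE/eqP; lia.
move=> [h1 h2]; rewrite h2 cycf_big //; split=> //.
by rewrite -val_eqE /= (_ : i == 0 :> nat = false) //; apply/negbTE/eqP; lia.
Qed.

Lemma drop_lastK x : inner1 x -> lift_first (drop_last x) = x.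
Proof.
case: x => p s /forallP h; rewrite /lift_first /drop_last /=; congr pair; last by rewrite -mulgA mulVg mulg1.
apply/ffunP => i; rewrite !ffunE permM cycVE; have := h i => /=.
have -> : (cycg (s i) == r0) = (s i == r1).
  by rewrite -!val_eqE /= cycg_val; do ![case: ifP => ?]; lia.
case: eqP => // _ /= p0; apply/val_inj; rewrite /= inordK inordK ?prednK //; apply: leq_trans (ltn_ord (p i)); lia.
Qed.

Lemma lift_firstK x : inner0 x -> drop_last (lift_first x) = x.
Proof.
case: x => p s /forallP h; rewrite /lift_first /drop_last /=; congr pair; last by rewrite -mulgA mulgV mulg1.
apply/ffunP => i; rewrite !ffunE permM cycE; have := h i => /=.
have -> : (cycf (s i) == r1) = (s i == r0).
  by rewrite -!val_eqE /= cycf_val; do ![case: ifP => ?]; lia.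
case: eqP => // _ /= p0; apply/val_inj; rewrite /= !inordK //; lia.
Qed.

Lemma inner_lift_first x : inner1 (lift_first x) && (drop_last (lift_first x) == x) = inner0 x.
Proof.
have E i : ((lift_first x).2 i == r1) = (x.2 i == r0).
  by rewrite /= permM cycE -!val_eqE /= cycf_val; do ![case: ifP => ?]; lia.
apply/idP/idP => [/andP [/forallP h _]|h]; last first.
  rewrite lift_firstK // eqxx andbT; apply/forallP => i; rewrite E; apply/implyP => si.
  have := implyP (forallP h i) si => pi; rewrite /= ffunE si inordK //; lia.
apply/forallP => i; apply/implyP => si; have := h i; rewrite E si /= ffunE si.
case: (ltnP (x.1 i) N0) => // pi; by rewrite /inord /insubd insubN //= -leqNgt; lia.
Qed.

Lemma facet_lift_first x : inner0 x -> facetmx (@ord_max d.+1) (lift_first x) = facetmx ord0 x.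
Proof.
move=> /forallP h; apply/matrixP => a c; rewrite !mxE; congr (lab _ == _)%:R.
apply/funext => i; rewrite lift_max /vtx; case: insubP => // i' _ _; rewrite /= permM cycE ffunE cycf_val.
have := h i'; rewrite -val_eqE /= /fintype.bump /=; case: eqP => [->|ne] /= hi.
  have -> : (d < a)%N = false by have := ltn_ord a; lia.
  by rewrite inordK ?addn0 ?addn1 //; lia.
congr (_ + nat_of_bool _)%N; move: (nat_of_ord (x.2 i')) ne => b ne.
by move: (nat_of_ord a) (ltn_ord a) => e ed; case: (leqP b d) => bd; apply/idP/idP; lia.
Qed.

Lemma boundary0 x : onface d.+1 x -> ~~ inner0 x -> \det (facetmx (@ord0 d.+1) x) = 0.
Proof.
move=> fx; rewrite negb_forall => /existsP [i]; rewrite negb_imply -leqNgt => /andP [/eqP si pi].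
have id : (i < d.+1)%N by apply: onface_lt fx _; rewrite si.
apply: (@det_col0 _ _ _ (Ordinal id)) => a; rewrite mxE /=.
have := @labB (vtx x (lift ord0 a)) i (ltn_ord i); rewrite vtxE si /= /fintype.bump /=.
have -> : (x.1 i + 1 = N)%N by have := ltn_ord (x.1 i); lia.
by move=> /(_ erefl) /eqP /negbTE ->.
Qed.

Lemma boundary1 x : onface d.+1 x -> ~~ inner1 x ->
  \det (facetmx (@ord_max d.+1) x) = if onface d x then \det (labmx d x) else 0.
Proof.
move=> fx; rewrite negb_forall => /existsP [i]; rewrite negb_imply -leqNgt leqn0 => /andP [/eqP si /eqP pi].
have id : (i < d.+1)%N by apply: onface_lt fx _; rewrite si.
have L a : (a <= d)%N -> (lab (vtx x a) <= i)%N.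
  by move=> ad; apply: labA; rewrite vtxE pi si /= add0n ltnNge ad.
case: ifPn => [fd|nf].
  by congr (\det _); apply/matrixP => a c; rewrite !mxE lift_max.
apply: (@det_col0 _ _ _ ord_max) => a; rewrite mxE lift_max.
have ne : (i : nat) != d.
  apply: contra nf => /eqP Ei; apply/onfaceP => j; rewrite leq_eqVlt => /orP [/eqP dj|dj].
    have -> : j = i by apply/val_inj; rewrite /= Ei.
    by split=> //; rewrite si; apply/val_inj; rewrite /= Ei.
  by apply: (onfaceP _ _ fx).
have := L a; rewrite -ltnS ltn_ord => /(_ isT) h.
by rewrite (_ : (_ == _) = false) //; apply/negbTE/eqP => /=; lia.
Qed.

Lemma total_step : total d.+1 = total d.
Proof.
rewrite /total (eq_bigr _ (fun x fx => det_labmx fx)) exchange_big /=.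
rewrite (bigD1 ord0) //= (bigD1 ord_max) //= [X in _ + (_ + X)]big1 ?addr0; last first.
  by move=> k /andP [k0 k1]; apply: interior_facets.
rewrite (bigID inner0) /= [X in _ + X + _]big1 ?addr0; last by move=> x /andP [fx nx]; apply: boundary0.
rewrite [X in _ + X](bigID inner1) /= addrA.
have -> : \sum_(x | onface d.+1 x && inner1 x) \det (facetmx (@ord_max d.+1) x) =
          \sum_(x | onface d.+1 x && inner0 x) \det (facetmx (@ord0 d.+1) x).
  rewrite (reindex_onto lift_first drop_last) /=; last by move=> x /andP [_ hx]; exact: drop_lastK.
  rewrite (eq_bigl (fun x => onface d.+1 x && inner0 x)); last first.
    by move=> x; rewrite onface_lift_first -andbA inner_lift_first.
  by apply: eq_bigr => x /andP [_ h]; rewrite facet_lift_first.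
rewrite [X in X + _](_ : _ = 0) ?add0r; last first.
  by move: (\sum_(_ | _) _) => -[[|[|]]] // i; apply/val_inj.
rewrite (eq_bigr (fun x => if onface d x then \det (labmx d x) else 0)); last first.
  by move=> x /andP [fx nx]; apply: boundary1.
rewrite -big_mkcondr; apply: eq_bigl => x; apply/idP/idP => [/andP [] //|fd].
have fx : onface d.+1 x by apply/onfaceP => i /ltnW; apply: (onfaceP _ _ fd).
rewrite fx fd andbT /=; apply/negP => /forallP /(_ r1).
by have [-> ->] := onfaceP _ _ fd r1 (leqnn d); rewrite eqxx.
Qed.

End Step.

Lemma kuhn : exists x, forall c, (c <= m)%N -> exists2 k, (k <= m)%N & lab (vtx x k) = c.
Proof.
have T1 d : (d <= m)%N -> total d = 1.
  by elim: d => [|d IH] dm; [exact: total0 | rewrite total_step // IH // ltnW].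
have [x dx] : exists x, \det (labmx m x) != 0.
  apply: contrapT => h; have : (1 : 'F_2) != 0 by [].
  rewrite -(T1 m (leqnn m)) /total big1 ?eqxx // => x _; apply/eqP/negPn/negP => dx.
  by apply: h; exists x.
exists x => c cm; apply: contrapT => h; move: dx.
rewrite (@det_col0 _ _ _ (Ordinal (cm : (c < m.+1)%N))) ?eqxx // => a; rewrite mxE /=.
by case: eqP => // E; case: h; exists a => //; rewrite -ltnS.
Qed.

End Kuhn.

Lemma seq_gauge (R : realType) (T : eqType) (f : T -> R) (s : seq T) : (forall z, 0 < f z) ->
  exists2 r : R, 0 < r & forall z, z \in s -> r <= f z.
Proof.
move=> f0; elim: s => [|a s [r r0 h]]; first by exists 1.
exists (Num.min r (f a)); first by rewrite lt_min r0 f0.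
by move=> z; rewrite inE ge_min => /orP [/eqP ->|/h ->]; rewrite ?lexx ?orbT.
Qed.

Lemma In_nth_ex (T : Type) (x0 x : T) (l : seq T) : List.In x l -> exists2 j, (j < size l)%N & nth x0 l j = x.
Proof.
elim: l => //= a l IH [->|/IH [j jl jx]]; first by exists 0%N.
by exists j.+1.
Qed.

Lemma nth_In (T : Type) (x0 : T) (l : seq T) j : (j < size l)%N -> List.In (nth x0 l j) l.
Proof. by elim: l j => //= a l IH [|j] h; [left | right; apply: IH]. Qed.

Lemma irrational_ex (R : realType) : exists r : R, ~ rational r.
Proof.
exists (Num.sqrt 2) => -[q hq].
have q2 : q ^+ 2 = 2%:R.
  apply: (fmorph_inj (ratr : {rmorphism rat -> R})).
  by rewrite /= rmorphXn /= -hq sqr_sqrtr // rmorph_nat.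
have d0 : (denq q)%:~R != 0 :> rat by rewrite intr_eq0 denq_neq0.
have E : (numq q) ^+ 2 = 2 * (denq q) ^+ 2.
  apply/eqP; rewrite -(eqr_int rat) rmorphXn rmorphM rmorphXn /=.
  have -> : (2 : int)%:~R = q ^+ 2 :> rat by rewrite q2.
  rewrite -exprMn.
  by rewrite -{2}[q]divq_num_den divfK.
have {E} E : (`|numq q| ^ 2 = 2 * `|denq q| ^ 2)%N by rewrite -!abszX E abszM.
have c : coprime (`|denq q| ^ 2) (`|numq q| ^ 2) by rewrite coprimeXl // coprimeXr // coprime_sym coprime_num_den.
have d1 : (`|denq q| ^ 2 = 1)%N.
  by move: c; rewrite /coprime E gcdnMl => /eqP.
move: E; rewrite d1 muln1; move: (`|numq q|)%N => a.
by case: a => [|[|a]] //; rewrite expnS expn1; nia.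
Qed.

Section LowerBound.
Variables (R : realType) (m : nat).
Local Notation n := m.+3.
Local Notation X := 'rV[R]_n.
Variables (K : X -> Prop) (F g : X -> X) (h : R -> R) (r0 : R).
Hypothesis cK : compactX K.
Hypothesis cg : forall y, contat g y.
Hypothesis r0_irr : ~ rational r0.
Hypothesis FK : forall x, two_irrational x -> K (F x).
Hypothesis gF : forall x, two_irrational x -> g (F x) = \row_j h (x 0 j).
Hypothesis cF : forall x e, two_irrational x -> 0 < e ->
  exists2 d, 0 < d & forall x', two_irrational x' -> `|x' - x| < d -> `|F x' - F x| < e.
Hypothesis h01 : h 0 != h 1.

Definition clamp (x : X) : X := \row_j if (j < 2)%N then r0 else Num.max 0 (Num.min 1 (x 0 j)).

Lemma clamp_irr x : two_irrational (clamp x).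
Proof.
exists (@Ordinal n 0 isT), (@Ordinal n 1 isT); split=> //; by rewrite mxE.
Qed.

Lemma clamp_lip x y : `|clamp x - clamp y| <= `|x - y|.
Proof.
apply/norm_rV_le => // j; rewrite !mxE; case: ifP => _; first by rewrite subrr normr0.
apply: le_trans (max0_dist _ _) _; have := coord_le_norm (x - y) j; rewrite !mxE; apply: le_trans.
case: (lerP 1 (x 0 j)) => a; case: (lerP 1 (y 0 j)) => b //; rewrite ?subrr ?normr0 //.
- by rewrite !ger0_norm; lra.
- by rewrite !ler0_norm; lra.
Qed.

Local Notation Phi x := (F (clamp x)).

Lemma Phi_cont x : contat (fun y => Phi y) x.
Proof.
move=> e e0; have [d d0 hd] := cF (clamp_irr x) e0; exists d => // y yx.
apply: hd; first exact: clamp_irr.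
exact: le_lt_trans (clamp_lip _ _) yx.
Qed.

Lemma gPhi x (j : 'I_n) : (1 < j)%N -> g (Phi x) 0 j = h (Num.max 0 (Num.min 1 (x 0 j))).
Proof. by move=> j1; rewrite gF ?mxE ?mxE; [rewrite ltnNge j1 | exact: clamp_irr]. Qed.

Lemma covdimX_lower : ~ covdimX_le K m.
Proof.
move=> dimK.
have d10 : 0 < `|h 0 - h 1| / 2 by rewrite divr_gt0 // normr_gt0 subr_eq0.
set d1 := _ / 2 in d10.
pose W (c x : X) : Prop := `|g x - c| < d1.
have [||cs hcs] := @cK X W.
- move=> c x Kx xc; have e0 : 0 < d1 - `|g x - c| by rewrite subr_gt0.
  have [d d0 hd] := cg x e0; exists d => // y Ky /hd yx; rewrite /W.
  have -> : g y - c = (g y - g x) + (g x - c) by rewrite addrA subrK.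
  by apply: le_lt_trans (ler_normD _ _) _; rewrite -ltrBrDr.
- by move=> x Kx; exists (g x); rewrite /W subrr normr0.
have [|Vs [[oV cV] rV mV]] := dimK [seq W c | c <- cs].
- split.
    move=> U /List.in_map_iff [c [<- _]] x Kx xc; have e0 : 0 < d1 - `|g x - c| by rewrite subr_gt0.
    have [d d0 hd] := cg x e0; exists d => // y Ky /hd yx; rewrite /W.
    have -> : g y - c = (g y - g x) + (g x - c) by rewrite addrA subrK.
    by apply: le_lt_trans (ler_normD _ _) _; rewrite -ltrBrDr.
  move=> x Kx; have [c [ccs xc]] := hcs x Kx; exists (W c); split=> //.
  by apply/List.in_map_iff; exists c.
pose V j := nth (fun=> False) Vs j.
have smallV j x y : (j < size Vs)%N -> V j (Phi x) -> V j (Phi y) -> `|g (Phi x) - g (Phi y)| < `|h 0 - h 1|.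
  move=> jV Vx Vy; have [U [/List.in_map_iff [c [<- _]] hU]] := rV _ (nth_In (fun=> False) jV).
  have hx := hU _ (FK (clamp_irr x)) Vx; have hy := hU _ (FK (clamp_irr y)) Vy; rewrite /W in hx hy.
  have -> : g (Phi x) - g (Phi y) = (g (Phi x) - c) - (g (Phi y) - c) by rewrite opprB addrA subrK.
  by apply: le_lt_trans (ler_normB _ _) _; move: hx hy; rewrite /d1; lra.
have /choice [d hd] : forall x, exists p : R * nat, [/\ 0 < p.1, (p.2 < size Vs)%N &
    forall y, `|y - x| < 2 * p.1 -> V p.2 (Phi y)].
  move=> x; have Kx := FK (clamp_irr x); have [U [UV Ux]] := cV _ Kx.
  have [j jV jU] := In_nth_ex (fun=> False) UV.
  have [e e0 he] := oV _ UV _ Kx Ux; have [r r1 hr] := Phi_cont x e0.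
  exists (r / 2, j); split=> //=; first lra.
  by move=> y yx; rewrite /V jU; apply: he; [apply: FK (clamp_irr y) | apply: hr; lra].
have dp z : 0 < (d z).1 by case: (hd z).
have [s hs] := gauge_compact 1 dp; have [e e0 he] := seq_gauge s dp.
have leb x : `|x| <= 1 -> exists j, (j < size Vs)%N /\ forall y, `|y - x| < e -> V j (Phi y).
  move=> /hs [z zs xz]; have [_ h1 h2] := hd z; exists (d z).2; split=> // y yx; apply: h2.
  have -> : y - z = (y - x) + (x - z) by rewrite addrA subrK.
  by apply: le_lt_trans (ler_normD _ _) _; have := he z zs; lra.
have ei : 0 <= e^-1 by rewrite invr_ge0 ltW.
have /andP [_] := truncn_itv ei; set N0 := Num.truncn _ => hN.
have Np : 0 < N0.+1%:R :> R by rewrite ltr0n.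
have hN' : N0.+1%:R^-1 < e by rewrite invf_plt ?posrE.
pose pt (v : nat -> nat) : X := \row_j ((minn (v (j - 2)%N) N0.+1)%:R / N0.+1%:R).
have pt1 v : `|pt v| <= 1.
  apply/norm_rV_le => // j; rewrite mxE ger0_norm; last by rewrite divr_ge0.
  by rewrite ler_pdivrMr // mul1r ler_nat geq_minr.
have /choice [w hw] : forall v, exists j, (j < size Vs)%N /\ forall y, `|y - pt v| < e -> V j (Phi y).
  by move=> v; apply: leb.
have wpt v : V (w v) (Phi (pt v)) by apply: (hw v).2; rewrite subrr normr0.
pose meets j i := `[< exists y, V j (Phi y) /\ forall l : 'I_n, l = i.+2 :> nat -> y 0 l = 0 >].
pose lab' j := find (meets j) (iota 0 m.+1).
have labA v i : v i = 0%N -> (lab' (w v) <= i)%N.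
  move=> vi; case: (ltnP i m.+1) => im; last first.
    by apply: leq_trans im; have := find_size (meets (w v)) (iota 0 m.+1); rewrite size_iota.
  rewrite leqNgt; apply/negP => /(before_find 0%N); rewrite nth_iota // add0n => /asboolP; apply.
  by exists (pt v); split=> // l li; rewrite mxE li subSS subSS subn0 vi min0n mul0r.
have labB v i : (i < m.+1)%N -> v i = N0.+1 -> lab' (w v) <> i.
  move=> im vi E; have hm : has (meets (w v)) (iota 0 m.+1) by rewrite has_find size_iota -/(lab' _) E.
  have := nth_find 0%N hm; rewrite -/(lab' _) E nth_iota // add0n => /asboolP [y [Vy y0]].
  have im3 : (i.+2 < n)%N by [].
  have := smallV _ _ _ (hw v).1 Vy (wpt v); rewrite ltNge => /negP; apply.
  have := coord_le_norm (g (Phi y) - g (Phi (pt v))) (Ordinal im3); rewrite !mxE !gPhi //.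
  rewrite y0 // mxE /= subSS subSS subn0 vi minnn divff ?lt0r_neq0 // minxx.
  rewrite (_ : Num.min 1 0 = 0 :> R); last by apply/min_idPr.
  by rewrite maxxx (_ : Num.max 0 1 = 1 :> R) //; apply/max_idPr.
have [x /= hx] := kuhn labA labB.
have /choice [k hk] : forall c, exists k, (c <= m.+1)%N -> lab' (w (vtx x k)) = c.
  by move=> c; case: (leqP c m.+1) => [/hx [k _ kc]|_]; [exists k | exists 0%N].
have close k0 : `|pt (vtx x 0) - pt (vtx x k0)| < e.
  apply: le_lt_trans hN'; apply/norm_rV_le; first by rewrite invr_ge0.
  move=> j; rewrite !mxE -mulrBl normrM [X in _ * X]ger0_norm ?invr_ge0 // -[leRHS]mul1r ler_pM2r ?invr_gt0 //.
  rewrite /vtx; case: insubP => [i _ _|_]; last by rewrite subrr normr0.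
  rewrite ltn0 addn0; move: (x.1 i : nat) (x.2 i < k0)%N => a b.
  case: (leqP N0.+1 a) => aN.
    by rewrite !(minn_idPr _) ?subrr ?normr0 // (leq_trans aN) // leq_addr.
  rewrite (minn_idPl _); last by case: b; lia.
  by rewrite natrD opprD addNKr normrN; case: b; rewrite /= ?normr1 ?normr0.
have Ky := FK (clamp_irr (pt (vtx x 0))).
have [l [sl hl]] := mV _ Ky.
pose ws := [seq w (vtx x (k c)) | c <- iota 0 m.+2].
have uw : uniq ws.
  rewrite map_inj_in_uniq ?iota_uniq // => c c'; rewrite !mem_iota !add0n /= !ltnS => cm cm' E.
  by rewrite -(hk c cm) -(hk c' cm') E.
have : (size ws <= size l)%N.
  apply: uniq_leq_size uw _ => _ /mapP [c _ ->]; apply: hl; first exact: (hw _).1.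
  exact: (hw _).2 (close _).
by rewrite size_map size_iota => h1; have := leq_trans h1 sl; rewrite ltnn.
Qed.

End LowerBound.

(** * The compactification *)

Lemma compactification (R : realType) (n : nat) : (1 < n)%N ->
  exists (K : 'rV[R]_n -> Prop) (F G : 'rV[R]_n -> 'rV[R]_n), [/\ compactX K, covdimX_le K n.-2,
    if n is m.+3 then ~ covdimX_le K m else exists x, K x,
    (forall x, two_irrational x -> K (F x)) /\
    (forall y e, K y -> 0 < e -> exists2 x, two_irrational x & `|F x - y| < e) &
    forall x, two_irrational x -> [/\ G (F x) = x, contat G (F x) &
      forall e, 0 < e -> exists2 d, 0 < d &
        forall x', two_irrational x' -> `|x' - x| < d -> `|F x' - F x| < e]].
Proof.
move=> n2; have i0 : 'I_n by apply: (Ordinal (ltnW n2)).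
have [F [g [h [k [[ch [hk ck]] cg gF cF tF]]]]] := nobeling_embedding R i0.
have [r0 r0_irr] := irrational_ex R.
pose K (y : 'rV[R]_n) := forall e, 0 < e -> exists2 x, two_irrational x & `|F x - y| < e.
have FK x : two_irrational x -> K (F x) by move=> hx e e0; exists x => //; rewrite subrr normr0.
have cK : compactX K.
  apply: (@closed_bounded_compactX _ _ _ 3).
    move=> y /(_ 1 ltr01) [x hx yx]; have [_ h2] := gF x hx.
    have -> : y = F x - (F x - y) by rewrite subKr.
    by apply: le_trans (ler_normB _ _) _; lra.
  move=> y nK; have [e e0 he] : exists2 e : R, 0 < e & forall x, two_irrational x -> e <= `|F x - y|.
    apply: contrapT => h'; apply: nK => e e0; apply: contrapT => h''; apply: h'; exists e => // x hx.
    by rewrite leNgt; apply/negP => lt; apply: h''; exists x.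
  exists (e / 2); first by lra.
  move=> z zy Kz; have e2 : 0 < e / 2 by lra.
  have [x hx xz] := Kz _ e2; have := he x hx.
  have -> : F x - y = (F x - z) + (z - y) by rewrite addrA subrK.
  by move=> /le_trans /(_ (ler_normD _ _)); lra.
exists K, F, (fun y => \row_j k (g y 0 j)); split=> //.
- apply: covdimX_upper => // y Ky i q yq; have [eta eta0 ht] := tF i q.
  have [x hx xy] := Ky eta eta0; apply: (ht x hx) => j ji; rewrite /= mxE -(yq j ji).
  by have := coord_le_norm (F x - y) j; rewrite !mxE => /le_trans; apply; apply: ltW.
- case: n n2 i0 F g cg gF cF tF K FK cK => [|[|[|m]]] // n2 i0 F g cg gF cF tF K FK cK.
    exists (F (\row_j r0)); apply: FK; exists (@Ordinal 2 0 isT), (@Ordinal 2 1 isT); split=> //; by rewrite mxE.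
  apply: (covdimX_lower cK cg r0_irr FK _ cF (h := h)); first by move=> x /gF [].
  by apply/eqP => /(congr1 k); rewrite !hk => /eqP; rewrite eq_sym oner_eq0.
- by split=> // y e Ky e0; apply: Ky.
- move=> x hx; have [gE _] := gF x hx; split.
  + by rewrite gE; apply/rowP => j; rewrite !mxE hk.
  + apply: contat_row => j; have -> : (fun y => (\row_j k (g y 0 j)) 0 j) = k \o ((fun z : 'rV[R]_n => z 0 j) \o g).
      by apply/funext => y; rewrite mxE.
    apply: contat_comp; first by apply: contat_comp (cg _) _; exact: contat_coord.
    by rewrite /= gE mxE; exact: ck.
  + by move=> e; apply: cF.
Qed.

Local Notation R := Rdefinitions.R.

Lemma IZR_of_nat (k : nat) : Rdefinitions.IZR (BinInt.Z.of_nat k) = k%:R.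
Proof. by rewrite -RIneq.INR_IZR_INZ INRE. Qed.

Lemma IZR_Zpos (p : BinNums.positive) : Rdefinitions.IZR (BinNums.Zpos p) = (nat_of_pos p)%:R.
Proof. by rewrite IZRposE INRE. Qed.

Lemma is_rational_rational (r : R) : is_rational r <-> rational r.
Proof.
split.
  case=> -[z d] ->; rewrite /Rdefinitions.Q2R /=.
  have [k hk] : exists k : int, Rdefinitions.IZR z = k%:~R.
    case: z => [|p|p]; first by exists 0.
      by exists (nat_of_pos p)%:Z; rewrite IZR_Zpos.
    by exists (- (nat_of_pos p)%:Z); rewrite -BinInt.Pos2Z.opp_pos RIneq.opp_IZR IZR_Zpos RoppE rmorphN.
  exists (k%:~R / (nat_of_pos d)%:R).
  by rewrite fmorph_div /= ratr_int ratr_nat hk IZR_Zpos.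
case=> q ->; rewrite -[q]divq_num_den fmorph_div /= !ratr_int.
have := denq_gt0 q; case: (denq q) => // k k0.
have [z hz] : exists z, Rdefinitions.IZR z = (numq q)%:~R.
  case: (numq q) => l; first by exists (BinInt.Z.of_nat l); rewrite IZR_of_nat.
  by exists (BinInt.Z.opp (BinInt.Z.of_nat l.+1)); rewrite RIneq.opp_IZR IZR_of_nat RoppE NegzE rmorphN.
exists (QArith_base.Qmake z (BinPos.Pos.of_nat k)); rewrite /Rdefinitions.Q2R /= hz.
have -> : Rdefinitions.IZR (BinNums.Zpos (BinPos.Pos.of_nat k)) = k%:R; last by [].
rewrite -IZR_of_nat; congr Rdefinitions.IZR; case: k k0 => // k _.
by rewrite -(Znat.positive_nat_Z (BinPos.Pos.of_nat k.+1)) Pnat.Nat2Pos.id.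
Qed.

Section Transport.
Variable n : nat.
Local Notation X := 'rV[R]_n.

Definition ord_of (i : Fin.t n) : 'I_n := Ordinal (introT ssrnat.ltP (proj2_sig (Fin.to_nat i))).
Definition fin_of (j : 'I_n) : Fin.t n := Fin.of_nat_lt (elimT ssrnat.ltP (ltn_ord j)).

Lemma ord_ofK : cancel ord_of fin_of.
Proof.
move=> i; rewrite -[RHS]Fin.of_nat_to_nat_inv /fin_of /=.
by congr (Fin.of_nat_lt _); apply: Prop_irrelevance.
Qed.

Lemma fin_ofK : cancel fin_of ord_of.
Proof. by move=> j; apply/val_inj; rewrite /= /fin_of Fin.to_nat_of_nat. Qed.

Definition row_of (x : Rn n) : X := \row_j x (fin_of j).
Definition fun_of (v : X) : Rn n := fun i => v 0 (ord_of i).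

Lemma row_ofK : cancel row_of fun_of.
Proof. by move=> x; apply/funext => i; rewrite /fun_of mxE ord_ofK. Qed.

Lemma fun_ofK : cancel fun_of row_of.
Proof. by move=> v; apply/rowP => j; rewrite mxE /fun_of fin_ofK. Qed.

Lemma nearP (x y : Rn n) (r : R) : 0 < r -> Defs.near x y r <-> `|row_of y - row_of x| < r.
Proof.
move=> r0; rewrite distrC; split.
  move=> h; apply/norm_rV_lt => // j; have := h (fin_of j).
  by rewrite RminusE RabsE !mxE => /RltP.
move=> /(norm_rV_lt _ r0) h i; rewrite RminusE RabsE; apply/RltP.
by have := h (ord_of i); rewrite !mxE ord_ofK.
Qed.

Variable K : X -> Prop.
Local Notation K' := (fun x : Rn n => K (row_of x)).

Lemma relopen_row (U : subset_of n) : relopen K' U -> relopenX K (fun v => U (fun_of v)).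
Proof.
move=> oU x Kx Ux; have [|r [/RltP r0 hr]] := oU (fun_of x) _ Ux; first by rewrite fun_ofK.
exists r => // y Ky yx; apply: hr; first by rewrite fun_ofK.
by apply/nearP => //; rewrite !fun_ofK.
Qed.

Lemma relopen_fun (U : X -> Prop) : relopenX K U -> relopen K' (fun x => U (row_of x)).
Proof.
move=> oU x Kx Ux; have [r r0 hr] := oU _ Kx Ux; exists r; split; first exact/RltP.
by move=> y Ky /(nearP _ _ r0); apply: hr.
Qed.

Lemma compact_fun : compactX K -> compact_set K'.
Proof.
move=> cK I U oU cov.
have [||l hl] := cK I (fun i v => U i (fun_of v)).
- by move=> i; apply: relopen_row.
- by move=> v Kv; apply: cov; rewrite fun_ofK.
exists l => x Kx; have [i [il Ui]] := hl _ Kx; exists i; split=> //.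
by rewrite row_ofK in Ui.
Qed.

Lemma cover_row Us : finite_open_cover K' Us -> coverX K [seq (fun v => U (fun_of v)) | U : subset_of n <- Us].
Proof.
move=> [oU cU]; split.
  by move=> _ /List.in_map_iff [U [<- UU]]; apply: relopen_row; exact: oU.
move=> v Kv; have [|U [UU Uv]] := cU (fun_of v); first by rewrite fun_ofK.
by exists (fun v => U (fun_of v)); split=> //; apply/List.in_map_iff; exists U.
Qed.

Lemma cover_fun Us : coverX K Us -> finite_open_cover K' [seq (fun x => U (row_of x)) | U : X -> Prop <- Us].
Proof.
move=> [oU cU]; split.
  by move=> _ /List.in_map_iff [U [<- UU]]; apply: relopen_fun; exact: oU.
move=> v Kv; have [U [UU Uv]] := cU _ Kv.
by exists (fun x => U (row_of x)); split=> //; apply/List.in_map_iff; exists U.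
Qed.

Lemma nth_listE (T : Type) (x0 : T) l j : List.nth j l x0 = nth x0 l j.
Proof. by elim: l j => [|a l IH] [|j] //=. Qed.

Lemma covdim_le_fun k : covdimX_le K k -> covdim_le K' k.
Proof.
move=> dK Us cU; have [Vs [cV rV mV]] := dK _ (cover_row cU).
exists [seq (fun x => V (row_of x)) | V : X -> Prop <- Vs]; split; first exact: cover_fun.
split.
  move=> _ /List.in_map_iff [V [<- VV]]; have [_ [/List.in_map_iff [U [<- UU]] hU]] := rV V VV.
  by exists U; split=> // x Kx Vx; have := hU _ Kx Vx; rewrite row_ofK.
move=> x Kx; have [l [sl hl]] := mV _ Kx; exists l; split; first exact/ssrnat.leP.
move=> j; rewrite List.length_map => /ssrnat.ltP jV; rewrite nth_listE (nth_map (fun=> False)) // => Vx.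
by apply/In_mem; apply: hl.
Qed.

Lemma covdim_le_row k : covdim_le K' k -> covdimX_le K k.
Proof.
move=> dK Us cU; have [Vs [cV [rV mV]]] := dK _ (cover_fun cU).
exists [seq (fun v => V (fun_of v)) | V : subset_of n <- Vs]; split; first exact: cover_row.
  move=> _ /List.in_map_iff [V [<- VV]]; have [_ [/List.in_map_iff [U [<- UU]] hU]] := rV V VV.
  exists U; split=> // x Kx Vx; have := hU (fun_of x); rewrite fun_ofK; exact.
move=> x Kx; have [|l [sl hl]] := mV (fun_of x); first by rewrite fun_ofK.
exists l; split; first exact/ssrnat.leP.
move=> j; rewrite size_map => jV; rewrite (nth_map empty_set) // => Vx.
by apply/In_mem; apply: hl; [exact/ssrnat.ltP | rewrite nth_listE].
Qed.

Lemma two_irrational_Nobeling (x : Rn n) : (1 < n)%N ->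
  Nobeling n (Nat.sub n 2) x <-> two_irrational (row_of x).
Proof.
move=> n2; split.
  move=> [l [/ssrnat.leP sl hl]]; pose S := [set j | `[< rational (row_of x 0 j) >]]%SET.
  have cS : (#|S| <= n - 2)%N.
    have {}sl : (size l <= n - 2)%N := sl.
    apply: leq_trans sl; rewrite cardE -(size_map ord_of l); apply: uniq_leq_size; first exact: enum_uniq.
    move=> j; rewrite mem_enum inE => /asboolP; rewrite mxE => /is_rational_rational /hl h.
    by rewrite -[j]fin_ofK; apply/In_mem; apply: List.in_map.
  have : (1 < #|~: S|)%N by have := cardsC S; rewrite card_ord; move: #|S| #|~: S| cS => a b; lia.
  move=> /card_gt1P [i [j [iS jS ij]]]; exists i, j.
  by split=> //; [move: iS | move: jS]; rewrite !inE => /asboolPn.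
move=> [i [j [ij xi xj]]].
exists [seq fin_of k | k <- enum (~: [set i; j]%SET)]; split.
  rewrite List.length_map; apply/ssrnat.leP.
  have E : (2 + size (enum (~: [set i; j]%SET)) = n)%N.
    by rewrite -cardE -[RHS]card_ord -(cardsC [set i; j]%SET) cards2 ij.
  suff : (size (enum (~: [set i; j]%SET)) <= n - 2)%N by [].
  lia.
move=> k /is_rational_rational rk; apply/List.in_map_iff; exists (ord_of k); split; first exact: ord_ofK.
apply/In_mem; rewrite mem_enum !inE; apply/negP => /orP [/eqP E|/eqP E].
  by apply: xi; rewrite -E mxE ord_ofK.
by apply: xj; rewrite -E mxE ord_ofK.
Qed.

End Transport.

Lemma nobeling_compactification (n : nat) (n2 : (1 < n)%N) :
  exists K : subset_of n,
    compact_set K /\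
    covdim_eq K (Nat.sub n 2) /\
    exists D : subset_of n,
      dense_in D K /\ homeomorphic D (Nobeling n (Nat.sub n 2)).
Proof.
have [K [F [G [cK dK lK [FK Fd] hF]]]] := compactification R n2.
exists (fun x => K (row_of x)); split; first exact: compact_fun.
split.
  have dK' := covdim_le_fun dK; split; first by move: dK'; rewrite -subn2.
  case: n n2 K F G cK dK lK FK Fd hF dK' => [|[|[|m]]] // n2 K F G cK dK lK FK Fd hF dK'.
    by have [v Kv] := lK; exists (fun_of v); rewrite fun_ofK.
  by move=> /covdim_le_row.
exists (fun x => exists2 z, two_irrational z & x = fun_of (F z)); split.
  split; first by move=> _ [z hz ->]; rewrite fun_ofK; exact: FK.
  move=> y Ky r /RltP r0; have [z hz zy] := Fd _ _ Ky r0.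
  exists (fun_of (F z)); split; first by exists z.
  by apply/nearP => //; rewrite fun_ofK.
exists (fun x => fun_of (G (row_of x))), (fun x => fun_of (F (row_of x))); split; [|split; [|split]].
- split.
    move=> _ [z hz ->]; apply/two_irrational_Nobeling => //; rewrite !fun_ofK.
    by have [-> _ _] := hF z hz.
  move=> _ [z hz ->] e /RltP e0; have [_ cG _] := hF z hz; have [d d0 hd] := cG e e0.
  exists d; split; first exact/RltP.
  move=> y _ /(nearP _ _ d0); rewrite fun_ofK => /hd h; apply/nearP => //; rewrite !fun_ofK; exact: h.
- split; first by move=> y /(@two_irrational_Nobeling n _ n2) hy; exists (row_of y).
  move=> x /(@two_irrational_Nobeling n _ n2) hx e /RltP e0.
  have [_ _ cF] := hF _ hx; have [d d0 hd] := cF e e0.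
  exists d; split; first exact/RltP.
  move=> y /(@two_irrational_Nobeling n _ n2) hy /(nearP _ _ d0) yx.
  by apply/nearP => //; rewrite !fun_ofK; apply: hd.
- by move=> _ [z hz ->]; rewrite !fun_ofK; have [-> _ _] := hF z hz.
- move=> y /(@two_irrational_Nobeling n _ n2) hy; rewrite !fun_ofK; have [-> _ _] := hF _ hy.
  exact: row_ofK.
Qed.

End Compactification.

From Stdlib Require Import Reals QArith Qreals List.
From Stdlib Require Vectors.Fin.
Open Scope R_scope.

Theorem mainTheorem1 (n : nat) (hn : (2 <= n)%nat) :
  exists K : subset_of n,
    compact_set K /\
    covdim_eq K (n - 2) /\
    exists D : subset_of n,
      dense_in D K /\ homeomorphic D (Nobeling n (n - 2)).
Proof.
exact (@Compactification.nobeling_compactification n (ssrbool.introT ssrnat.ltP hn)).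
Qed.
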